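(* Let $n\ge1$ and let $\Pi_n$ be the preprojective algebra of type $A_n$ over a field $K$. The set of internal $n$-simplices of $\Delta_n\times\Delta_1$ and the set of isomorphism classes of indecomposable $\tau$-rigid pairs over $\Pi_n$ are in bijection with each other. Moreover, the set of internal $n$-simplices of $\Delta_n\times\Delta_1$ and the set of isomorphism classes of indecomposable two-term presilting complexes over $\Pi_n$ are also in bijection with each other.
   Context: Preprojective algebra: $Q_n$ is the quiver with vertices $1,\dots,n$ and arrows $\alpha_i\colon i\to i+1$, $\beta_i\colon i+1\to i$ for $1\le i\le n-1$. Arrows are composed left to right. $\Pi_n$ is $KQ_n$ modulo the relations $\beta_i\alpha_i=\alpha_{i+1}\beta_{i+1}$ for $1\le i\le n-2$ and $\alpha_1\beta_1=0=\beta_{n-1}\alpha_{n-1}$ (so $\Pi_1=K$). Modules are finite-dimensional right modules. A pair $(M,P)$ of $\Pi_n$-modules with $P$ projective is $\tau$-rigid if $\operatorname{Hom}(M,\tau M)=0$ ($\tau$ the Auslander–Reiten translate) and $\operatorname{Hom}(P,M)=0$. It is indecomposable if it is of the form $(M,0)$ with $M$ indecomposable or $(0,P)$ with $P$ indecomposable. $\mathcal{K}=\mathsf{K}^{\mathsf b}(\mathsf{proj}\,\Pi_n)$ is the homotopy category of bounded complexes of finitely generated projective $\Pi_n$-modules. A two-term complex is one concentrated in degrees $-1,0$; $T\in\mathcal K$ is presilting if $\operatorname{Hom}_{\mathcal K}(T,T[i])=0$ for all $i>0$. Prism: with $e_0,\dots,e_n$ the standard basis of $\mathbb{R}^{n+1}$,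 $a_i=(e_i,1,0)$ and $b_i=(e_i,0,1)$ in $\mathbb{R}^{n+3}$; $\Delta_n\times\Delta_1$ is the convex hull of $V=\{a_0,\dots,a_n,b_0,\dots,b_n\}$. An $n$-simplex in $\Delta_n\times\Delta_1$ is the convex hull of $n+1$ affinely independent elements of $V$; it is internal if it is not contained in the boundary of $\Delta_n\times\Delta_1$. *)

(* Defs.v *)
From HB Require Import structures.
From mathcomp Require Import all_boot all_order all_algebra.
From mathcomp Require Import finmap.
From mathcomp Require Import monalg.
From mathcomp Require Import boolp classical_sets functions reals topology normedtype.

Set Implicit Arguments.
Unset Strict Implicit.
Unset Printing Implicit Defensive.

Import Order.TTheory GRing.Theory Num.Theory.
Import numFieldTopology.Exports.
Local Open Scope ring_scope.

Record quiver := Quiver {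
  vertex : finType;
  arrow : finType;
  source : arrow -> vertex;
  target : arrow -> vertex }.

Section Paths.
Variable Q : quiver.

Fixpoint walk (v : vertex Q) (s : seq (arrow Q)) : bool :=
  if s is a :: s' then (source a == v) && walk (target a) s' else true.

(* A path is its first vertex followed by its arrows, listed in the order in
   which they are traversed; (v, [::]) is the trivial path at v. *)
Record qpath :=
  QPath { pval : vertex Q * seq (arrow Q); _ : walk pval.1 pval.2 }.
HB.instance Definition _ := [isSub for pval].
HB.instance Definition _ := [Choice of qpath by <:].

Definition pstart (p : qpath) : vertex Q := (pval p).1.
Definition parrows (p : qpath) : seq (arrow Q) := (pval p).2.
Definition pend (p : qpath) : vertex Q :=
  last (pstart p) (map (@target Q) (parrows p)).

Definition ptriv (v : vertex Q) : qpath := @QPath (v, [::]) isT.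

Lemma walk1 (a : arrow Q) : walk (source a) [:: a].
Proof. by rewrite /= eqxx. Qed.
Definition parr (a : arrow Q) : qpath := @QPath (source a, [:: a]) (walk1 a).

Lemma parr_neq_triv a v : (parr a == ptriv v) = false.
Proof. by apply/eqP => /(congr1 parrows). Qed.

Lemma walk_cat v s1 s2 :
  walk v (s1 ++ s2) = walk v s1 && walk (last v (map (@target Q) s1)) s2.
Proof. by elim: s1 v => //= a s1 IH v; rewrite IH andbA. Qed.

Definition pcat (p q : qpath) : option qpath :=
  if pend p == pstart q then insub (pstart p, parrows p ++ parrows q) else None.

Lemma pcatP (p q : qpath) : pend p = pstart q ->
  {r | pcat p q = Some r & [/\ pstart r = pstart p, pend r = pend q
                           & parrows r = parrows p ++ parrows q]}.
Proof.
move=> e; rewrite /pcat e eqxx.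
have w : walk (pstart p) (parrows p ++ parrows q).
  rewrite walk_cat -/(pend p) e.
  by move: (valP p) (valP q); rewrite -/(pstart p) -/(parrows p) => -> ->.
exists (@QPath (pstart p, parrows p ++ parrows q) w).
  by rewrite insubT.
by split; rewrite // /pend /pstart /parrows /= map_cat last_cat -/(pend p) e.
Qed.

Lemma pcatN (p q : qpath) : pend p != pstart q -> pcat p q = None.
Proof. by rewrite /pcat => /negPf ->. Qed.

Lemma qpathP (p q : qpath) :
  pstart p = pstart q -> parrows p = parrows q -> p = q.
Proof.
by move=> e1 e2; apply: val_inj; rewrite [LHS]surjective_pairing
   [RHS]surjective_pairing; congr (_, _).
Qed.

Lemma pcatA (p q r : qpath) :
  obind (pcat p) (pcat q r) = obind (pcat^~ r) (pcat p q).
Proof.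
case: (eqVneq (pend p) (pstart q)) => [e1|n1]; last first.
  rewrite (pcatN n1) /=.
  case: (eqVneq (pend q) (pstart r)) => [e2|n2]; last by rewrite (pcatN n2).
  have [qr -> [s _ _]] /= := pcatP e2; by rewrite pcatN // s.
have [pq -> [s1 t1 a1]] /= := pcatP e1.
case: (eqVneq (pend q) (pstart r)) => [e2|n2]; last first.
  by rewrite (pcatN n2) pcatN // t1.
have [qr -> [s2 t2 a2]] /= := pcatP e2.
have e3 : pend p = pstart qr by rewrite s2.
have e4 : pend pq = pstart r by rewrite t1.
have [x -> [sx _ ax]] := pcatP e3; have [y -> [sy _ ay]] := pcatP e4.
by congr Some; apply: qpathP; rewrite ?sx ?sy ?s1 // ax ay a1 a2 catA.
Qed.

Lemma pcat_trivl v q : pcat (ptriv v) q = if v == pstart q then Some q else None.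
Proof.
case: eqP => [e|/eqP n]; last by rewrite pcatN.
have [r -> [sr _ ar]] := @pcatP (ptriv v) q e.
by congr Some; apply: qpathP => //; rewrite sr.
Qed.

Lemma pcat_trivr v p : pcat p (ptriv v) = if v == pend p then Some p else None.
Proof.
rewrite eq_sym; case: eqP => [e|/eqP n]; last by rewrite pcatN.
have [r -> [sr _ ar]] := @pcatP p (ptriv v) e.
by congr Some; apply: qpathP => //; rewrite ar cats0.
Qed.

Lemma pcat_triv p q r v : pcat p q = Some r ->
  (r == ptriv v) = (p == ptriv v) && (q == ptriv v).
Proof.
case: (eqVneq (pend p) (pstart q)) => [e|n]; last by rewrite (pcatN n).
have [r' -> [sr tr ar]] := pcatP e => -[<-] {r}.
apply/eqP/andP => [er|[/eqP ep /eqP eq]]; last first.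
  by apply: qpathP; rewrite ?sr ?ar ep ?eq.
move: sr ar; rewrite er => sp.
case ep: (parrows p) => [|//] /= eq; split; apply/eqP.
  exact: qpathP.
by apply: qpathP => //; rewrite -e /pend ep /= -sp.
Qed.
End Paths.

Definition pathalg (K : fieldType) (Q : quiver) := {malg K[qpath Q]}.
HB.instance Definition _ K Q := GRing.Lmodule.on (pathalg K Q).

HB.lock Definition bpath (K : fieldType) (Q : quiver) (p : qpath Q) :
  pathalg K Q := << p >>.

(* Paths are composed from left to right: the product of p and q is p followed
   by q, and 0 when p does not end where q starts. *)
HB.lock Definition pmul (K : fieldType) (Q : quiver) (f g : pathalg K Q) :
    pathalg K Q :=
  \sum_(p <- msupp f) \sum_(q <- msupp g)
    (f@_p * g@_q) *: oapp (@bpath K Q) 0 (pcat p q).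

Section PathAlgebra.
Variables (K : fieldType) (Q : quiver).
Local Notation pathalg := (pathalg K Q).
Local Notation bpath := (@bpath K Q).
Local Notation pmul := (@pmul K Q).
Implicit Types f g h : pathalg.

Definition pone : pathalg := \sum_(v : vertex Q) bpath (ptriv v).

Lemma mcoeff_bpath p q : (bpath p)@_q = (p == q)%:R :> K.
Proof. by rewrite bpath.unlock; exact: mcoeffU. Qed.

Lemma msupp_bpath p : msupp (bpath p) = [fset p]%fset.
Proof. by rewrite bpath.unlock msuppU oner_eq0. Qed.

Definition plin (V : lmodType K) (u : qpath Q -> V) f : V :=
  \sum_(p <- msupp f) f@_p *: u p.

Lemma plinEw (V : lmodType K) (u : qpath Q -> V) (d : {fset qpath Q}) f :
  (msupp f `<=` d)%fset -> plin u f = \sum_(p <- d) f@_p *: u p.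
Proof.
by move=> le; rewrite /plin; apply: big_fset_incl => // p _ /mcoeff_outdom ->;
   rewrite scale0r.
Qed.

Lemma plin_is_linear (V : lmodType K) (u : qpath Q -> V) : linear (plin u).
Proof.
move=> c f g; pose d := (msupp f `|` msupp g)%fset.
have lef : (msupp f `<=` d)%fset by apply: fsubsetUl.
have leg : (msupp g `<=` d)%fset by apply: fsubsetUr.
have lefg : (msupp (c *: f + g) `<=` d)%fset.
  apply: fsubset_trans (msuppD_le _ _) _; apply: fsetSU; exact: msuppZ_le.
rewrite (plinEw u lef) (plinEw u leg) (plinEw u lefg) scaler_sumr -big_split /=.
by apply: eq_bigr => p _; rewrite mcoeffD mcoeffZ scalerDl scalerA.
Qed.
HB.instance Definition _ (V : lmodType K) (u : qpath Q -> V) :=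
  GRing.isLinear.Build K pathalg V _ (plin u) (plin_is_linear u).

Lemma plin_bpath (V : lmodType K) (u : qpath Q -> V) p : plin u (bpath p) = u p.
Proof. by rewrite /plin msupp_bpath big_seq_fset1 mcoeff_bpath eqxx scale1r. Qed.

Lemma pathalgE f : f = \sum_(p <- msupp f) f@_p *: bpath p.
Proof.
rewrite [LHS]monalgE; apply: eq_bigr => p _.
by apply/malgP => q; rewrite mcoeffZ mcoeff_bpath mcoeffU mulr_natr.
Qed.

Lemma linear_path_ext (V : lmodType K) (u v : {linear pathalg -> V}) :
  (forall p, u (bpath p) = v (bpath p)) -> u =1 v.
Proof.
move=> e f; rewrite [f]pathalgE !linear_sum; apply: eq_bigr => p _.
by rewrite !linearZ e.
Qed.

Definition pcat0 p q : pathalg := oapp bpath 0 (pcat p q).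

Lemma pmulEl f g : pmul f g = plin (fun p => plin (pcat0 p) g) f.
Proof.
rewrite pmul.unlock; apply: eq_bigr => p _; rewrite /plin scaler_sumr.
by apply: eq_bigr => q _; rewrite scalerA.
Qed.

Lemma pmulEr f g : pmul f g = plin (fun q => plin (pcat0^~ q) f) g.
Proof.
rewrite pmul.unlock exchange_big; apply: eq_bigr => p _; rewrite /plin scaler_sumr.
by apply: eq_bigr => q _; rewrite scalerA mulrC.
Qed.

Lemma pmul_linearl g : linear (pmul^~ g).
Proof. by move=> c f f'; rewrite !pmulEl linearP. Qed.
Lemma pmul_linearr f : linear (pmul f).
Proof. by move=> c g g'; rewrite !pmulEr linearP. Qed.

Lemma pmul_bpath p q : pmul (bpath p) (bpath q) = pcat0 p q.
Proof. by rewrite pmulEl !plin_bpath. Qed.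

#[local] Definition mL f : {linear pathalg -> pathalg} := HB.pack_for {linear pathalg -> pathalg}
  (pmul f) (GRing.isLinear.Build _ _ _ _ _ (pmul_linearr f)).
#[local] Definition mR g : {linear pathalg -> pathalg} := HB.pack_for {linear pathalg -> pathalg}
  (pmul^~ g) (GRing.isLinear.Build _ _ _ _ _ (pmul_linearl g)).

Lemma pmul0l f : pmul 0 f = 0. Proof. exact: (linear0 (mR f)). Qed.
Lemma pmul0r f : pmul f 0 = 0. Proof. exact: (linear0 (mL f)). Qed.

Lemma pmulA : associative pmul.
Proof.
have A1 p q r : pmul (bpath p) (pmul (bpath q) (bpath r))
              = pmul (pmul (bpath p) (bpath q)) (bpath r).
  rewrite !pmul_bpath /pcat0.
  have := pcatA p q r; case: (pcat q r) => [qr|]; case: (pcat p q) => [pq|] /=.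
  - by rewrite !pmul_bpath /pcat0 => ->.
  - by rewrite pmul_bpath /pcat0 => ->; rewrite pmul0l.
  - by rewrite pmul_bpath /pcat0 => <-; rewrite pmul0r.
  - by rewrite pmul0l pmul0r.
have A2 p q h : pmul (bpath p) (pmul (bpath q) h)
              = pmul (pmul (bpath p) (bpath q)) h.
  exact: (@linear_path_ext _ (mL (bpath p) \o mL (bpath q))
           (mL (pmul (bpath p) (bpath q))) (A1 p q)).
have A3 p g h : pmul (bpath p) (pmul g h) = pmul (pmul (bpath p) g) h.
  exact: (@linear_path_ext _ (mL (bpath p) \o mR h)
           (mR h \o mL (bpath p)) (fun q => A2 p q h)).
move=> f g h.
exact: (@linear_path_ext _ (mR (pmul g h)) (mR h \o mR g) (fun p => A3 p g h)).
Qed.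

Lemma pmul1l : left_id pone pmul.
Proof.
move=> f; apply: (@linear_path_ext _ (mL pone) idfun) => p.
rewrite -[mL _ _]/(mR _ _) /pone linear_sum /= (bigD1 (pstart p)) //= big1.
  by rewrite addr0 pmul_bpath /pcat0 pcat_trivl eqxx.
by move=> v /negPf n; rewrite pmul_bpath /pcat0 pcat_trivl n.
Qed.

Lemma pmul1r : right_id pone pmul.
Proof.
move=> f; apply: (@linear_path_ext _ (mR pone) idfun) => p.
rewrite -[mR _ _]/(mL _ _) /pone linear_sum /= (bigD1 (pend p)) //= big1.
  by rewrite addr0 pmul_bpath /pcat0 pcat_trivr eqxx.
by move=> v /negPf n; rewrite pmul_bpath /pcat0 pcat_trivr n.
Qed.

Lemma pmulDl : left_distributive pmul +%R.
Proof. by move=> f g h; exact: (linearD (mR h)). Qed.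
Lemma pmulDr : right_distributive pmul +%R.
Proof. by move=> f g h; exact: (linearD (mL f)). Qed.

HB.instance Definition _ := GRing.Zmodule_isPzRing.Build pathalg
  pmulA pmul1l pmul1r pmulDl pmulDr.

Lemma pathalg_scalerAl (c : K) f g : c *: (f * g) = (c *: f) * g.
Proof. exact: esym (linearZ_LR (mR g) c f). Qed.
Lemma pathalg_scalerAr (c : K) f g : c *: (f * g) = f * (c *: g).
Proof. exact: esym (linearZ_LR (mL f) c g). Qed.

Lemma mcoeff_ptriv_mul v f g : (f * g)@_(ptriv v) = f@_(ptriv v) * g@_(ptriv v).
Proof.
pose c h : K^o := h@_(ptriv v).
have cl : linear c by move=> a x y; rewrite /c mcoeffD mcoeffZ.
pose cL := HB.pack_for {linear pathalg -> K^o} c (GRing.isLinear.Build _ _ _ _ _ cl).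
have B p q : cL (bpath p * bpath q) = cL (bpath p) * cL (bpath q).
  rewrite [X in cL X]pmul_bpath /= /c /pcat0.
  case: (eqVneq (pend p) (pstart q)) => [e|n]; last first.
    rewrite (pcatN n) /= mcoeff0 !mcoeff_bpath.
    case: eqP => [ep|]; last by rewrite mul0r.
    case: eqP => [eq|]; last by rewrite mulr0.
    by rewrite ep eq eqxx in n.
  have [r er _] := pcatP e; rewrite er /= !mcoeff_bpath (pcat_triv v er).
  by case: eqP; case: eqP; rewrite ?mulr0 ?mul0r ?mulr1.
have B2 p y : cL (bpath p * y) = cL (bpath p) * cL y.
  exact: (@linear_path_ext _ (cL \o mL (bpath p))
             ( *:%R (cL (bpath p)) \o cL) (B p)).
suff /(_ f) : (cL \o mR g) =1 (( *:%R (cL g)) \o cL).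
  by rewrite /= /c mulrC.
apply: linear_path_ext => p /=; rewrite -[RHS]mulrC; exact: B2.
Qed.

Lemma mcoeff_ptriv1 v : (1 : pathalg)@_(ptriv v) = 1.
Proof.
rewrite -[1]/pone (raddf_sum (mcoeff (ptriv v))) (bigD1 v) //= mcoeff_bpath eqxx.
rewrite big1 ?addr0 // => w nwv; rewrite mcoeff_bpath.
by case: eqP => // -[e]; rewrite e eqxx in nwv.
Qed.

End PathAlgebra.

Inductive ideal_gen (A : pzRingType) (S : A -> Prop) : A -> Prop :=
| ideal_gen_rel x : S x -> ideal_gen S x
| ideal_gen0 : ideal_gen S 0
| ideal_genD x y : ideal_gen S x -> ideal_gen S y -> ideal_gen S (x + y)
| ideal_genMl a x : ideal_gen S x -> ideal_gen S (a * x)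
| ideal_genMr a x : ideal_gen S x -> ideal_gen S (x * a).

Section BoundQuiverAlgebra.
Variables (K : fieldType) (Q : quiver) (rel : pathalg K Q -> Prop).
Local Notation pathalg := (pathalg K Q).

Definition bideal : {pred pathalg} := fun x => `[< ideal_gen rel x >].

Lemma bidealP x : reflect (ideal_gen rel x) (x \in bideal).
Proof. exact: asboolP. Qed.

Lemma bidealMl a x : x \in bideal -> a * x \in bideal.
Proof. by move=> /bidealP ?; apply/bidealP; apply: ideal_genMl. Qed.
Lemma bidealMr a x : x \in bideal -> x * a \in bideal.
Proof. by move=> /bidealP ?; apply/bidealP; apply: ideal_genMr. Qed.

Lemma bideal_zmod_closed : zmod_closed bideal.
Proof.
split=> [|x y /bidealP Ix /bidealP Iy]; first by apply/bidealP; apply: ideal_gen0.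
by apply/bidealP; rewrite -mulN1r; apply: ideal_genD => //; apply: ideal_genMl.
Qed.
HB.instance Definition _ := GRing.isZmodClosed.Build pathalg bideal bideal_zmod_closed.

Lemma bidealZ c x : x \in bideal -> c *: x \in bideal.
Proof. by move=> ?; rewrite -[x]mul1r pathalg_scalerAl bidealMl. Qed.

(* The ideal is required to be proper because an algType is nontrivial. *)
Definition bquot of ~ ideal_gen rel 1 :=
  Quotient.quot (bideal : zmodClosed pathalg).

Section Instances.
Variable proper : ~ ideal_gen rel 1.
Local Notation B := (bquot proper).
Local Open Scope quotient_scope.

HB.instance Definition _ := GRing.Zmodule.on B.
HB.instance Definition _ := EqQuotient.on B.

Lemma bquot_eqP (x y : pathalg) : reflect (\pi_B x = \pi_B y) (x - y \in bideal).
Proof.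
apply: (iffP idP) => [|e].
  by rewrite (Quotient.idealrBE (bideal : zmodClosed pathalg)) => /eqP.
by rewrite (Quotient.idealrBE (bideal : zmodClosed pathalg)); apply/eqP.
Qed.

Lemma bquot_repr (x : pathalg) : repr (\pi_B x) - x \in bideal.
Proof. by apply/bquot_eqP; rewrite reprK. Qed.

Lemma bquot_piD x y : \pi_B (x + y) = \pi_B x + \pi_B y.
Proof. by rewrite !piE. Qed.

Definition bquot_one : B := \pi_B 1.
Definition bquot_mul (x y : B) : B := \pi_B (repr x * repr y).
Definition bquot_scale (c : K) (x : B) : B := \pi_B (c *: repr x).

Lemma bquot_piM x y : \pi_B (x * y) = bquot_mul (\pi_B x) (\pi_B y).
Proof.
apply: esym; apply/bquot_eqP; set x' := repr _; set y' := repr _.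
have -> : x' * y' - x * y = (x' - x) * y' + x * (y' - y).
  by rewrite mulrBl mulrBr addrA subrK.
by apply: rpredD; [apply: bidealMr|apply: bidealMl]; apply: bquot_repr.
Qed.

Lemma bquot_piZ c x : \pi_B (c *: x) = bquot_scale c (\pi_B x).
Proof. by apply: esym; apply/bquot_eqP; rewrite -scalerBr; apply: bidealZ; apply: bquot_repr. Qed.

Lemma bquot_ex (x : B) : exists a, x = \pi_B a.
Proof. by exists (repr x); rewrite reprK. Qed.

Lemma bquot_mulA : associative bquot_mul.
Proof.
move=> x y z; have [[[a ->] [b ->]] [c ->]] := (bquot_ex x, bquot_ex y, bquot_ex z).
by rewrite -(bquot_piM b c) -(bquot_piM a b) -(bquot_piM a) -(bquot_piM _ c) mulrA.
Qed.
Lemma bquot_mul1l : left_id bquot_one bquot_mul.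
Proof. by move=> x; have [a ->] := bquot_ex x; rewrite -(bquot_piM 1 a) mul1r. Qed.
Lemma bquot_mul1r : right_id bquot_one bquot_mul.
Proof. by move=> x; have [a ->] := bquot_ex x; rewrite -(bquot_piM a 1) mulr1. Qed.
Lemma bquot_mulDl : left_distributive bquot_mul +%R.
Proof.
move=> x y z; have [[[a ->] [b ->]] [c ->]] := (bquot_ex x, bquot_ex y, bquot_ex z).
by rewrite -(bquot_piD a b) -(bquot_piM a c) -(bquot_piM b c)
           -(bquot_piM (a + b) c) -bquot_piD mulrDl.
Qed.
Lemma bquot_mulDr : right_distributive bquot_mul +%R.
Proof.
move=> x y z; have [[[a ->] [b ->]] [c ->]] := (bquot_ex x, bquot_ex y, bquot_ex z).
by rewrite -(bquot_piD b c) -(bquot_piM a c) -(bquot_piM a b)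
           -(bquot_piM a (b + c)) -bquot_piD mulrDr.
Qed.
Lemma bquot_one_neq0 : bquot_one != 0.
Proof.
apply/eqP => e; apply: proper; apply/bidealP; rewrite -[1]subr0.
by apply/bquot_eqP; rewrite -[LHS]/bquot_one e !piE.
Qed.

HB.instance Definition _ := GRing.Zmodule_isNzRing.Build B
  bquot_mulA bquot_mul1l bquot_mul1r bquot_mulDl bquot_mulDr bquot_one_neq0.

Lemma bquot_scaleA c d x : bquot_scale c (bquot_scale d x) = bquot_scale (c * d) x.
Proof.
have [a ->] := bquot_ex x.
by rewrite -(bquot_piZ d a) -(bquot_piZ c) -(bquot_piZ (c * d)) scalerA.
Qed.
Lemma bquot_scale1 : left_id 1 bquot_scale.
Proof. by move=> x; have [a ->] := bquot_ex x; rewrite -(bquot_piZ 1 a) scale1r. Qed.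
Lemma bquot_scaleDr : right_distributive bquot_scale +%R.
Proof.
move=> c x y; have [[a ->] [b ->]] := (bquot_ex x, bquot_ex y).
by rewrite -(bquot_piD a b) -(bquot_piZ c a) -(bquot_piZ c b) -(bquot_piZ c (a + b))
           -bquot_piD scalerDr.
Qed.
Lemma bquot_scaleDl x : {morph bquot_scale^~ x : c d / c + d}.
Proof.
move=> c d; have [a ->] := bquot_ex x.
by rewrite /= -(bquot_piZ c a) -(bquot_piZ d a) -(bquot_piZ (c + d) a)
           -bquot_piD scalerDl.
Qed.

HB.instance Definition _ := GRing.Zmodule_isLmodule.Build K B
  bquot_scaleA bquot_scale1 bquot_scaleDr bquot_scaleDl.

Lemma bquot_scaleAl (c : K) (x y : B) : c *: (x * y) = (c *: x) * y.
Proof.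
have [[a ->] [b ->]] := (bquot_ex x, bquot_ex y).
change (bquot_scale c (bquot_mul (\pi_B a) (\pi_B b))
      = bquot_mul (bquot_scale c (\pi_B a)) (\pi_B b)).
by rewrite -(bquot_piM a b) -(bquot_piZ c a) -(bquot_piZ c) -(bquot_piM _ b)
           pathalg_scalerAl.
Qed.
HB.instance Definition _ := GRing.Lmodule_isLalgebra.Build K B bquot_scaleAl.

Lemma bquot_scaleAr (c : K) (x y : B) : c *: (x * y) = x * (c *: y).
Proof.
have [[a ->] [b ->]] := (bquot_ex x, bquot_ex y).
change (bquot_scale c (bquot_mul (\pi_B a) (\pi_B b))
      = bquot_mul (\pi_B a) (bquot_scale c (\pi_B b))).
by rewrite -(bquot_piM a b) -(bquot_piZ c b) -(bquot_piZ c) -(bquot_piM a)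
           pathalg_scalerAr.
Qed.
HB.instance Definition _ := GRing.Lalgebra_isAlgebra.Build K B bquot_scaleAr.

End Instances.
End BoundQuiverAlgebra.

(* The double quiver of A_n, with vertices and arrows numbered from 0: inl i is
   alpha_i : i -> i+1 and inr i is beta_i : i+1 -> i.  The vertex set has n
   elements only when 0 < n (it is a singleton for n = 0). *)
Definition dynkinA_double (n : nat) : quiver :=
  @Quiver 'I_n.-1.+1 ('I_n.-1 + 'I_n.-1)%type
    (fun a => match a with inl i => widen_ord (leqnSn _) i | inr i => lift ord0 i end)
    (fun a => match a with inl i => lift ord0 i | inr i => widen_ord (leqnSn _) i end).

Section Preprojective.
Variables (K : fieldType) (n : nat).
Local Notation KQ := (pathalg K (dynkinA_double n)).

Definition alpha (i : 'I_n.-1) : KQ := bpath K (@parr (dynkinA_double n) (inl i)).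
Definition beta (i : 'I_n.-1) : KQ := bpath K (@parr (dynkinA_double n) (inr i)).

Inductive preproj_rel : KQ -> Prop :=
| preproj_mesh (i j : 'I_n.-1) :
    j = i.+1 :> nat -> preproj_rel (beta i * alpha i - alpha j * beta j)
| preproj_first (i : 'I_n.-1) : i = 0%N :> nat -> preproj_rel (alpha i * beta i)
| preproj_last (i : 'I_n.-1) : i.+1 = n.-1 -> preproj_rel (beta i * alpha i).

Lemma preproj_proper : ~ ideal_gen preproj_rel 1.
Proof.
pose v0 : vertex (dynkinA_double n) := ord0.
suff I0 x : ideal_gen preproj_rel x -> x@_(ptriv v0) = 0.
  by move=> /I0 /eqP; rewrite mcoeff_ptriv1 oner_eq0.
have A i : (alpha i)@_(ptriv v0) = 0 by rewrite /alpha mcoeff_bpath parr_neq_triv.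
have B i : (beta i)@_(ptriv v0) = 0 by rewrite /beta mcoeff_bpath parr_neq_triv.
elim=> {x} [x []||x y _ ex _ ey|a x _ ex|a x _ ex].
- by move=> *; rewrite mcoeffB !mcoeff_ptriv_mul !A !mulr0 mul0r subrr.
- by move=> *; rewrite mcoeff_ptriv_mul A mul0r.
- by move=> *; rewrite mcoeff_ptriv_mul A mulr0.
- exact: mcoeff0.
- by rewrite mcoeffD ex ey addr0.
- by rewrite mcoeff_ptriv_mul ex mulr0.
- by rewrite mcoeff_ptriv_mul ex mul0r.
Qed.

Definition preproj : algType K := bquot preproj_proper.
End Preprojective.

Section Modules.
Variables (K : fieldType) (A : algType K).

(* Finite-dimensional right modules; the product x a is written ract a x. *)
Record rmod := RMod {
  rmod_space :> vectType K;
  ract : A -> 'End(rmod_space);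
  ract_linear : linear ract;
  ract1 : ract 1 = \1%VF;
  ractM : forall a b, ract (a * b) = (ract b \o ract a)%VF }.

(* Finite-dimensional left modules; the product a x is written lact a x. *)
Record leftmod := LeftMod {
  leftmod_space :> vectType K;
  lact : A -> 'End(leftmod_space);
  lact_linear : linear lact;
  lact1 : lact 1 = \1%VF;
  lactM : forall a b, lact (a * b) = (lact a \o lact b)%VF }.

Definition rhom (M N : rmod) (f : 'Hom(M, N)) : Prop :=
  forall a x, f (ract M a x) = ract N a (f x).

Definition riso (M N : rmod) : Prop :=
  exists2 f : 'Hom(M, N), rhom f & bijective f.

Definition rzero (M : rmod) : Prop := forall x : M, x = 0.

Definition rsubmod (M : rmod) (U : {vspace M}) : Prop :=
  forall a x, x \in U -> ract M a x \in U.

Definition rindec (M : rmod) : Prop :=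
  ~ rzero M /\
  forall U V : {vspace M}, rsubmod U -> rsubmod V ->
    (U + V)%VS = fullv -> (U :&: V)%VS = 0%VS -> U = 0%VS \/ V = 0%VS.

(* Projective objects of the category of finite-dimensional modules. *)
Definition rproj (P : rmod) : Prop :=
  forall (M N : rmod) (g : 'Hom(M, N)) (f : 'Hom(P, N)),
    rhom g -> rhom f -> limg g = fullv ->
    exists2 h : 'Hom(P, M), rhom h & (g \o h)%VF = f.

Definition superfluous (M : rmod) (V : {vspace M}) : Prop :=
  forall U : {vspace M}, rsubmod U -> (U + V)%VS = fullv -> U = fullv.

(* P1 -f-> P0 -g-> M -> 0 *)
Definition min_proj_presentation (P1 P0 M : rmod)
    (f : 'Hom(P1, P0)) (g : 'Hom(P0, M)) : Prop :=
  [/\ rproj P1, rproj P0, rhom f & rhom g] /\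
  [/\ limg g = fullv, limg f = lker g, superfluous (lker f)
    & superfluous (lker g)].

(* The elements of the left module Hom_A(P, A). *)
Definition rform (P : rmod) (u : P -> A) : Prop :=
  linear u /\ forall a x, u (ract P a x) = u x * a.

(* L is the cokernel of Hom_A(f, A) : Hom_A(P0, A) -> Hom_A(P1, A), for
   P1 -f-> P0 -> M -> 0 a minimal projective presentation; c is the projection,
   and its values outside Hom_A(P1, A) are irrelevant. *)
Definition is_transpose (M : rmod) (L : leftmod) : Prop :=
  exists (P1 P0 : rmod) (f : 'Hom(P1, P0)) (g : 'Hom(P0, M)) (c : (P1 -> A) -> L),
    min_proj_presentation f g /\
    [/\ forall k u v, rform u -> rform v ->
          c (fun x => k *: u x + v x) = k *: c u + c v,
        forall a u, rform u -> c (fun x => a * u x) = lact L a (c u),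
        forall y, exists2 u, rform u & c u = y
      & forall u, rform u ->
          (c u = 0 <-> exists2 w : P0 -> A, rform w & u = w \o f)].

Section Dual.
Variable L : leftmod.
Definition dual_act (a : A) : 'End('Hom(L, K^o)) :=
  linfun (fun phi : 'Hom(L, K^o) => (phi \o lact L a)%VF).

Lemma dual_actE a (phi : 'Hom(L, K^o)) : dual_act a phi = (phi \o lact L a)%VF.
Proof.
have lin : linear (fun psi : 'Hom(L, K^o) => (psi \o lact L a)%VF).
  by move=> k psi psi'; rewrite comp_lfunDl comp_lfunZl.
pose F : {linear 'Hom(L, K^o) -> 'Hom(L, K^o)} :=
  HB.pack_for {linear 'Hom(L, K^o) -> 'Hom(L, K^o)}
    (fun psi : 'Hom(L, K^o) => (psi \o lact L a)%VF)
    (GRing.isLinear.Build _ _ _ _ _ lin).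
exact: (lfunE F).
Qed.

Lemma dual_act_linear : linear dual_act.
Proof.
move=> k a b; apply/lfunP => phi.
by rewrite add_lfunE scale_lfunE !dual_actE lact_linear comp_lfunDr comp_lfunZr.
Qed.
Lemma dual_act1 : dual_act 1 = \1%VF.
Proof. by apply/lfunP => phi; rewrite dual_actE lact1 comp_lfun1r id_lfunE. Qed.
Lemma dual_actM a b : dual_act (a * b) = (dual_act b \o dual_act a)%VF.
Proof.
by apply/lfunP => phi; rewrite comp_lfunE !dual_actE lactM comp_lfunA.
Qed.

Definition dualmod : rmod := RMod dual_act_linear dual_act1 dual_actM.
End Dual.

(* N is isomorphic to tau M = D Tr M. *)
Definition is_tau (M N : rmod) : Prop :=
  exists2 L, is_transpose M L & riso N (dualmod L).

Definition hom_zero (M N : rmod) : Prop :=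
  forall f : 'Hom(M, N), rhom f -> f = 0.

Definition tau_rigid_pair (X : rmod * rmod) : Prop :=
  [/\ rproj X.2, exists2 N, is_tau X.1 N & hom_zero X.1 N & hom_zero X.2 X.1].

Definition indec_pair (X : rmod * rmod) : Prop :=
  (rindec X.1 /\ rzero X.2) \/ (rzero X.1 /\ rindec X.2).

Definition pair_iso (X Y : rmod * rmod) : Prop := riso X.1 Y.1 /\ riso X.2 Y.2.

(* Bounded cochain complexes of projectives.  To avoid transports there is a map
   between any two degrees, which is 0 unless the degrees are i and i + 1. *)
Record pcomplex := PComplex {
  cterm :> int -> rmod;
  cdiff : forall i j, 'Hom(cterm i, cterm j);
  cterm_proj : forall i, rproj (cterm i);
  cdiff_hom : forall i j, rhom (cdiff i j);
  cdiff_shape : forall i j, j <> i + 1 -> cdiff i j = 0;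
  cdiff_comp : forall i j k, (cdiff j k \o cdiff i j)%VF = 0;
  cterm_bounded : exists m : nat, forall i, (m < absz i)%N -> rzero (cterm i) }.

Section Shift.
Variables (k : int) (X : pcomplex).
Definition shift_term (i : int) : rmod := X (i + k).
Definition shift_diff i j : 'Hom(shift_term i, shift_term j) :=
  (-1) ^+ absz k *: cdiff X (i + k) (j + k).

Lemma shift_proj i : rproj (shift_term i).
Proof. exact: cterm_proj. Qed.
Lemma shift_hom i j : rhom (shift_diff i j).
Proof. by move=> a x; rewrite /shift_diff !scale_lfunE cdiff_hom linearZ. Qed.
Lemma shift_shape i j : j <> i + 1 -> shift_diff i j = 0.
Proof.
move=> n; rewrite /shift_diff cdiff_shape ?scaler0 // => e; apply: n.
by apply: (addIr k); rewrite e addrAC.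
Qed.
Lemma shift_comp i j l : (shift_diff j l \o shift_diff i j)%VF = 0.
Proof. by rewrite /shift_diff -comp_lfunZl -comp_lfunZr cdiff_comp !scaler0. Qed.
Lemma shift_bounded : exists m : nat, forall i, (m < absz i)%N -> rzero (shift_term i).
Proof.
have [m Hm] := cterm_bounded X; exists (m + absz k)%N => i hi; apply: Hm.
rewrite -(ltn_add2r (absz k)); apply: leq_trans hi _.
rewrite -lez_nat PoszD !abszE -[X in `|X| <= _](addrK k i).
exact: ler_normB.
Qed.

Definition cshift : pcomplex :=
  PComplex shift_proj shift_hom shift_shape shift_comp shift_bounded.
End Shift.

Definition cmap (X Y : pcomplex) := forall i, 'Hom(X i, Y i).

Definition chain_map X Y (f : cmap X Y) : Prop :=
  (forall i, rhom (f i)) /\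
  forall i j, (f j \o cdiff X i j)%VF = (cdiff Y i j \o f i)%VF.

Definition null_homotopic X Y (f : cmap X Y) : Prop :=
  exists h : forall i j, 'Hom(X i, Y j),
    (forall i j, rhom (h i j)) /\
    forall i, f i = (cdiff Y (i - 1) i \o h i (i - 1))%VF
                   + (h (i + 1) i \o cdiff X i (i + 1))%VF.

Definition cmap_id X : cmap X X := fun i => \1%VF.
Definition cmap_comp X Y Z (g : cmap Y Z) (f : cmap X Y) : cmap X Z :=
  fun i => (g i \o f i)%VF.
Definition cmap_add X Y (f g : cmap X Y) : cmap X Y := fun i => f i + g i.

Definition homotopic X Y (f g : cmap X Y) : Prop :=
  null_homotopic (fun i => f i - g i : 'Hom(X i, Y i)).

Definition Kiso (X Y : pcomplex) : Prop :=
  exists (f : cmap X Y) (g : cmap Y X),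
    [/\ chain_map f, chain_map g, homotopic (cmap_comp g f) (cmap_id X)
      & homotopic (cmap_comp f g) (cmap_id Y)].

Definition Kzero (X : pcomplex) : Prop := null_homotopic (cmap_id X).

(* T is a direct sum of X and Y in the additive category K^b(proj A). *)
Definition Kbiproduct (T X Y : pcomplex) : Prop :=
  exists (iX : cmap X T) (iY : cmap Y T) (pX : cmap T X) (pY : cmap T Y),
    [/\ chain_map iX, chain_map iY, chain_map pX & chain_map pY] /\
    [/\ homotopic (cmap_comp pX iX) (cmap_id X),
        homotopic (cmap_comp pY iY) (cmap_id Y),
        null_homotopic (cmap_comp pX iY),
        null_homotopic (cmap_comp pY iX)
      & homotopic (cmap_add (cmap_comp iX pX) (cmap_comp iY pY)) (cmap_id T)].

Definition Kindec (T : pcomplex) : Prop :=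
  ~ Kzero T /\ forall X Y, Kbiproduct T X Y -> Kzero X \/ Kzero Y.

Definition two_term (T : pcomplex) : Prop :=
  forall i : int, i <> -1 -> i <> 0 -> rzero (T i).

Definition presilting (T : pcomplex) : Prop :=
  forall i : int, 0 < i ->
  forall f : cmap T (cshift i T), chain_map f -> null_homotopic f.

End Modules.

(* S is in bijection with the set of isomorphism classes of the objects
   satisfying C: f picks one object in each class. *)
Definition bij_iso_classes (T U : Type) (S : T -> Prop) (C : U -> Prop)
    (iso : U -> U -> Prop) : Prop :=
  exists f : T -> U,
    [/\ forall s, S s -> C (f s),
        forall s t, S s -> S t -> iso (f s) (f t) -> s = t
      & forall x, C x -> exists2 s, S s & iso (f s) x].

Section Prism.
Local Open Scope classical_set_scope.
Variables (R : realType) (n : nat).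
Local Notation point := 'rV[R]_(n.+1 + 2).

Definition chull (X : set point) : set point :=
  [set y | exists (m : nat) (x : 'I_m -> point) (c : 'I_m -> R),
     [/\ forall i, X (x i), forall i, 0 <= c i, \sum_i c i = 1
       & y = \sum_i c i *: x i]].

Definition affine_hull (X : set point) : set point :=
  [set y | exists (m : nat) (x : 'I_m -> point) (c : 'I_m -> R),
     [/\ forall i, X (x i), \sum_i c i = 1 & y = \sum_i c i *: x i]].

Definition affine_indep (m : nat) (t : 'I_m -> point) : Prop :=
  forall c : 'I_m -> R, \sum_i c i = 0 -> \sum_i c i *: t i = 0 ->
  forall i, c i = 0.

Definition prism_a (i : 'I_n.+1) : point := row_mx (delta_mx 0 i) (delta_mx 0 0).
Definition prism_b (i : 'I_n.+1) : point := row_mx (delta_mx 0 i) (delta_mx 0 1).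
Definition prism_vertices : set point := range prism_a `|` range prism_b.
Definition prism : set point := chull prism_vertices.

(* The prism is not full-dimensional: interior and boundary are taken relative
   to the affine hull. *)
Definition rel_interior (X : set point) : set point :=
  [set x | X x /\ \forall y \near x, affine_hull X y -> X y].
Definition rel_boundary (X : set point) : set point :=
  closure X `\` rel_interior X.

Definition prism_simplex : set (set point) :=
  [set S | exists t : 'I_n.+1 -> point,
     [/\ forall i, prism_vertices (t i), affine_indep t & S = chull (range t)]].

Definition internal_simplex : set (set point) :=
  [set S | prism_simplex S /\ ~ (S `<=` rel_boundary prism)].
End Prism.

(* Main.v *)
Require Import Defs.
From HB Require Import structures.
From mathcomp Require Import finmap monalg.
From mathcomp Require Import boolp classical_sets reals topology normedtype.
From mathcomp Require Import all_boot all_order all_algebra.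
From mathcomp Require Import ring lra zify.

Set Implicit Arguments.
Unset Strict Implicit.
Unset Printing Implicit Defensive.

Import Order.TTheory GRing.Theory Num.Theory.
Import numFieldTopology.Exports.
Local Open Scope ring_scope.

(** Both kinds of objects are parametrised by the nonempty proper subsets [s] of
    [{0, ..., n}].

    On the side of the prism, [s] gives the simplex with the vertices [a_i] for
    [i] in [s] and [b_i] for the other [i]. An internal simplex contains a point of
    the relative interior, all of whose coordinates are positive; hence it has a
    vertex in each of the [n + 1] columns, so exactly one, and not all of them lie
    at the same end ([simplex_internal], [internal_simplexP]).

    On the side of the algebra, let [y] be the sum of the arrows [alpha_i] and [x]
    that of the [beta_i]. The mesh relations say that [x] and [y] commute, so that a
    module is a vector space graded by the vertices with two commuting operators, one
    lowering and one raising the degree ([xxyy], [gr_mod]), and the projective at a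
    vertex has a basis of monomials [x^a y^b], a rectangle. A subset [S] of
    [{0, ..., n}] is a disjoint union of intervals; when one of them consists of the
    [k] with [i <= k < j], call [i] an entry and [j] an exit. In the two-term complex
    [zigzag S] the terms are the projectives at the entries and at the exits, and
    the differential joins neighbouring points by the shortest paths. Points which
    are not vertices, 0 and [n + 1], contribute nothing.

    A two-term complex is presilting when it is rigid, that is, has no nonzero maps
    to its own shift. The rigid complexes are found as follows. The zigzag complexes
    of nested sets have no maps to the shifts of each other ([zigzag_vanish]), and the
    endomorphisms of one zigzag complex form a local ring ([zz_unit]). Given the
    numbers [b k] and [a k] of generators at the vertex [k] in degrees -1 and 0, the
    superlevel sets of the function on [{0, ..., n}] that changes by [b k - a k] from
    [k - 1] to [k] form a chain; their zigzag complexes, with some contractible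
    ones, add up to a rigid complex with these terms ([model_rigid], [model_count1],
    [model_count0]). Finally, two rigid complexes with the same terms are isomorphic.
    Geometrically, each has an open orbit in the space of differentials; over an
    arbitrary field one joins the two differentials by a line and solves a linear
    system by the rule of Cramer to see that both are isomorphic to the generic point
    of the line, which yields polynomial families of chain maps in both directions
    whose composites are a nonzero polynomial times the identity
    ([rigid_generic_iso]). A coefficient of these identities writes the identity of
    each complex as a sum of maps through the other ([trigid_generic]), and by locality
    a zigzag complex is a direct summand of every rigid complex that is not
    contractible ([zigzag_summand]). The indecomposable ones are therefore the zigzag
    complexes of nonempty proper subsets, and [s] can be recovered because the tops of
    the two terms show where the intervals begin and end ([zigzag_eq]).

    Tau-rigid modules are the cokernels of rigid complexes: for a minimal
    projective presentation [f : P1 -> P0] of [M], the space [Hom (M, tau M)] is dual to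
    the cokernel of [Hom (P0, M) -> Hom (P1, M)], and this cokernel vanishes if and
    only if [f] is rigid ([hom_zero_factor], [factor_hom_zero],
    [rigid_presentation]). The pair of [s] consists of the cokernel of the zigzag
    complex and 0, or of 0 and the term in degree -1 when the term in degree 0
    vanishes. The zigzag complex is a minimal presentation in the first case, because
    its differential takes values in the radical, and so does the inclusion of its
    kernel, by locality ([zz_diff_rad], [ker_rad]). *)

(** * Subspaces and quotients of finite-dimensional vector spaces *)

Section VectorSpaces.
Variable K : fieldType.

Lemma linfun_linE (aT rT : vectType K) (f : aT -> rT) : linear f -> linfun f =1 f.
Proof.
move=> lf.
pose F := HB.pack_for {linear aT -> rT} f (GRing.isLinear.Build _ _ _ _ _ lf).
exact: (lfunE F).
Qed.

(** A subspace of largest dimension among those on which [P] holds contains every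
    vector satisfying [P], since the line through that vector could be added. *)
Lemma vspace_of_pred (V : vectType K) (P : V -> Prop) :
    P 0 -> (forall k x y, P x -> P y -> P (k *: x + y)) ->
  exists U : {vspace V}, forall x, x \in U <-> P x.
Proof.
move=> P0 PD.
pose good d := `[< exists2 U : {vspace V}, \dim U = d & forall x, x \in U -> P x >].
have exg : exists d, good d.
  exists 0%N; apply/asboolP; exists 0%VS; first by rewrite dimv0.
  by move=> x; rewrite memv0 => /eqP ->.
have bound d : good d -> (d <= dim V)%N.
  by move=> /asboolP [U <- _]; rewrite -dimvf dimvS ?subvf.
case: (ex_maxnP exg bound) => d /asboolP [U dU UP] dmax.
exists U => x; split; first exact: UP.
move=> Px; have PUx y : y \in (U + <[x]>)%VS -> P y.
  move=> /memv_addP [u uU [w /vlineP [k ->] ->]].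
  by rewrite addrC; apply: PD => //; apply: UP.
have := dmax (\dim (U + <[x]>)) (introT (asboolP _) (ex_intro2 _ _ _ erefl PUx)).
rewrite -dU => le; have /eqP -> : U == (U + <[x]>)%VS by rewrite eqEdim addvSl le.
by apply: subvP (memv_line x); apply: addvSr.
Qed.

Section Quotient.
Variables (V : vectType K) (U : {vspace V}).

(** The quotient of [V] by [U] is modelled by a complement of [U]; [vquo] is
    the projection onto it and [vlift] a linear section. *)
Definition vquo_space := subvs_of (U^C)%VS.
Definition vlift : 'Hom(vquo_space, V) := linfun vsval.
Definition vquo : 'Hom(V, vquo_space) := linfun (fun x => vsproj _ (x - projv U x)).

Lemma vquoE x : vquo x = vsproj _ (x - projv U x).
Proof.
rewrite linfun_linE // => k y z.
by rewrite linearP opprD addrACA -scalerBr linearP.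
Qed.
Lemma vliftE w : vlift w = vsval w.
Proof. exact: lfunE. Qed.

Lemma vquo_eq0 x : (vquo x == 0) = (x \in U).
Proof.
rewrite vquoE; apply/eqP/idP => [/(congr1 vsval)|xU]; last first.
  by rewrite projv_id // subrr linear0.
by rewrite vsprojK ?memv_projC //= => /eqP; rewrite subr_eq0 => /eqP ->; exact: memv_proj.
Qed.

Lemma vquoK w : vquo (vlift w) = w.
Proof.
rewrite vquoE vliftE; apply: val_inj; rewrite /= vsprojK ?memv_projC //=.
set y := vsval w.
have: projv U y \in (U :&: U^C)%VS.
  rewrite memv_cap memv_proj /= -[projv U y](subKr y).
  by rewrite memvB ?subvsP // memv_projC.
by rewrite capv_compl memv0 => /eqP ->; rewrite subr0.
Qed.

Lemma vquo_lift x : vlift (vquo x) - x \in U.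
Proof. by rewrite -vquo_eq0 linearB /= vquoK subrr. Qed.
End Quotient.
End VectorSpaces.

(** * Finite-dimensional right modules *)

Section ModuleBasics.
Variables (K : fieldType) (A : algType K).
Implicit Types (M N P Q : rmod A) (a b : A).

Lemma ractD M a b x : ract M (a + b) x = ract M a x + ract M b x.
Proof. by have := ract_linear M 1 a b; rewrite !scale1r => ->; rewrite add_lfunE. Qed.
Lemma ract0 M x : ract M 0 x = 0.
Proof. by apply: (addrI (ract M 0 x)); rewrite -ractD !addr0. Qed.
Lemma ractZ M k a x : ract M (k *: a) x = k *: ract M a x.
Proof. by have := ract_linear M k a 0; rewrite addr0 => ->; rewrite add_lfunE ract0 addr0 scale_lfunE. Qed.
Lemma ractMx M a b x : ract M (a * b) x = ract M b (ract M a x).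
Proof. by rewrite ractM comp_lfunE. Qed.
Lemma ract1x M x : ract M 1 x = x.
Proof. by rewrite ract1 id_lfunE. Qed.
Lemma ract_sum M (I : Type) (r : seq I) (p : pred I) (F : I -> A) x :
  ract M (\sum_(i <- r | p i) F i) x = \sum_(i <- r | p i) ract M (F i) x.
Proof. by elim/big_rec2: _ => [|i y z _ <-]; rewrite ?ract0 ?ractD. Qed.

Lemma rhom_id M : rhom (\1%VF : 'Hom(M, M)).
Proof. by move=> a x; rewrite !id_lfunE. Qed.
Lemma rhom_comp M N P (g : 'Hom(N, P)) (f : 'Hom(M, N)) :
  rhom g -> rhom f -> rhom (g \o f)%VF.
Proof. by move=> hg hf a x; rewrite !comp_lfunE hf hg. Qed.
Lemma rhom0 M N : rhom (0 : 'Hom(M, N)).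
Proof. by move=> a x; rewrite !zero_lfunE linear0. Qed.
Lemma rhomD M N (f g : 'Hom(M, N)) : rhom f -> rhom g -> rhom (f + g).
Proof. by move=> hf hg a x; rewrite !add_lfunE hf hg linearD. Qed.
Lemma rhomZ M N k (f : 'Hom(M, N)) : rhom f -> rhom (k *: f).
Proof. by move=> hf a x; rewrite !scale_lfunE hf linearZ. Qed.
Lemma rhomN M N (f : 'Hom(M, N)) : rhom f -> rhom (- f).
Proof. by move=> hf; rewrite -scaleN1r; apply: rhomZ. Qed.
Lemma rhomB M N (f g : 'Hom(M, N)) : rhom f -> rhom g -> rhom (f - g).
Proof. by move=> hf hg; apply: rhomD => //; apply: rhomN. Qed.
Lemma rhom_sum M N (I : Type) (r : seq I) (p : pred I) (F : I -> 'Hom(M, N)) :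
  (forall i, p i -> rhom (F i)) -> rhom (\sum_(i <- r | p i) F i).
Proof. by move=> h; apply: big_ind => // *; [apply: rhom0|apply: rhomD]. Qed.

Lemma comp_lfun_suml (aT vT rT : vectType K) (I : Type) (r : seq I) (p : pred I)
    (F : I -> 'Hom(vT, rT)) (g : 'Hom(aT, vT)) :
  ((\sum_(i <- r | p i) F i) \o g)%VF = \sum_(i <- r | p i) (F i \o g)%VF.
Proof. by elim/big_rec2: _ => [|i y1 y2 _ <-]; rewrite ?comp_lfun0l ?comp_lfunDl. Qed.
Lemma comp_lfun_sumr (aT vT rT : vectType K) (I : Type) (r : seq I) (p : pred I)
    (F : I -> 'Hom(aT, vT)) (g : 'Hom(vT, rT)) :
  (g \o (\sum_(i <- r | p i) F i))%VF = \sum_(i <- r | p i) (g \o F i)%VF.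
Proof. by elim/big_rec2: _ => [|i y1 y2 _ <-]; rewrite ?comp_lfun0r ?comp_lfunDr. Qed.
Lemma comp_lfunBl (aT vT rT : vectType K) (f1 f2 : 'Hom(vT, rT)) (g : 'Hom(aT, vT)) :
  ((f1 - f2) \o g = (f1 \o g) - (f2 \o g))%VF.
Proof. by rewrite comp_lfunDl comp_lfunNl. Qed.
Lemma comp_lfunBr (aT vT rT : vectType K) (g : 'Hom(vT, rT)) (f1 f2 : 'Hom(aT, vT)) :
  (g \o (f1 - f2) = (g \o f1) - (g \o f2))%VF.
Proof. by rewrite comp_lfunDr comp_lfunNr. Qed.

Lemma rsubmod_ker M N (f : 'Hom(M, N)) : rhom f -> rsubmod (lker f).
Proof. by move=> hf a x; rewrite !memv_ker hf => /eqP ->; rewrite linear0. Qed.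
Lemma rsubmod_img M N (f : 'Hom(M, N)) : rhom f -> rsubmod (limg f).
Proof.
by move=> hf a y /memv_imgP [x _ ->]; rewrite -hf; apply: memv_img; apply: memvf.
Qed.

Section MakeModule.
Variables (V : vectType K) (act : A -> V -> V).
Hypotheses (actL : forall a, linear (act a))
  (act_linear : forall k a b x, act (k *: a + b) x = k *: act a x + act b x)
  (act1 : forall x, act 1 x = x) (actM : forall a b x, act (a * b) x = act b (act a x)).

Fact mk_rmod_linear : linear (fun a => linfun (act a) : 'End(V)).
Proof. by move=> k a b; apply/lfunP => x; rewrite add_lfunE scale_lfunE !linfun_linE. Qed.
Fact mk_rmod1 : linfun (act 1) = \1%VF.
Proof. by apply/lfunP => x; rewrite id_lfunE linfun_linE. Qed.
Fact mk_rmodM a b : linfun (act (a * b)) = (linfun (act b) \o linfun (act a))%VF.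
Proof. by apply/lfunP => x; rewrite comp_lfunE !linfun_linE. Qed.
Definition mk_rmod : rmod A := RMod mk_rmod_linear mk_rmod1 mk_rmodM.
Lemma mk_rmodE a (x : V) : ract mk_rmod a x = act a x.
Proof. exact: linfun_linE. Qed.
End MakeModule.

Section Submodule.
Variables (M : rmod A) (U : {vspace M}).
Hypothesis sU : rsubmod U.

Let act a (w : subvs_of U) : subvs_of U := vsproj U (ract M a (vsval w)).
Let vact a w : vsval (act a w) = ract M a (vsval w).
Proof. by rewrite vsprojK // sU ?subvsP. Qed.
Fact rsub_actL a : linear (act a).
Proof. by move=> k x y; rewrite /act !linearP. Qed.
Fact rsub_act_linear k a b x : act (k *: a + b) x = k *: act a x + act b x.
Proof. by rewrite /act ractD ractZ linearP. Qed.
Fact rsub_act1 x : act 1 x = x.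
Proof. by rewrite /act ract1x vsvalK. Qed.
Fact rsub_actM a b x : act (a * b) x = act b (act a x).
Proof. by apply: val_inj; rewrite /= !vact ractMx. Qed.
Definition rsub : rmod A := mk_rmod rsub_actL rsub_act_linear rsub_act1 rsub_actM.

Definition rsub_inc : 'Hom(rsub, M) := linfun (vsval : rsub -> M).
Definition rsub_proj : 'Hom(M, rsub) := linfun (vsproj U : M -> rsub).
Lemma rsub_incE w : rsub_inc w = vsval w. Proof. exact: lfunE. Qed.
Lemma rsub_projE x : rsub_proj x = vsproj U x. Proof. exact: lfunE. Qed.
Lemma rsub_inc_rhom : rhom rsub_inc.
Proof. by move=> a w; rewrite !rsub_incE mk_rmodE vact. Qed.
Lemma rsub_inc_mem w : rsub_inc w \in U.
Proof. by rewrite rsub_incE subvsP. Qed.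
Lemma rsub_inc_inj : injective rsub_inc.
Proof. by move=> x y; rewrite !rsub_incE; apply: val_inj. Qed.
Lemma rsub_projK x : x \in U -> rsub_inc (rsub_proj x) = x.
Proof. by move=> xU; rewrite rsub_incE rsub_projE vsprojK. Qed.
Lemma rsub_incK x : rsub_proj (rsub_inc x) = x.
Proof. by apply: rsub_inc_inj; rewrite rsub_projK ?rsub_inc_mem. Qed.

Lemma rsub_corestrict N (f : 'Hom(N, M)) : rhom f -> (limg f <= U)%VS ->
  exists2 h : 'Hom(N, rsub), rhom h & (rsub_inc \o h)%VF = f.
Proof.
move=> hf le; have fU x : f x \in U by apply: (subvP le); apply: memv_img; apply: memvf.
exists (rsub_proj \o f)%VF => [a x|].
  by apply: rsub_inc_inj; rewrite rsub_inc_rhom !comp_lfunE !rsub_projK.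
by apply/lfunP => x; rewrite !comp_lfunE rsub_projK.
Qed.
End Submodule.

Section QuotientModule.
Variables (M : rmod A) (U : {vspace M}).
Hypothesis sU : rsubmod U.

Let act a (w : vquo_space U) : vquo_space U := vquo U (ract M a (vlift U w)).
Let vact a x : act a (vquo U x) = vquo U (ract M a x).
Proof.
apply/eqP; rewrite /act -subr_eq0 -linearB /= -linearB vquo_eq0.
exact/sU/vquo_lift.
Qed.
Fact rquo_actL a : linear (act a).
Proof. by move=> k x y; rewrite /act !linearP. Qed.
Fact rquo_act_linear k a b x : act (k *: a + b) x = k *: act a x + act b x.
Proof. by rewrite /act ractD ractZ linearP. Qed.
Fact rquo_act1 x : act 1 x = x.
Proof. by rewrite /act ract1x vquoK. Qed.
Fact rquo_actM a b x : act (a * b) x = act b (act a x).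
Proof. by rewrite [act a x]/act vact /act ractMx. Qed.
Definition rquo : rmod A := mk_rmod rquo_actL rquo_act_linear rquo_act1 rquo_actM.

Definition rquo_proj : 'Hom(M, rquo) := vquo U.
Lemma rquo_proj_rhom : rhom rquo_proj.
Proof. by move=> a w; rewrite mk_rmodE vact. Qed.
Lemma rquo_proj_surj : limg rquo_proj = fullv.
Proof.
apply/vspaceP => y; rewrite memvf; apply/memv_imgP.
by exists (vlift U y); rewrite ?memvf ?[RHS]vquoK.
Qed.
Lemma lker_rquo_proj : lker rquo_proj = U.
Proof. by apply/vspaceP => x; rewrite memv_ker vquo_eq0. Qed.
End QuotientModule.

Lemma surjP (V W : vectType K) (f : 'Hom(V, W)) :
  limg f = fullv <-> forall y, exists x, f x = y.
Proof.
split=> [e y|h].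
  by have := memvf y; rewrite -e => /memv_imgP [x _ ->]; exists x.
apply/vspaceP => y; rewrite memvf; have [x <-] := h y.
by apply: memv_img; apply: memvf.
Qed.

Lemma rzero_hom0 M N (f : 'Hom(M, N)) : rzero M \/ rzero N -> f = 0.
Proof.
move=> z; apply/lfunP => x; rewrite zero_lfunE.
by case: z => z; [rewrite (z x) linear0|rewrite (z (f x))].
Qed.

(** Projectivity only asks for lifts along surjections; a map whose image lies
    in the image of [g] lifts along [g] after corestriction. *)
Lemma proj_lift P M N (g : 'Hom(M, N)) (f : 'Hom(P, N)) :
    rproj P -> rhom g -> rhom f -> (limg f <= limg g)%VS ->
  exists2 h : 'Hom(P, M), rhom h & (g \o h)%VF = f.
Proof.
move=> pP hg hf le.
have sg := rsubmod_img hg.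
have [f' hf' ef] := rsub_corestrict sg hf le.
have [g' hg' eg] := rsub_corestrict sg hg (subvv _).
have sj : limg g' = fullv.
  apply/surjP => y; have /memv_imgP [x _ ex] := rsub_inc_mem y; exists x.
  by apply: (rsub_inc_inj (sU := sg)); rewrite -(comp_lfunE (rsub_inc sg)) eg.
have [h hh eh] := pP _ _ _ _ hg' hf' sj; exists h => //.
rewrite -ef -eh comp_lfunA.
by congr (_ \o h)%VF.
Qed.

Lemma rproj_retract P Q (i : 'Hom(Q, P)) (p : 'Hom(P, Q)) :
  rhom i -> rhom p -> (p \o i)%VF = \1%VF -> rproj P -> rproj Q.
Proof.
move=> hi hp e pP M N g f hg hf sj.
have [h hh eh] := pP _ _ g (f \o p)%VF hg (rhom_comp hf hp) sj.
exists (h \o i)%VF; first exact: rhom_comp.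
by rewrite comp_lfunA eh -comp_lfunA e comp_lfun1r.
Qed.

Lemma riso_sym M N : riso M N -> riso N M.
Proof.
move=> [f hf bf]; have k0 : lker f == 0%VS by apply/lker0P/bij_inj.
have fK : cancel f f^-1%VF := lker0_lfunK k0.
have fVK : cancel f^-1%VF f.
  by case: bf => g _ gK y; rewrite -{1}(gK y) fK gK.
exists (f^-1)%VF; last by exists f.
by move=> a x; apply: (bij_inj bf); rewrite hf !fVK.
Qed.

Lemma riso_of_inverses M N (f : 'Hom(M, N)) (g : 'Hom(N, M)) :
  rhom f -> (g \o f)%VF = \1%VF -> (f \o g)%VF = \1%VF -> riso M N.
Proof.
move=> hf e1 e2; exists f => //; exists g => x.
  by rewrite -comp_lfunE e1 id_lfunE.
by rewrite -comp_lfunE e2 id_lfunE.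
Qed.

Lemma riso_inverses M N : riso M N ->
  exists (f : 'Hom(M, N)) (g : 'Hom(N, M)),
  [/\ rhom f, rhom g, (g \o f)%VF = \1%VF & (f \o g)%VF = \1%VF].
Proof.
move=> i; have [f hf bf] := i.
have k0 : lker f == 0%VS by apply/lker0P/bij_inj.
have fK : cancel f f^-1%VF := lker0_lfunK k0.
have fVK : cancel f^-1%VF f.
  by case: bf => g _ gK y; rewrite -{1}(gK y) fK gK.
exists f, (f^-1)%VF; split=> //; last 2 first.
- by apply/lfunP => x; rewrite comp_lfunE id_lfunE fK.
- by apply/lfunP => x; rewrite comp_lfunE id_lfunE fVK.
by move=> a x; apply: (bij_inj bf); rewrite hf !fVK.
Qed.

Lemma riso_refl M : riso M M.
Proof. by apply: (@riso_of_inverses _ _ \1%VF \1%VF); rewrite ?comp_lfun1l //; apply: rhom_id. Qed.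

Lemma zero_modE (x : 'rV[K]_0) : 0 = x.
Proof. by apply/rowP; case. Qed.
Definition zero_mod : rmod A := @mk_rmod 'rV[K]_0 (fun _ _ => 0)
  (fun _ _ _ _ => zero_modE _) (fun _ _ _ _ => zero_modE _) zero_modE (fun _ _ _ => erefl).
Lemma zero_mod_rzero : rzero zero_mod.
Proof. by move=> x; rewrite -[RHS]zero_modE -[LHS]zero_modE. Qed.
Lemma rproj_zero P : rzero P -> rproj P.
Proof.
move=> z M N g f _ _ _; exists 0; first exact: rhom0.
by rewrite (rzero_hom0 f (or_introl z)) comp_lfun0r.
Qed.
End ModuleBasics.

Arguments ract : simpl never.
Arguments rmod_space : simpl never.
Arguments mk_rmod : simpl never.
Arguments rsub : simpl never.
Arguments rquo : simpl never.

(** * Rigid maps with the same source and target are generically isomorphic *)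

Section Deformation.
Variables (K : fieldType) (p q : nat) (J : Type) (r1 : J -> 'M[K]_p) (r0 : J -> 'M[K]_q).
Local Notation pC := (map_mx (@polyC K)).
Local Notation KX := {poly K}.

Let com1 (v : 'M[K]_p) := forall j, r1 j *m v = v *m r1 j.
Let com0 (u : 'M[K]_q) := forall j, r0 j *m u = u *m r0 j.
Let int (F : 'M[K]_(p, q)) := forall j, r1 j *m F = F *m r0 j.
Let pcom1 (v : 'M[KX]_p) := forall j, pC (r1 j) *m v = v *m pC (r1 j).
Let pcom0 (u : 'M[KX]_q) := forall j, pC (r0 j) *m u = u *m pC (r0 j).
Let rigid (F : 'M[K]_(p, q)) :=
  forall H, int H -> exists v u, [/\ com1 v, com0 u & H = v *m F + F *m u].

Lemma det_neq0_horner m (v : 'M[KX]_m) s : map_mx (horner_eval s) v = 1%:M -> \det v != 0.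
Proof.
move=> e; apply/eqP => d0; have := det1 K m; rewrite -e det_map_mx d0 /= /horner_eval horner0.
by move/eqP; rewrite eq_sym oner_eq0.
Qed.

(** The generic point of a curve [F + c (G - F)] through a rigid [F] lies in the
    orbit of [F]. Let [e_i] be a basis of the pairs of endomorphisms and
    [Phi (v, u) = v F - F u]. Rigidity writes [v_i (G - F)] as [\sum_j N i j Phi e_j],
    so that a combination of the [e_i] with coefficients [d] maps the curve to [F] as
    soon as [d (1 + c N)] is a multiple of the coefficients [c0] of the identity,
    which [Phi] kills. The adjugate of [1 + c N] provides such a [d]; where [c]
    vanishes it gives the identity, hence the determinants are not zero. *)
Lemma rigid_deform (F G : 'M[K]_(p, q)) (c : KX) (s : K) :
    int F -> int G -> rigid F -> c.[s] = 0 ->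
  exists (v : 'M[KX]_p) (u : 'M[KX]_q),
  [/\ pcom1 v, pcom0 u, v *m (pC F + c *: (pC G - pC F)) = pC F *m u,
      \det v != 0 & \det u != 0].
Proof.
move=> iF iG rF cs.
have [U UP] : exists U : {vspace ('M[K]_p * 'M[K]_q)%type},
    forall x, x \in U <-> com1 x.1 /\ com0 x.2.
  apply: vspace_of_pred => [|k x y [x1 x0] [y1 y0]].
    by split=> j /=; rewrite mul0mx mulmx0.
  by split=> j /=; rewrite mulmxDr mulmxDl -scalemxAr -scalemxAl ?x1 ?x0 ?y1 ?y0.
pose X := vbasis U; pose m := \dim U; pose e (i : 'I_m) := X`_i.
have eU i : com1 (e i).1 /\ com0 (e i).2.
  by apply/UP; apply: vbasis_mem; rewrite mem_nth // size_tuple.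
pose Phi (x : 'M[K]_p * 'M[K]_q) := x.1 *m F - F *m x.2.
have PhiL (k : 'I_m -> K) : Phi (\sum_i k i *: e i) = \sum_i k i *: Phi (e i).
  rewrite /Phi (raddf_sum (fst : {additive _ -> _})) (raddf_sum (snd : {additive _ -> _})).
  rewrite mulmx_suml mulmx_sumr -sumrB; apply: eq_bigr => i _.
  by rewrite scalerBr -scalemxAl -scalemxAr.
have exN i : exists k : 'I_m -> K, (e i).1 *m (G - F) = \sum_j k j *: Phi (e j).
  have [|v [u [cv cu E]]] := rF ((e i).1 *m (G - F)).
    move=> j; have [c1 _] := eU i; rewrite mulmxA c1 -!mulmxA; congr (_ *m _).
    by rewrite mulmxBr mulmxBl iF iG.
  have vuU : (v, - u) \in U.
    by apply/UP; split=> //= j; rewrite mulmxN mulNmx cu.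
  exists (fun j => coord X j (v, - u)).
  by rewrite -PhiL -(coord_vbasis vuU) /Phi /= mulmxN opprK.
have [N NP] := choice exN.
have oneU : (1%:M, 1%:M) \in U.
  by apply/UP; split=> j /=; rewrite mul1mx mulmx1.
pose c0 : 'rV[K]_m := \row_i coord X i (1%:M, 1%:M).
have c0P : \sum_i c0 0 i *: e i = (1%:M, 1%:M).
  rewrite [RHS](coord_vbasis oneU); apply: eq_bigr => i _; by rewrite mxE.
pose Nm : 'M[K]_m := \matrix_(i, j) N i j.
pose B : 'M[KX]_m := 1%:M + c *: pC Nm.
pose d : 'rV[KX]_m := pC c0 *m \adj B.
have dB : d *m B = \det B *: pC c0.
  by rewrite -mulmxA mul_adj_mx mul_mx_scalar.
have ds : map_mx (horner_eval s) d = c0.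
  rewrite map_mxM map_mx_adj.
  have -> : map_mx (horner_eval s) B = 1%:M.
    rewrite map_mxD map_mxZ map_mx1 /= /horner_eval cs scale0r addr0 //.
  rewrite adj1 mulmx1; apply/matrixP => i j; rewrite !mxE; exact: hornerC.
clearbody d.
pose v : 'M[KX]_p := \sum_i d 0 i *: pC (e i).1.
pose u : 'M[KX]_q := \sum_i d 0 i *: pC (e i).2.
have evs a b (w : 'I_m -> 'M[K]_(a, b)) :
    map_mx (horner_eval s) (\sum_i d 0 i *: pC (w i)) = \sum_i c0 0 i *: w i.
  have d0s i : (d 0 i).[s] = c0 0 i by rewrite -ds [RHS]mxE.
  apply/matrixP => x y; rewrite [LHS]mxE !summxE /horner_eval horner_sum.
  apply: eq_bigr => i _; rewrite [RHS]mxE -d0s.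
  by rewrite [X in X.[s] = _]mxE hornerM; congr (_ * _); rewrite [X in X.[s] = _]mxE hornerC.
exists v, u; split.
- move=> j; rewrite /v mulmx_suml mulmx_sumr; apply: eq_bigr => i _.
  by rewrite -scalemxAr -scalemxAl -!map_mxM (eU i).1.
- move=> j; rewrite /u mulmx_suml mulmx_sumr; apply: eq_bigr => i _.
  by rewrite -scalemxAr -scalemxAl -!map_mxM (eU i).2.
- apply/eqP; rewrite -subr_eq0; apply/eqP.
  transitivity (\sum_i d 0 i *: (pC (Phi (e i)) + c *: pC ((e i).1 *m (G - F)))).
    rewrite /v /u mulmx_suml mulmx_sumr -sumrB; apply: eq_bigr => i _.
    rewrite -scalemxAl -scalemxAr -scalerBr; congr (_ *: _).
    rewrite mulmxDr -scalemxAr /Phi map_mxB !map_mxM !map_mxB.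
    by rewrite addrAC.
  transitivity (\sum_j (d *m B) 0 j *: pC (Phi (e j))).
    under [RHS]eq_bigr do rewrite mxE scaler_suml.
    rewrite exchange_big; apply: eq_bigr => i _ /=.
    under [RHS]eq_bigr do rewrite !mxE mulrDr scalerDl.
    rewrite big_split /= scalerDr; congr (_ + _).
      rewrite (bigD1 i) //= eqxx mulr1 big1 ?addr0 // => j /negPf n.
      by rewrite eq_sym n mulr0 scale0r.
    rewrite NP (raddf_sum (map_mx polyC)) !scaler_sumr; apply: eq_bigr => j _.
    by rewrite /= map_mxZ !scalerA mulrA.
  rewrite dB; transitivity (\det B *: pC (Phi (\sum_i c0 0 i *: e i))).
    rewrite PhiL (raddf_sum (map_mx polyC)) scaler_sumr; apply: eq_bigr => i _.
    by rewrite /= map_mxZ scalerA !mxE.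
  by rewrite c0P /Phi /= mul1mx mulmx1 subrr map_mx0 scaler0.
- apply: (@det_neq0_horner _ _ s); rewrite /v evs.
  by have := congr1 fst c0P; rewrite (raddf_sum (fst : {additive _ -> _})).
- apply: (@det_neq0_horner _ _ s); rewrite /u evs.
  by have := congr1 snd c0P; rewrite (raddf_sum (snd : {additive _ -> _})).
Qed.

(** The adjugate commutes with whatever [v] commutes with, because its multiple by
    the nonzero [\det v] does. *)
Lemma adj_commute m (r v : 'M[KX]_m) : \det v != 0 ->
  r *m v = v *m r -> r *m \adj v = \adj v *m r.
Proof.
move=> d0 e.
have canc (x y : 'M[KX]_m) : \det v *: x = \det v *: y -> x = y.
  move=> /matrixP h; apply/matrixP => i j; have := h i j; rewrite [LHS]mxE [RHS]mxE.
  exact: mulfI.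
apply: canc.
transitivity (\adj v *m (v *m r) *m \adj v).
  by rewrite mulmxA mul_adj_mx mul_scalar_mx -!scalemxAl.
by rewrite -e -!mulmxA mul_mx_adj mul_mx_scalar -scalemxAr.
Qed.

(** Both rigid maps specialise from the generic point of the line joining
    them, so over [K(s)] they are isomorphic; clearing denominators gives
    polynomial families in both directions composing to a nonzero scalar. *)
Lemma rigid_generic_iso (F G : 'M[K]_(p, q)) :
    int F -> int G -> rigid F -> rigid G ->
  exists (a1 b1 : 'M[KX]_p) (a0 b0 : 'M[KX]_q) (D : KX),
  [/\ [/\ pcom1 a1, pcom1 b1, pcom0 a0 & pcom0 b0],
      a1 *m pC G = pC F *m a0, b1 *m pC F = pC G *m b0,
      [/\ a1 *m b1 = D%:M, b1 *m a1 = D%:M, a0 *m b0 = D%:M & b0 *m a0 = D%:M]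
    & D != 0].
Proof.
move=> iF iG rF rG.
have [|v [u [cv cu E dv du]]] := @rigid_deform F G 'X 0 iF iG rF; first by rewrite hornerX.
have [|w [z [cw cz E' dw dz]]] := @rigid_deform G F (1 - 'X) 1 iG iF rG.
  by rewrite hornerD hornerN hornerX hornerC subrr.
set L := pC F + 'X *: (pC G - pC F) in E.
have EL : pC G + (1 - 'X) *: (pC F - pC G) = L.
  rewrite /L scalerBl scale1r addrA [pC G + (pC F - pC G)]addrC subrK; congr (_ + _).
  by rewrite -scalerN opprB.
rewrite {}EL in E'.
have adjw j := adj_commute dw (cw j); have adjz j := adj_commute dz (cz j).
have adjv j := adj_commute dv (cv j); have adju j := adj_commute du (cu j).
have scA m (k l : KX) (x y : 'M[KX]_m) : (k *: x) *m (l *: y) = (k * l) *: (x *m y).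
  by rewrite -scalemxAl -scalemxAr scalerA.
exists (\det z *: (v *m \adj w)), (\det u *: (w *m \adj v)).
exists (\det w *: (u *m \adj z)), (\det v *: (z *m \adj u)).
exists (\det z * \det u * (\det v * \det w)); split.
- split=> j; rewrite -scalemxAr -scalemxAl; congr (_ *: _).
  + by rewrite mulmxA cv -!mulmxA adjw.
  + by rewrite mulmxA cw -!mulmxA adjv.
  + by rewrite mulmxA cu -!mulmxA adjz.
  + by rewrite mulmxA cz -!mulmxA adju.
- have H : \det z *: (\adj w *m pC G) = \det w *: (L *m \adj z).
    have /(congr1 (fun x => \adj w *m x *m \adj z)) := E'.
    rewrite mulmxA mul_adj_mx mul_scalar_mx -!scalemxAl => ->.
    by rewrite -!mulmxA mul_mx_adj mul_mx_scalar -scalemxAr.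
  rewrite -scalemxAl -mulmxA scalemxAr H -scalemxAr mulmxA E.
  by rewrite -scalemxAr mulmxA.
- have H : \det u *: (\adj v *m pC F) = \det v *: (L *m \adj u).
    have /(congr1 (fun x => \adj v *m x *m \adj u)) := E.
    rewrite mulmxA mul_adj_mx mul_scalar_mx -!scalemxAl => ->.
    by rewrite -!mulmxA mul_mx_adj mul_mx_scalar -scalemxAr.
  rewrite -scalemxAl -mulmxA scalemxAr H -scalemxAr mulmxA E'.
  by rewrite -scalemxAr mulmxA.
- have canc m (x y : 'M[KX]_m) : x *m \adj y *m (y *m \adj x) = (\det x * \det y)%:M.
    rewrite -mulmxA (mulmxA (\adj y)) mul_adj_mx mul_scalar_mx -scalemxAr mul_mx_adj.
    by rewrite scale_scalar_mx mulrC.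
  by split; rewrite scA canc scale_scalar_mx; congr (_%:M); ring.
- by rewrite !mulf_neq0.
Qed.
End Deformation.

(** * Two-term complexes and their chain maps *)

Section TwoTerm.
Variables (K : fieldType) (A : algType K).

Record tcx := Tcx {
  t1 : rmod A;
  t0 : rmod A;
  td : 'Hom(t1, t0);
  td_hom : rhom td }.

Definition tmor (X Y : tcx) := ('Hom(t1 X, t1 Y) * 'Hom(t0 X, t0 Y))%type.
Definition tchain X Y (f : tmor X Y) : Prop :=
  [/\ rhom f.1, rhom f.2 & (f.2 \o td X)%VF = (td Y \o f.1)%VF].
Definition tid X : tmor X X := (\1%VF, \1%VF).
Definition tcomp X Y Z (g : tmor Y Z) (f : tmor X Y) : tmor X Z :=
  ((g.1 \o f.1)%VF, (g.2 \o f.2)%VF).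

Definition tnull X Y (f : tmor X Y) : Prop :=
  exists2 h : 'Hom(t0 X, t1 Y), rhom h & f = ((h \o td X)%VF, (td Y \o h)%VF).

(** A map from [X] to the shift of [Y] is a homomorphism [t1 X -> t0 Y]; the
    null-homotopic ones are those on the right, so this is the vanishing of
    the maps from [X] to the shift of [Y] in the homotopy category. *)
Definition tvanish (X Y : tcx) : Prop :=
  forall h : 'Hom(t1 X, t0 Y), rhom h ->
  exists (v : 'Hom(t1 X, t1 Y)) (u : 'Hom(t0 X, t0 Y)),
    [/\ rhom v, rhom u & h = (td Y \o v)%VF + (u \o td X)%VF].

Implicit Types X Y Z : tcx.

Lemma tchain_comp X Y Z (g : tmor Y Z) (f : tmor X Y) :
  tchain g -> tchain f -> tchain (tcomp g f).
Proof.
move=> [g1 g0 eg] [f1 f0 ef]; split=> /=; try exact: rhom_comp.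
by rewrite -comp_lfunA ef comp_lfunA eg comp_lfunA.
Qed.
Lemma tchainZ X Y k (f : tmor X Y) : tchain f -> tchain (k *: f).
Proof.
move=> [f1 f0 ef]; split=> /=; try exact: rhomZ.
by rewrite -comp_lfunZl ef comp_lfunZr.
Qed.

Lemma tcompA X Y Z W (h : tmor Z W) (g : tmor Y Z) (f : tmor X Y) :
  tcomp h (tcomp g f) = tcomp (tcomp h g) f.
Proof. by rewrite /tcomp /= !comp_lfunA. Qed.
Lemma tcomp_idl X Y (f : tmor X Y) : tcomp (tid Y) f = f.
Proof. by rewrite /tcomp !comp_lfun1l; case: f. Qed.
Lemma tsum1 X Y (I : Type) (r : seq I) (F : I -> tmor X Y) :
  (\sum_(i <- r) F i).1 = \sum_(i <- r) (F i).1.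
Proof. by elim/big_rec2: _ => [|i y1 y2 _ <-]. Qed.
Lemma tsum2 X Y (I : Type) (r : seq I) (F : I -> tmor X Y) :
  (\sum_(i <- r) F i).2 = \sum_(i <- r) (F i).2.
Proof. by elim/big_rec2: _ => [|i y1 y2 _ <-]. Qed.
Lemma tcomp_suml X Y Z (I : Type) (r : seq I) (F : I -> tmor Y Z) (f : tmor X Y) :
  tcomp (\sum_(i <- r) F i) f = \sum_(i <- r) tcomp (F i) f.
Proof.
elim/big_rec2: _ => [|i y1 y2 _ <-]; first by rewrite /tcomp !comp_lfun0l.
by rewrite /tcomp /= !comp_lfunDl.
Qed.
Lemma tcomp_sumr X Y Z (I : Type) (r : seq I) (F : I -> tmor X Y) (g : tmor Y Z) :
  tcomp g (\sum_(i <- r) F i) = \sum_(i <- r) tcomp g (F i).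
Proof.
elim/big_rec2: _ => [|i y1 y2 _ <-]; first by rewrite /tcomp !comp_lfun0r.
by rewrite /tcomp /= !comp_lfunDr.
Qed.

Lemma tnull0 X Y : tnull (0 : tmor X Y).
Proof. by exists 0; [apply: rhom0|rewrite comp_lfun0l comp_lfun0r]. Qed.
Lemma tnullD X Y (f g : tmor X Y) : tnull f -> tnull g -> tnull (f + g).
Proof.
move=> [h hh ->] [k hk ->]; exists (h + k); first exact: rhomD.
by rewrite comp_lfunDl comp_lfunDr.
Qed.
Lemma tnull_sum X Y (I : Type) (r : seq I) (F : I -> tmor X Y) :
  (forall i, tnull (F i)) -> tnull (\sum_(i <- r) F i).
Proof. by move=> h; apply: big_ind => // *; [apply: tnull0|apply: tnullD]. Qed.
Lemma tnull_compl X Y Z (g : tmor Y Z) (f : tmor X Y) :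
  tchain g -> tnull f -> tnull (tcomp g f).
Proof.
move=> [g1 g0 eg] [h hh ->]; exists (g.1 \o h)%VF; first exact: rhom_comp.
by rewrite /tcomp /= !comp_lfunA eg.
Qed.
Lemma tnull_compr X Y Z (g : tmor Y Z) (f : tmor X Y) :
  tchain f -> tnull g -> tnull (tcomp g f).
Proof.
move=> [f1 f0 ef] [h hh ->]; exists (h \o f.2)%VF; first exact: rhom_comp.
by rewrite /tcomp /= -!comp_lfunA ef.
Qed.

(** A map between two direct sums is the sum of its components. *)
Lemma tvanish_sum (I J : finType) X Y (U : I -> tcx) (V : J -> tcx)
    (i_ : forall i, tmor (U i) X) (p_ : forall i, tmor X (U i))
    (j_ : forall j, tmor (V j) Y) (q_ : forall j, tmor Y (V j)) :
    (forall i, tchain (i_ i)) -> (forall i, tchain (p_ i)) ->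
    (forall j, tchain (j_ j)) -> (forall j, tchain (q_ j)) ->
    \sum_i tcomp (i_ i) (p_ i) = tid X -> \sum_j tcomp (j_ j) (q_ j) = tid Y ->
  (forall i j, tvanish (U i) (V j)) -> tvanish X Y.
Proof.
move=> ci cp cj cq eX eY van h hh.
have exij i j : exists vu : 'Hom(t1 (U i), t1 (V j)) * 'Hom(t0 (U i), t0 (V j)),
    [/\ rhom vu.1, rhom vu.2
      & ((q_ j).2 \o h \o (i_ i).1 = (td (V j) \o vu.1) + (vu.2 \o td (U i)))%VF].
  have [_ q2 _] := cq j; have [i1 _ _] := ci i.
  have [v [u [hv hu e]]] := van i j _ (rhom_comp (rhom_comp q2 hh) i1).
  by exists (v, u).
have [w wP] : exists w : forall ij : I * J, tmor (U ij.1) (V ij.2), forall ij,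
    [/\ rhom (w ij).1, rhom (w ij).2
      & ((q_ ij.2).2 \o h \o (i_ ij.1).1 = (td (V ij.2) \o (w ij).1) + ((w ij).2 \o td (U ij.1)))%VF].
  exists (fun ij => sval (cid (exij ij.1 ij.2))) => ij; exact: (svalP (cid (exij ij.1 ij.2))).
exists (\sum_i \sum_j ((j_ j).1 \o (w (i, j)).1 \o (p_ i).1)%VF).
exists (\sum_i \sum_j ((j_ j).2 \o (w (i, j)).2 \o (p_ i).2)%VF).
split.
- apply: rhom_sum => i _; apply: rhom_sum => j _.
  have [w1 w2 _] := wP (i, j); have [j1 _ _] := cj j; have [p1 _ _] := cp i.
  by do !apply: rhom_comp.
- apply: rhom_sum => i _; apply: rhom_sum => j _.
  have [w1 w2 _] := wP (i, j); have [_ j2 _] := cj j; have [_ p2 _] := cp i.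
  by do !apply: rhom_comp.
have e1 : \sum_i ((i_ i).1 \o (p_ i).1)%VF = \1%VF :> 'End(t1 X).
  by have := congr1 fst eX; rewrite tsum1.
have e2 : \sum_j ((j_ j).2 \o (q_ j).2)%VF = \1%VF :> 'End(t0 Y).
  by have := congr1 snd eY; rewrite tsum2.
transitivity (\sum_i \sum_j (((j_ j).2 \o (q_ j).2) \o h \o ((i_ i).1 \o (p_ i).1))%VF).
  rewrite -[LHS]comp_lfun1r -[LHS]comp_lfun1l -e1 -e2 comp_lfun_suml exchange_big /=.
  by apply: eq_bigr => j _; rewrite !comp_lfun_sumr; apply: eq_bigr => i _; rewrite !comp_lfunA.
rewrite comp_lfun_sumr comp_lfun_suml -big_split /=.
apply: eq_bigr => i _; rewrite comp_lfun_sumr comp_lfun_suml -big_split /=.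
apply: eq_bigr => j _; have [_ _ e] := wP (i, j).
have [_ _ ej] := cj j; have [_ _ ep] := cp i.
transitivity ((j_ j).2 \o ((q_ j).2 \o h \o (i_ i).1) \o (p_ i).1)%VF.
  by rewrite !comp_lfunA.
rewrite e comp_lfunDr comp_lfunDl !comp_lfunA ej; congr (_ + _).
by rewrite -!comp_lfunA ep.
Qed.
End TwoTerm.

(** * Generic isomorphism of rigid two-term complexes with the same terms *)

Section MatrixOfMap.
Import VectorInternalTheory.
Variable K : fieldType.

Lemma v2r_f2mx (U V : vectType K) (f : 'Hom(U, V)) x : v2r (f x) = v2r x *m f2mx f.
Proof. by rewrite unlock /= r2vK. Qed.
Lemma f2mx_inj (U V : vectType K) : injective (@f2mx K U V).
Proof. exact: val_inj. Qed.
Lemma f2mx_comp (U V W : vectType K) (g : 'Hom(V, W)) (f : 'Hom(U, V)) :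
  f2mx (g \o f)%VF = f2mx f *m f2mx g.
Proof.
apply/row_matrixP => i; rewrite !rowE mulmxA -[delta_mx 0 i]r2vK.
by rewrite -!v2r_f2mx comp_lfunE.
Qed.
Lemma f2mx_scalar (U : vectType K) k : f2mx (k *: \1%VF : 'End(U)) = k%:M.
Proof.
apply/row_matrixP => i; rewrite !rowE -[delta_mx 0 i]r2vK -!v2r_f2mx.
by rewrite scale_lfunE id_lfunE linearZ /= mul_mx_scalar.
Qed.
Lemma f2mxD (U V : vectType K) (f g : 'Hom(U, V)) : f2mx (f + g) = f2mx f + f2mx g.
Proof.
apply/row_matrixP => i; rewrite !rowE -[delta_mx 0 i]r2vK mulmxDr -!v2r_f2mx.
by rewrite add_lfunE linearD.
Qed.
Lemma f2mx_sum (U V : vectType K) (I : Type) (r : seq I) (F : I -> 'Hom(U, V)) :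
  f2mx (\sum_(i <- r) F i) = \sum_(i <- r) f2mx (F i).
Proof.
elim/big_rec2: _ => [|i y1 y2 _ <-]; last by rewrite f2mxD.
by apply: (addrI (f2mx 0)); rewrite -f2mxD !addr0.
Qed.
End MatrixOfMap.

Section GenericIso.
Import VectorInternalTheory.
Variables (K : fieldType) (A : algType K).
Local Notation pC := (map_mx (@polyC K)).

Definition trigid (X : tcx A) := tvanish X X.

Lemma rhom_f2mx (M N : rmod A) (f : 'Hom(M, N)) :
  rhom f <-> forall a, f2mx (ract M a) *m f2mx f = f2mx f *m f2mx (ract N a).
Proof.
split=> [h a|h a x].
  by rewrite -!f2mx_comp; congr f2mx; apply/lfunP => x; rewrite !comp_lfunE h.
by rewrite -!comp_lfunE; congr (fun_of_lfun _ x); apply: f2mx_inj; rewrite !f2mx_comp h.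
Qed.

Lemma f2mxK (M N : vectType K) (m : 'M[K]_(dim M, dim N)) : f2mx (Hom m : 'Hom(M, N)) = m.
Proof. by []. Qed.

Lemma coef_mulmx (m n p : nat) (B : 'M[{poly K}]_(m, n)) (C : 'M[{poly K}]_(n, p)) k :
  map_mx (coefp k) (B *m C) =
  \sum_(i < k.+1) map_mx (coefp i) B *m map_mx (coefp (k - i)) C.
Proof.
apply/matrixP => x y; rewrite summxE !mxE /coefp /= coef_sum.
under [LHS]eq_bigr do rewrite coefM.
by rewrite exchange_big; apply: eq_bigr => i _; rewrite mxE; apply: eq_bigr => j _; rewrite !mxE.
Qed.
Lemma coef_pCmx (m n p : nat) (B : 'M[K]_(m, n)) (C : 'M[{poly K}]_(n, p)) k :
  map_mx (coefp k) (pC B *m C) = B *m map_mx (coefp k) C.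
Proof.
apply/matrixP => x y; rewrite !mxE /coefp /= coef_sum.
by apply: eq_bigr => i _; rewrite !mxE coefCM.
Qed.
Lemma coef_mxpC (m n p : nat) (B : 'M[{poly K}]_(m, n)) (C : 'M[K]_(n, p)) k :
  map_mx (coefp k) (B *m pC C) = map_mx (coefp k) B *m C.
Proof.
apply/matrixP => x y; rewrite !mxE /coefp /= coef_sum.
by apply: eq_bigr => i _; rewrite !mxE coefMC.
Qed.

(** The leading coefficient of the identities satisfied by the generic
    isomorphism: a coefficient of a product of polynomials is a sum of products of
    coefficients, whence a sum of maps through the other complex. Over a finite
    field no specialisation of the generic isomorphism need be invertible. *)
Lemma trigid_generic_same (P Q : rmod A) (f g : 'Hom(P, Q)) (hf : rhom f) (hg : rhom g)
    (X := Tcx hf) (Y := Tcx hg) : trigid X -> trigid Y ->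
  exists (m : nat) (a : 'I_m -> tmor X Y) (b : 'I_m -> tmor Y X),
  [/\ forall i, tchain (a i), forall i, tchain (b i),
      \sum_i tcomp (b i) (a i) = tid X & \sum_i tcomp (a i) (b i) = tid Y].
Proof.
have matrix_rigid (h : 'Hom(P, Q)) (hh : rhom h) : trigid (Tcx hh) ->
    forall H, (forall a, f2mx (ract P a) *m H = H *m f2mx (ract Q a)) ->
    exists v u, [/\ forall a, f2mx (ract P a) *m v = v *m f2mx (ract P a),
      forall a, f2mx (ract Q a) *m u = u *m f2mx (ract Q a)
      & H = v *m f2mx h + f2mx h *m u].
  move=> r H iH; have [|v [u [/rhom_f2mx hv /rhom_f2mx hu e]]] := r (Hom H : 'Hom(P, Q)).
    exact/rhom_f2mx.
  exists (f2mx v), (f2mx u); split=> //.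
  by rewrite -[LHS](f2mxK (M := P) (N := Q)) e f2mxD !f2mx_comp.
move=> /matrix_rigid rX /matrix_rigid rY.
have /rhom_f2mx intf := hf; have /rhom_f2mx intg := hg.
have [a1 [b1 [a0 [b0 [D [[ca1 cb1 ca0 cb0] ea eb [e1 e2 e3 e4] D0]]]]]] :=
  rigid_generic_iso intf intg rX rY.
pose k := (size D).-1; have Dk : D`_k != 0 by rewrite lead_coef_eq0.
pose cf (M : rmod A) (m : 'M[{poly K}]_(dim M)) i : 'End(M) := Hom (map_mx (coefp i) m).
have cfh (M : rmod A) (m : 'M[{poly K}]_(dim M)) i :
    (forall a, pC (f2mx (ract M a)) *m m = m *m pC (f2mx (ract M a))) -> rhom (cf M m i).
  by move=> cm; apply/rhom_f2mx => a; rewrite f2mxK -coef_pCmx cm coef_mxpC.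
have cfs (M : rmod A) (m m' : 'M[{poly K}]_(dim M)) : m *m m' = D%:M ->
    \sum_(i < k.+1) ((D`_k)^-1 *: cf M m' (k - i)%N \o cf M m i)%VF = \1%VF.
  move=> e; apply: f2mx_inj; rewrite f2mx_sum.
  under eq_bigr do rewrite f2mx_comp.
  have sc (n : 'M[{poly K}]_(dim M)) i c : f2mx (c *: cf M n i) = c *: map_mx (coefp i) n.
    have -> : c *: cf M n i = ((c *: \1) \o cf M n i)%VF by rewrite -comp_lfunZl comp_lfun1l.
    by rewrite f2mx_comp f2mx_scalar mul_mx_scalar.
  under eq_bigr do rewrite sc -scalemxAr.
  rewrite -scaler_sumr -coef_mulmx e -[\1%VF]scale1r f2mx_scalar.
  by apply/matrixP => x y; rewrite !mxE /coefp /= coefMn mulrnAr mulVf.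
exists k.+1, (fun i => (cf P a1 i, cf Q a0 i)).
exists (fun i => (D`_k)^-1 *: ((cf P b1 (k - i)%N, cf Q b0 (k - i)%N) : tmor Y X)).
split.
- move=> i; split; try exact: cfh.
  by apply: f2mx_inj; rewrite /= !f2mx_comp !f2mxK -coef_pCmx -ea coef_mxpC.
- move=> i; apply: tchainZ; split; try exact: cfh.
  by apply: f2mx_inj; rewrite /= !f2mx_comp !f2mxK -coef_pCmx -eb coef_mxpC.
- rewrite [LHS]surjective_pairing tsum1 tsum2; congr (_, _); exact: cfs.
rewrite [LHS]surjective_pairing tsum1 tsum2 (reindex_inj rev_ord_inj) /=.
rewrite [in X in (_, X)](reindex_inj rev_ord_inj) /=.
congr (_, _).
  rewrite -[RHS](cfs P b1 a1) //; apply: eq_bigr => i _.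
  by rewrite subSS -comp_lfunZl comp_lfunZr subKn // -ltnS.
rewrite -[RHS](cfs Q b0 a0) //; apply: eq_bigr => i _.
by rewrite subSS -comp_lfunZl comp_lfunZr subKn // -ltnS.
Qed.

Lemma trigid_generic (X Y : tcx A) :
    riso (t1 X) (t1 Y) -> riso (t0 X) (t0 Y) -> trigid X -> trigid Y ->
  exists (m : nat) (a : 'I_m -> tmor X Y) (b : 'I_m -> tmor Y X),
  [/\ forall i, tchain (a i), forall i, tchain (b i),
      \sum_i tcomp (b i) (a i) = tid X & \sum_i tcomp (a i) (b i) = tid Y].
Proof.
case: X => P Q f hf /= /riso_inverses [p1 [q1 [hp1 hq1 e1 e1']]] /riso_inverses [p0 [q0 [hp0 hq0 e0 e0']]] rX rY.
have hg : rhom (q0 \o td Y \o p1)%VF by do !apply: rhom_comp => //; exact: td_hom.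
pose Z := Tcx hg.
pose phi : tmor Z Y := (p1, p0); pose psi : tmor Y Z := (q1, q0).
have cphi : tchain phi by split=> //=; rewrite !comp_lfunA e0' comp_lfun1l.
have cpsi : tchain psi by split=> //=; rewrite -!comp_lfunA e1' comp_lfun1r.
have pp : tcomp psi phi = tid Z by rewrite /tcomp /= e1 e0.
have pp' : tcomp phi psi = tid Y by rewrite /tcomp /= e1' e0'.
have rZ : trigid Z.
  move=> h hh; have [|v [u [hv hu e]]] := rY (p0 \o h \o q1)%VF.
    by do !apply: rhom_comp.
  exists (q1 \o v \o p1)%VF, (q0 \o u \o p0)%VF; split; try by do !apply: rhom_comp.
  rewrite /= -[LHS]comp_lfun1r -[LHS]comp_lfun1l -e1 -e0.
  transitivity (q0 \o (p0 \o h \o q1) \o p1)%VF; first by rewrite !comp_lfunA.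
  rewrite e comp_lfunDr comp_lfunDl !comp_lfunA; congr (_ + _).
    by rewrite -(comp_lfunA _ p1) e1' comp_lfun1r.
  by rewrite -(comp_lfunA _ p0) e0' comp_lfun1r.
have [m [a [b [ca cb ba ab]]]] := trigid_generic_same rX rZ.
exists m, (fun i => tcomp phi (a i)), (fun i => tcomp (b i) psi); split.
- by move=> i; apply: tchain_comp.
- by move=> i; apply: tchain_comp.
- by rewrite -[RHS]ba; apply: eq_bigr => i _; rewrite -tcompA (tcompA psi) pp tcomp_idl.
transitivity (tcomp phi (tcomp (\sum_i tcomp (a i) (b i)) psi)).
  rewrite tcomp_suml tcomp_sumr; apply: eq_bigr => i _; by rewrite -!tcompA.
by rewrite ab tcomp_idl pp'.
Qed.
End GenericIso.

Lemma linear_ext_paths (K : fieldType) (Q : quiver) (V : lmodType K)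
    (u v : pathalg K Q -> V) : linear u -> linear v ->
  (forall p, u (bpath K p) = v (bpath K p)) -> u =1 v.
Proof.
move=> lu lv.
pose U := HB.pack_for {linear pathalg K Q -> V} u (GRing.isLinear.Build _ _ _ _ _ lu).
pose W := HB.pack_for {linear pathalg K Q -> V} v (GRing.isLinear.Build _ _ _ _ _ lv).
exact: (@linear_path_ext _ _ _ U W).
Qed.

(** * Generators of the preprojective algebra of type A *)

(** The relations give one equation at each inner vertex and one at each end of the
    quiver; this lemma puts them together. *)
Lemma shifted_sum_eq (V : nmodType) (m : nat) (F G : 'I_m -> V) :
    (forall i j : 'I_m, j = i.+1 :> nat -> F i = G j) ->
    (forall i : 'I_m, i = 0%N :> nat -> G i = 0) ->
    (forall i : 'I_m, i.+1 = m -> F i = 0) ->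
  \sum_i F i = \sum_i G i.
Proof.
case: m F G => [|m] F G FG G0 Fm; first by rewrite !big_ord0.
rewrite big_ord_recr big_ord_recl /= Fm // G0 // addr0 add0r.
by apply: eq_bigr => i _; apply: FG.
Qed.

Section Generators.
Variables (K : fieldType) (m : nat).
Local Notation n := m.+1.
Local Notation Q := (dynkinA_double n).
Local Notation KQ := (pathalg K Q).
Local Notation A := (preproj K n).
Local Open Scope quotient_scope.

Definition pcl (x : KQ) : A := \pi_(bquot (@preproj_proper K n)) x.

Lemma pclD x y : pcl (x + y) = pcl x + pcl y.
Proof. exact: bquot_piD. Qed.
Lemma pclM x y : pcl (x * y) = pcl x * pcl y.
Proof. exact: bquot_piM. Qed.
Lemma pclZ k x : pcl (k *: x) = k *: pcl x.
Proof. exact: bquot_piZ. Qed.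
Lemma pcl1 : pcl 1 = 1.
Proof. by []. Qed.
Lemma pcl_surj a : exists x, a = pcl x.
Proof. exact: bquot_ex. Qed.
Lemma pcl_eqP x y : pcl x = pcl y <-> ideal_gen (@preproj_rel K n) (x - y).
Proof.
split=> [e|h]; first by apply/bidealP/(bquot_eqP (@preproj_proper K n)).
by apply/(bquot_eqP (@preproj_proper K n))/bidealP.
Qed.
Lemma pcl0 : pcl 0 = 0.
Proof. by rewrite -(scale0r 0) pclZ scale0r. Qed.
Lemma pcl_sum (I : Type) (r : seq I) (p : pred I) (F : I -> KQ) :
  pcl (\sum_(i <- r | p i) F i) = \sum_(i <- r | p i) pcl (F i).
Proof. by elim/big_rec2: _ => [|i y1 y2 _ <-]; rewrite ?pcl0 ?pclD. Qed.

Let tv (v : vertex Q) : KQ := bpath K (ptriv v).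
Let Ek (k : nat) : KQ := \sum_(v : vertex Q | v.+1 == k) tv v.
Let al : 'I_m -> KQ := @alpha K n.
Let be : 'I_m -> KQ := @beta K n.

(** The idempotent of vertex [k], counted from 1; it is 0 for every other
    natural number, so that leaving the range of vertices gives 0. *)
Definition ee (k : nat) : A := pcl (Ek k).
Definition yy : A := pcl (\sum_(i < m) al i).
Definition xx : A := pcl (\sum_(i < m) be i).

Lemma triv_mul v (p : qpath Q) : tv v * bpath K p = if v == pstart p then bpath K p else 0.
Proof. by rewrite [LHS]pmul_bpath /pcat0 pcat_trivl; case: ifP. Qed.
Lemma mul_triv v (p : qpath Q) : bpath K p * tv v = if v == pend p then bpath K p else 0.
Proof. by rewrite [LHS]pmul_bpath /pcat0 pcat_trivr; case: ifP. Qed.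

Lemma Ek_mul k (p : qpath Q) : Ek k * bpath K p = if (pstart p).+1 == k then bpath K p else 0.
Proof.
rewrite mulr_suml; under eq_bigr do rewrite triv_mul.
case: ifP => [e|n']; last first.
  by rewrite big1 // => v /eqP ev; case: eqP => // e; rewrite -ev e eqxx in n'.
rewrite (bigD1 (pstart p)) //= eqxx big1 ?addr0 // => v /andP [_ /negPf ->] //.
Qed.
Lemma mul_Ek k (p : qpath Q) : bpath K p * Ek k = if (pend p).+1 == k then bpath K p else 0.
Proof.
rewrite mulr_sumr; under eq_bigr do rewrite mul_triv.
case: ifP => [e|n']; last first.
  by rewrite big1 // => v /eqP ev; case: eqP => // e; rewrite -ev e eqxx in n'.
rewrite (bigD1 (pend p)) //= eqxx big1 ?addr0 // => v /andP [_ /negPf ->] //.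
Qed.

Lemma Ek_al k i : Ek k * al i = if i.+1 == k then al i else 0.
Proof. exact: Ek_mul. Qed.
Lemma Ek_be k i : Ek k * be i = if i.+2 == k then be i else 0.
Proof. exact: Ek_mul. Qed.
Lemma al_Ek k i : al i * Ek k = if i.+2 == k then al i else 0.
Proof. exact: mul_Ek. Qed.
Lemma be_Ek k i : be i * Ek k = if i.+1 == k then be i else 0.
Proof. exact: mul_Ek. Qed.

Lemma ee_out k : (k == 0)%N || (n < k)%N -> ee k = 0.
Proof.
move=> h; rewrite /ee /Ek big_pred0 ?pcl0 // => v.
by apply/negbTE; move: h; have := ltn_ord v; lia.
Qed.

Lemma ee_mul k l : ee k * ee l = if k == l then ee k else 0.
Proof.
rewrite /ee -pclM {2}/Ek mulr_sumr.
under eq_bigr do rewrite Ek_mul /pstart /=.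
case: ifP => [/eqP ->|kl]; first by congr pcl; apply: eq_bigr => v ->.
by rewrite big1 ?pcl0 // => v /eqP ->; rewrite eq_sym kl.
Qed.

Lemma ee_sum : \sum_(k < n.+1) ee k = 1.
Proof.
rewrite big_ord_recl ee_out // add0r -pcl1 /ee -pcl_sum; congr pcl.
rewrite -[RHS]/(pone K Q) /pone; apply: eq_bigr => i _.
by rewrite /Ek (big_pred1 i) // => v; rewrite /= /bump /= eqSS.
Qed.

Lemma ee_yy k : ee k * yy = yy * ee k.+1.
Proof.
rewrite /ee /yy -!pclM mulr_sumr mulr_suml; congr pcl; apply: eq_bigr => i _.
by rewrite Ek_al al_Ek eqSS.
Qed.
Lemma ee_xx k : ee k.+1 * xx = xx * ee k.
Proof.
rewrite /ee /xx -!pclM mulr_sumr mulr_suml; congr pcl; apply: eq_bigr => i _.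
by rewrite Ek_be be_Ek eqSS.
Qed.

Lemma al_be i j : i != j -> al i * be j = 0.
Proof.
move=> nij; rewrite [LHS]pmul_bpath /pcat0 pcatN //.
Qed.
Lemma be_al i j : i != j -> be i * al j = 0.
Proof.
move=> nij; rewrite [LHS]pmul_bpath /pcat0 pcatN //.
Qed.

Lemma al_yy i : pcl (al i) = ee i.+1 * yy.
Proof.
rewrite /yy /ee -pclM mulr_sumr (bigD1 i) //= Ek_al eqxx big1 ?addr0 // => j /negPf nj.
by rewrite Ek_al eqSS; case: eqP => // /val_inj ej; rewrite ej eqxx in nj.
Qed.
Lemma be_xx i : pcl (be i) = ee i.+2 * xx.
Proof.
rewrite /xx /ee -pclM mulr_sumr (bigD1 i) //= Ek_be eqxx big1 ?addr0 // => j /negPf nj.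
by rewrite Ek_be !eqSS; case: eqP => // /val_inj ej; rewrite ej eqxx in nj.
Qed.

Lemma pcl_rel x : preproj_rel x -> pcl x = 0.
Proof. by move=> h; rewrite -pcl0; apply/pcl_eqP; rewrite subr0; apply: ideal_gen_rel. Qed.

(** The mesh relations, including the two boundary ones, are exactly the
    commutativity of [xx] and [yy]. *)
Lemma xxyy : xx * yy = yy * xx.
Proof.
have e1 : xx * yy = \sum_(i < m) pcl (be i * al i).
  rewrite /xx /yy -pclM -pcl_sum mulr_suml; congr pcl; apply: eq_bigr => i _.
  rewrite mulr_sumr (bigD1 i) //= big1 ?addr0 // => j; rewrite eq_sym; exact: be_al.
have e2 : yy * xx = \sum_(i < m) pcl (al i * be i).
  rewrite /xx /yy -pclM -pcl_sum mulr_suml; congr pcl; apply: eq_bigr => i _.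
  rewrite mulr_sumr (bigD1 i) //= big1 ?addr0 // => j; rewrite eq_sym; exact: al_be.
rewrite e1 e2.
have mesh (i j : 'I_m) : j = i.+1 :> nat -> pcl (be i * al i) = pcl (al j * be j).
  move=> e; apply/pcl_eqP; apply: ideal_gen_rel; exact: (@preproj_mesh K n).
have first (i : 'I_m) : i = 0%N :> nat -> pcl (al i * be i) = 0.
  by move=> e; apply: pcl_rel; exact: (@preproj_first K n).
have last (i : 'I_m) : i.+1 = m -> pcl (be i * al i) = 0.
  by move=> e; apply: pcl_rel; exact: (@preproj_last K n).
exact: shifted_sum_eq.
Qed.

Lemma preproj_ind (P : A -> Prop) :
    (forall k a b, P a -> P b -> P (k *: a + b)) -> (forall a b, P a -> P b -> P (a * b)) ->
    (forall k, P (ee k)) -> P xx -> P yy ->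
  forall a, P a.
Proof.
move=> PL PM Pe Px Py a.
have P0 : P 0 by rewrite -(ee_out (k := 0)).
have PD a1 a2 : P a1 -> P a2 -> P (a1 + a2) by move=> h1 h2; rewrite -[a1]scale1r; apply: PL.
have PZ k a1 : P a1 -> P (k *: a1) by move=> h; rewrite -[_ *: _]addr0; apply: PL.
have [x ->] := pcl_surj a; rewrite [x]pathalgE pcl_sum.
apply: big_ind => // p _; rewrite pclZ; apply: PZ.
have Pt v : P (pcl (tv v)).
  have -> : tv v = Ek v.+1 by rewrite /Ek (big_pred1 v) // => w; rewrite eqSS.
  exact: Pe.
have Pa (c : arrow Q) : P (pcl (bpath K (parr c))).
  by case: c => i; [rewrite [X in P X]al_yy|rewrite [X in P X]be_xx]; apply: PM.
case: p => -[v s] /= w; elim: s v w => [|c s IH] v w.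
  have -> : @QPath Q (v, [::]) w = ptriv v by apply: qpathP.
  exact: Pt.
have [ev ws] : source c = v /\ walk (target c) s by have /= /andP [/eqP] := w.
have -> : bpath K (@QPath Q (v, c :: s) w) = bpath K (parr c) * bpath K (@QPath Q (target c, s) ws).
  rewrite [RHS]pmul_bpath /pcat0.
  have [|r -> [sr _ ar]] := @pcatP _ (parr c) (@QPath Q (target c, s) ws); first by [].
  by congr bpath; apply: qpathP; rewrite ?sr ?ar // /pstart /= ev.
by rewrite pclM; apply: PM => //; apply: IH.
Qed.

(** * Modules as graded vector spaces with two commuting operators *)

Section BuildModule.
(* [E k] is the projection to degree [k]; [X] lowers the degree, [Y] raises it. *)
Variables (V : vectType K) (E : nat -> 'End(V)) (X Y : 'End(V)).
Hypotheses (E_out : forall k, (k == 0)%N || (n < k)%N -> E k = 0)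
  (E_sum : (\sum_(k < n.+1) E k) = \1%VF)
  (E_mul : forall k l, (E l \o E k)%VF = if k == l then E k else 0)
  (E_X : forall k, (X \o E k.+1)%VF = (E k \o X)%VF)
  (E_Y : forall k, (Y \o E k)%VF = (E k.+1 \o Y)%VF)
  (XY : (X \o Y)%VF = (Y \o X)%VF).

Let arr_op (c : arrow Q) : 'End(V) :=
  match c with inl i => (Y \o E i.+1)%VF | inr i => (X \o E i.+2)%VF end.
Let path_op (p : qpath Q) : 'End(V) :=
  foldl (fun h c => (arr_op c \o h)%VF) (E (pstart p).+1) (parrows p).
Let alg_op : KQ -> 'End(V) := plin path_op.

Let arr_op_target (c : arrow Q) : (E (target c).+1 \o arr_op c)%VF = arr_op c.
Proof.
by case: c => i /=; rewrite /bump /= comp_lfunA ?add1n -?E_Y -?E_X -comp_lfunA E_mul eqxx.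
Qed.
Let path_op_end (p : qpath Q) : (E (pend p).+1 \o path_op p)%VF = path_op p.
Proof.
rewrite /path_op /pend; case: p => -[v s] w /=; rewrite /pstart /parrows /=.
elim/last_ind: s {w} => [|s c _] /=; first by rewrite E_mul eqxx.
by rewrite foldl_rcons map_rcons last_rcons comp_lfunA arr_op_target.
Qed.
Let path_opE (p : qpath Q) : path_op p =
  (foldl (fun h c => (arr_op c \o h)%VF) \1%VF (parrows p) \o E (pstart p).+1)%VF.
Proof.
rewrite /path_op; elim/last_ind: (parrows p) => [|s c IH] /=; first by rewrite comp_lfun1l.
by rewrite !foldl_rcons IH comp_lfunA.
Qed.

Let path_op_cat (p q : qpath Q) : oapp path_op 0 (pcat p q) = (path_op q \o path_op p)%VF.
Proof.
case: (eqVneq (pend p) (pstart q)) => [e|ne].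
  have [r -> [sr _ ar]] /= := pcatP e.
  rewrite (path_opE q) -e -comp_lfunA path_op_end /path_op ar sr foldl_cat.
  elim/last_ind: (parrows q) => [|s c IH] /=; first by rewrite comp_lfun1l.
  by rewrite !foldl_rcons IH comp_lfunA.
rewrite (pcatN ne) /= path_opE -(path_op_end p) -comp_lfunA (comp_lfunA (E (pstart q).+1)).
rewrite E_mul eqSS; case: eqP => [/val_inj e|_]; first by rewrite e eqxx in ne.
by rewrite comp_lfun0l comp_lfun0r.
Qed.

Let alg_op_bpath (p : qpath Q) : alg_op (bpath K p) = path_op p.
Proof. exact: plin_bpath. Qed.

Let alg_opM f g : alg_op (f * g) = (alg_op g \o alg_op f)%VF.
Proof.
have M1 p h : alg_op (bpath K p * h) = (alg_op h \o alg_op (bpath K p))%VF.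
  have l1 : linear (fun h : KQ => alg_op (bpath K p * h)).
    by move=> k a b; rewrite mulrDr -pathalg_scalerAr /alg_op linearP.
  have l2 : linear (fun h : KQ => (alg_op h \o alg_op (bpath K p))%VF).
    by move=> k a b; rewrite /alg_op linearP comp_lfunDl comp_lfunZl.
  apply: (linear_ext_paths l1 l2) => q.
  rewrite !alg_op_bpath -path_op_cat [X in alg_op X]pmul_bpath /pcat0.
  by case: (pcat p q) => [r|] /=; rewrite ?alg_op_bpath ?[LHS]linear0.
have l1 : linear (fun h : KQ => alg_op (h * g)).
  by move=> k a b; rewrite mulrDl -pathalg_scalerAl /alg_op linearP.
have l2 : linear (fun h : KQ => (alg_op g \o alg_op h)%VF).
  by move=> k a b; rewrite /alg_op linearP comp_lfunDr comp_lfunZr.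
by apply: (linear_ext_paths l1 l2) => p; exact: M1.
Qed.

Let alg_op_al i : alg_op (al i) = (Y \o E i.+1)%VF.
Proof. by rewrite [LHS]alg_op_bpath /path_op /= -comp_lfunA E_mul eqxx. Qed.
Let alg_op_be i : alg_op (be i) = (X \o E i.+2)%VF.
Proof. by rewrite [LHS]alg_op_bpath /path_op /= /bump /= add1n -comp_lfunA E_mul eqxx. Qed.

Let alg_op_albe i : alg_op (al i * be i) = (X \o (Y \o E i.+1))%VF.
Proof.
rewrite alg_opM alg_op_al alg_op_be -comp_lfunA; congr (_ \o _)%VF.
by rewrite E_Y comp_lfunA E_mul eqxx.
Qed.
Let alg_op_beal i : alg_op (be i * al i) = (X \o (Y \o E i.+2))%VF.
Proof.
rewrite alg_opM alg_op_al alg_op_be [RHS]comp_lfunA XY -!comp_lfunA; congr (_ \o _)%VF.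
by rewrite comp_lfunA -E_X -comp_lfunA E_mul eqxx.
Qed.

Let alg_op_ideal x : ideal_gen (@preproj_rel K n) x -> alg_op x = 0.
Proof.
elim=> {x} [x []||x y _ ex _ ey|a x _ ex|a x _ ex].
- move=> i j e; rewrite /alg_op linearB -/alg_op [X in X - _]alg_op_beal.
  by rewrite [X in _ - X]alg_op_albe e subrr.
- by move=> i e; rewrite [LHS]alg_op_albe e comp_lfunA XY -comp_lfunA E_X E_out // comp_lfun0l comp_lfun0r.
- move=> i e; rewrite [LHS]alg_op_beal E_Y.
  by rewrite E_out ?comp_lfun0l ?comp_lfun0r //=; move: e => /=; lia.
- exact: linear0.
- transitivity (alg_op x + alg_op y); first exact: linearD.
  by rewrite ex ey addr0.
- by rewrite alg_opM ex comp_lfun0l.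
- by rewrite alg_opM ex comp_lfun0r.
Qed.

Let cl_op (a : A) : 'End(V) := alg_op (repr (a : bquot (@preproj_proper K n))).
Let cl_opE x : cl_op (pcl x) = alg_op x.
Proof.
apply/eqP; rewrite -subr_eq0 -[X in X == 0](linearB (plin path_op)); apply/eqP.
by apply: alg_op_ideal; apply/bidealP/bquot_repr.
Qed.
Let cl_op_linear : linear cl_op.
Proof.
move=> k a b; have [[x ->] [y ->]] := (pcl_surj a, pcl_surj b).
by rewrite -pclZ -pclD !cl_opE /alg_op linearP.
Qed.
Let alg_op_Ek k : alg_op (Ek k) = E k.
Proof.
rewrite [LHS](linear_sum (plin path_op)) /=.
under eq_bigr do rewrite plin_bpath /path_op /=.
case: (boolP ((k == 0)%N || (n < k)%N)) => h.
  rewrite E_out // big_pred0 // => v; apply/negbTE; move: h; have := ltn_ord v; lia.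
have kb : (k.-1 < n)%N by move: h; lia.
rewrite (big_pred1 (Ordinal kb)) /=; first by congr E; rewrite /pstart /=; move: h; lia.
by move=> v; rewrite /= -val_eqE /=; move: h; lia.
Qed.
Let cl_op1 : cl_op 1 = \1%VF.
Proof.
rewrite -ee_sum -E_sum.
pose c := HB.pack_for {linear A -> 'End(V)} cl_op (GRing.isLinear.Build _ _ _ _ _ cl_op_linear).
rewrite -[cl_op]/(c : A -> _) linear_sum; apply: eq_bigr => k _ /=.
by rewrite cl_opE alg_op_Ek.
Qed.
Let cl_opM a b : cl_op (a * b) = (cl_op b \o cl_op a)%VF.
Proof.
have [[x ->] [y ->]] := (pcl_surj a, pcl_surj b).
by rewrite -pclM !cl_opE alg_opM.
Qed.

(* Opaque: only the values on the generators matter from here on. *)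
Fact gr_act : {r : A -> 'End(V) | [/\ linear r, r 1 = \1%VF,
  forall a b, r (a * b) = (r b \o r a)%VF, forall k, r (ee k) = E k & r xx = X /\ r yy = Y]}.
Proof.
exists cl_op; split; [exact: cl_op_linear|exact: cl_op1|exact: cl_opM| |split].
- by move=> k; rewrite cl_opE alg_op_Ek.
- rewrite cl_opE [LHS](linear_sum (plin path_op)) /=.
  under eq_bigr do rewrite [plin _ _]alg_op_be.
  rewrite -comp_lfun_sumr -[RHS]comp_lfun1r -E_sum !big_ord_recl.
  rewrite E_out // add0r comp_lfunDr.
  by have -> : (X \o E (bump 0 0))%VF = 0; [rewrite E_X E_out // comp_lfun0l|rewrite add0r].
rewrite cl_opE [LHS](linear_sum (plin path_op)) /=.
under eq_bigr do rewrite [plin _ _]alg_op_al.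
rewrite -comp_lfun_sumr -[RHS]comp_lfun1r -E_sum big_ord_recl big_ord_recr /=.
rewrite E_out // add0r comp_lfunDr.
have -> : (Y \o E (bump 0 m))%VF = 0; last by rewrite addr0.
by rewrite E_Y E_out ?comp_lfun0l // /bump /=; lia.
Qed.

Fact gr_act_linear : linear (sval gr_act).
Proof. by have [h _ _ _ _] := svalP gr_act. Qed.
Fact gr_act1 : sval gr_act 1 = \1%VF.
Proof. by have [_ h _ _ _] := svalP gr_act. Qed.
Fact gr_actM a b : sval gr_act (a * b) = (sval gr_act b \o sval gr_act a)%VF.
Proof. by have [_ _ h _ _] := svalP gr_act. Qed.
Definition gr_mod : rmod A := RMod gr_act_linear gr_act1 gr_actM.
Lemma gr_mod_ee k : ract gr_mod (ee k) = E k.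
Proof. by have [_ _ _ h _] := svalP gr_act; exact: h. Qed.
Lemma gr_mod_xx : ract gr_mod xx = X.
Proof. by have [_ _ _ _ [h _]] := svalP gr_act; exact: h. Qed.
Lemma gr_mod_yy : ract gr_mod yy = Y.
Proof. by have [_ _ _ _ [_ h]] := svalP gr_act; exact: h. Qed.
End BuildModule.
End Generators.

Arguments gr_mod : simpl never.

(** * Monomials and the radical *)

Section Monomials.
Variables (K : fieldType) (m : nat).
Local Notation n := m.+1.
Local Notation A := (preproj K n).
Local Notation ee := (@ee K m).
Local Notation xx := (@xx K m).
Local Notation yy := (@yy K m).

Definition mon (a b : nat) : A := xx ^+ a * yy ^+ b.

Lemma mon00 : mon 0 0 = 1. Proof. by rewrite /mon !expr0 mulr1. Qed.
Lemma commXY a b : xx ^+ a * yy ^+ b = yy ^+ b * xx ^+ a.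
Proof. by apply: commrX; apply/commr_sym/commrX/commr_sym; exact: xxyy. Qed.
Lemma mon_xx a b : mon a b * xx = mon a.+1 b.
Proof. by rewrite /mon -mulrA -[X in _ * (_ * X)]expr1 -commXY mulrA -exprD addn1. Qed.
Lemma mon_yy a b : mon a b * yy = mon a b.+1.
Proof. by rewrite /mon -mulrA exprSr. Qed.
Lemma mon_mul a b c d : mon a b * mon c d = mon (a + c) (b + d).
Proof. by rewrite /mon mulrA -(mulrA _ (yy ^+ b)) -commXY !exprD !mulrA. Qed.

Lemma ee_xxn l a : ee l * xx ^+ a = if (a < l)%N then xx ^+ a * ee (l - a) else 0.
Proof.
elim: a l => [|a IH] [|l]; rewrite ?expr0 ?mulr1 ?mul1r ?subn0 //.
- by rewrite ee_out.
- by rewrite ee_out // mul0r.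
by rewrite exprS mulrA ee_xx -mulrA IH ltnS subSS; case: ifP; rewrite ?mulr0 // mulrA.
Qed.
Lemma ee_yyn l b : ee l * yy ^+ b = yy ^+ b * ee (l + b).
Proof.
elim: b l => [|b IH] l; rewrite ?expr0 ?mulr1 ?mul1r ?addn0 //.
by rewrite exprS mulrA ee_yy -mulrA IH mulrA addSnnS.
Qed.

Lemma ee_mon l a b : (a < l)%N -> ee l * mon a b = mon a b * ee (l + b - a).
Proof.
move=> h; rewrite /mon mulrA ee_xxn h -mulrA ee_yyn mulrA; congr (_ * ee _); lia.
Qed.
(** As [x] and [y] commute, the steps of a path can be taken in either order, and
    one of the orders makes a path that leaves the rectangle pass through a
    nonexistent vertex. *)
Lemma ee_mon0 l a b : ~~ ((a < l) && (l + b <= n))%N -> ee l * mon a b = 0.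
Proof.
rewrite negb_and => /orP [h|h].
  by rewrite /mon mulrA ee_xxn (negbTE h) mul0r.
rewrite /mon commXY mulrA ee_yyn ee_out ?mulr0 ?mul0r //; move: h; lia.
Qed.
Lemma mon_big a b : (n <= a)%N || (n <= b)%N -> mon a b = 0.
Proof.
move=> h; rewrite -[LHS]mul1r -(ee_sum K m) mulr_suml big1 // => k _.
apply: ee_mon0; have := ltn_ord k; move: h.
case: (posnP k) => [->|]; first by rewrite ltn0.
lia.
Qed.

Lemma ract_ee (M : rmod A) k z : ract M (ee k) (ract M (ee k) z) = ract M (ee k) z.
Proof. by rewrite -ractMx ee_mul eqxx. Qed.

Definition jrad (M : rmod A) : {vspace M} := (limg (ract M xx) + limg (ract M yy))%VS.

Lemma radP (M : rmod A) z : reflect (exists z1 z2, z = ract M xx z1 + ract M yy z2) (z \in jrad M).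
Proof.
apply: (iffP memv_addP) => [[u /memv_imgP [z1 _ ->] [w /memv_imgP [z2 _ ->] ->]]|[z1 [z2 ->]]].
  by exists z1, z2.
exists (ract M xx z1); first by apply: memv_img; apply: memvf.
by exists (ract M yy z2) => //; apply: memv_img; apply: memvf.
Qed.

Lemma rad_hom (M N : rmod A) (f : 'Hom(M, N)) z : rhom f -> z \in jrad M -> f z \in jrad N.
Proof.
move=> hf /radP [z1 [z2 ->]]; apply/radP; exists (f z1), (f z2).
by rewrite linearD /= !hf.
Qed.

Lemma mon_rad (M : rmod A) a b z : (0 < a + b)%N -> ract M (mon a b) z \in jrad M.
Proof.
case: a => [|a]; last first.
  by move=> _; rewrite -mon_xx ractMx; apply/radP; exists (ract M (mon a b) z), 0; rewrite linear0 addr0.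
case: b => // b _; rewrite -mon_yy ractMx; apply/radP.
by exists 0, (ract M (mon 0 b) z); rewrite linear0 add0r.
Qed.

(** The radical is nilpotent, so a submodule that is everything modulo the
    radical is everything. *)
Lemma nakayama (M : rmod A) (U : {vspace M}) :
  rsubmod U -> (U + jrad M)%VS = fullv -> U = fullv.
Proof.
move=> sU full; apply/vspaceP => z; rewrite memvf.
suff H N a b z' : (2 * n - (a + b) < N)%N -> ract M (mon a b) z' \in U.
  by have := H (2 * n - 0).+1 0%N 0%N z (leqnn _); rewrite mon00 ract1x.
elim: N a b z' => // N IH a b z' lt.
have [h|h] := boolP ((n <= a)%N || (n <= b)%N); first by rewrite mon_big // ract0 mem0v.
have /memv_addP [u uU [w /radP [z1 [z2 ->]] ->]] : z' \in (U + jrad M)%VS by rewrite full memvf.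
rewrite !linearD /= -!ractMx -[xx]mulr1 -mon00 -[yy]mulr1 -mon00.
have -> : xx * mon 0 0 * mon a b = mon a.+1 b by rewrite -mulrA mon_mul add0n add0n /mon mulrA -exprS.
have -> : yy * mon 0 0 * mon a b = mon a b.+1.
  by rewrite -mulrA mon_mul /mon !add0n mulrA -(commXY a 1) -mulrA -exprS.
by rewrite !memvD //; [apply: sU|apply: IH; move: h; lia|apply: IH; move: h; lia].
Qed.
End Monomials.

(** * Projective modules with a given list of generators *)

Section FreeModule.
Variables (K : fieldType) (m : nat) (I : finType) (v : I -> nat).
Local Notation n := m.+1.
Local Notation A := (preproj K n).
Local Notation ee := (@ee K m).
Local Notation xx := (@xx K m).
Local Notation yy := (@yy K m).

(** The projective module at vertex [k] has a basis of monomials [x^a y^b] with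
    [a < k] and [k + b <= n], a rectangle. Generators are listed by a finite
    type [I], with their vertices given by [v]; a generator whose label is not a
    vertex contributes nothing. *)
Definition valid i a b := (a < v i)%N && (v i + b <= n)%N.
Definition fbasis := {t : I * ('I_n.+1 * 'I_n.+1) | valid t.1 t.2.1 t.2.2}.
Definition fspace : vectType K := {ffun fbasis -> K^o}.

Definition cf (z : fspace) i a b : K :=
  if valid i a b then oapp (fun t : fbasis => z t) 0 (insub (i, (inord a, inord b))) else 0.
Definition fmk (f : I -> nat -> nat -> K) : fspace :=
  [ffun t : fbasis => f (val t).1 (val t).2.1 (val t).2.2].

Lemma cf_mk f i a b : cf (fmk f) i a b = if valid i a b then f i a b else 0.
Proof.
rewrite /cf; case: ifP => // vld.
have [ha hb] : (a < n.+1)%N /\ (b < n.+1)%N by move: vld; rewrite /valid; lia.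
by rewrite insubT /= ?inordK // => h; rewrite ffunE /= !inordK.
Qed.
Lemma cf_out z i a b : ~~ valid i a b -> cf z i a b = 0.
Proof. by rewrite /cf => /negbTE ->. Qed.
Lemma cf_ext z z' : (forall i a b, valid i a b -> cf z i a b = cf z' i a b) -> z = z'.
Proof.
move=> h; apply/ffunP => -[[i [a b]] /= vld].
have := h i a b vld; rewrite /cf vld !inord_val insubT //= => h'.
Qed.
Lemma cfL k z z' i a b : cf (k *: z + z') i a b = k * cf z i a b + cf z' i a b.
Proof.
rewrite /cf; case: ifP => _; last by rewrite mulr0 addr0.
by case: insub => [t|] /=; rewrite ?mulr0 ?addr0 // !ffunE.
Qed.
Lemma cf0 i a b : cf 0 i a b = 0.
Proof. by rewrite /cf; case: ifP => // _; case: insub => //= t; rewrite ffunE. Qed.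
Lemma cfD z z' i a b : cf (z + z') i a b = cf z i a b + cf z' i a b.
Proof. by rewrite -[z]scale1r cfL scale1r mul1r. Qed.
Lemma cfZ k z i a b : cf (k *: z) i a b = k * cf z i a b.
Proof. by rewrite -[_ *: _]addr0 cfL cf0 addr0. Qed.
Lemma cf_sum (J : Type) (r : seq J) (p : pred J) (F : J -> fspace) i a b :
  cf (\sum_(j <- r | p j) F j) i a b = \sum_(j <- r | p j) cf (F j) i a b.
Proof. by elim/big_rec2: _ => [|j y1 y2 _ <-]; rewrite ?cf0 ?cfD. Qed.

Let Ef k (z : fspace) := fmk (fun i a b => if (v i + b == k + a)%N then cf z i a b else 0).
Let Xf (z : fspace) := fmk (fun i a b => if a is a'.+1 then cf z i a' b else 0).
Let Yf (z : fspace) := fmk (fun i a b => if b is b'.+1 then cf z i a b' else 0).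
Let Ef_linear k : linear (Ef k).
Proof.
move=> c z z'; apply: cf_ext => i a b vld; rewrite cfL !cf_mk vld.
by case: ifP => _; rewrite ?cfL // mulr0 addr0.
Qed.
Let Xf_linear : linear Xf.
Proof.
move=> c z z'; apply: cf_ext => i a b vld; rewrite cfL !cf_mk vld.
by case: a vld => [|a] vld; rewrite ?cfL // mulr0 addr0.
Qed.
Let Yf_linear : linear Yf.
Proof.
move=> c z z'; apply: cf_ext => i a b vld; rewrite cfL !cf_mk vld.
by case: b vld => [|b] vld; rewrite ?cfL // mulr0 addr0.
Qed.
Let E k : 'End(fspace) := linfun (Ef k).
Let X : 'End(fspace) := linfun Xf.
Let Y : 'End(fspace) := linfun Yf.
Let EE k z i a b : cf (E k z) i a b = if (v i + b == k + a)%N then cf z i a b else 0.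
Proof.
rewrite linfun_linE // cf_mk; case: ifP => // /negbT h; case: ifP => // _.
by rewrite cf_out.
Qed.
Let XE z i a b : cf (X z) i a b =
  if valid i a b then if a is a'.+1 then cf z i a' b else 0 else 0.
Proof. by rewrite linfun_linE // cf_mk. Qed.
Let YE z i a b : cf (Y z) i a b =
  if valid i a b then if b is b'.+1 then cf z i a b' else 0 else 0.
Proof. by rewrite linfun_linE // cf_mk. Qed.

Fact free_E_out k : (k == 0)%N || (n < k)%N -> E k = 0.
Proof.
move=> h; apply/lfunP => z; rewrite zero_lfunE; apply: cf_ext => i a b vld.
rewrite EE cf0; case: eqP => // e; move: vld h; rewrite /valid; lia.
Qed.
Fact free_E_sum : (\sum_(k < n.+1) E k) = \1%VF.
Proof.
apply/lfunP => z; rewrite id_lfunE sum_lfunE; apply: cf_ext => i a b vld.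
have h : (v i + b - a < n.+1)%N by move: vld; rewrite /valid; lia.
rewrite cf_sum (bigD1 (Ordinal h)) //= EE.
have -> : (v i + b == v i + b - a + a)%N by move: vld; rewrite /valid; lia.
rewrite big1 ?addr0 // => k; rewrite -val_eqE /= EE => nk.
by case: eqP => // e; move: nk vld; rewrite /valid; lia.
Qed.
Fact free_E_mul k l : (E l \o E k)%VF = if k == l then E k else 0.
Proof.
apply/lfunP => z; rewrite comp_lfunE; apply: cf_ext => i a b vld; rewrite !EE.
case: (k =P l) => [->|nkl]; first by rewrite EE; case: eqP.
rewrite zero_lfunE cf0; case: eqP => // e1; case: eqP => // e2; move: nkl; lia.
Qed.
Fact free_E_X k : (X \o E k.+1)%VF = (E k \o X)%VF.
Proof.
apply/lfunP => z; rewrite !comp_lfunE; apply: cf_ext => i a b vld.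
rewrite XE EE vld; case: a vld => [|a] vld; first by rewrite XE vld; case: ifP.
by rewrite EE XE vld addSnnS.
Qed.
Fact free_E_Y k : (Y \o E k)%VF = (E k.+1 \o Y)%VF.
Proof.
apply/lfunP => z; rewrite !comp_lfunE; apply: cf_ext => i a b vld.
rewrite YE EE vld; case: b vld => [|b] vld; first by rewrite YE vld; case: ifP.
by rewrite EE YE vld addnS addSn eqSS.
Qed.
Fact free_XY : (X \o Y)%VF = (Y \o X)%VF.
Proof.
apply/lfunP => z; rewrite !comp_lfunE; apply: cf_ext => i a b vld.
rewrite XE YE vld; case: a b vld => [|a] [|b] vld //; rewrite ?XE ?YE.
- by case: ifP.
- by case: ifP.
have -> : valid i a b.+1 by move: vld; rewrite /valid; lia.
by have -> : valid i a.+1 b by move: vld; rewrite /valid; lia.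
Qed.

Definition fproj : rmod A :=
  gr_mod free_E_out free_E_sum free_E_mul free_E_X free_E_Y free_XY.

Lemma free_eeE k (z : fproj) i a b :
  cf (ract fproj (ee k) z) i a b = if (v i + b == k + a)%N then cf z i a b else 0.
Proof. by rewrite gr_mod_ee EE. Qed.
Lemma free_xxE (z : fproj) i a b : cf (ract fproj xx z) i a b =
  if valid i a b then if a is a'.+1 then cf z i a' b else 0 else 0.
Proof. by rewrite gr_mod_xx XE. Qed.
Lemma free_yyE (z : fproj) i a b : cf (ract fproj yy z) i a b =
  if valid i a b then if b is b'.+1 then cf z i a b' else 0 else 0.
Proof. by rewrite gr_mod_yy YE. Qed.

Lemma free_monE (z : fproj) i a b c d : cf (ract fproj (mon K m a b) z) i c d =
  if valid i c d && (a <= c)%N && (b <= d)%N then cf z i (c - a) (d - b) else 0.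
Proof.
elim: a c d => [|a IH] c d.
  elim: b d => [|b IH] d.
    by rewrite mon00 ract1x !subn0 !andbT; case: ifP => // /negbT; apply: cf_out.
  rewrite -mon_yy ractMx free_yyE; case: d => [|d]; first by rewrite andbF; case: ifP.
  rewrite IH subSS !ltnS !leq0n !andbT; case: (boolP (valid i c d.+1)) => //= vld.
  by have -> : valid i c d by move: vld; rewrite /valid; lia.
rewrite -mon_xx ractMx free_xxE; case: c => [|c]; first by rewrite andbF; case: ifP.
rewrite IH subSS !ltnS; case: (boolP (valid i c.+1 d)) => //= vld.
by have -> : valid i c d by move: vld; rewrite /valid; lia.
Qed.

Definition gen (i : I) : fproj :=
  fmk (fun i' a b => ((i == i') && (a == 0)%N && (b == 0)%N)%:R).

Lemma cf_gen i i' a b :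
  cf (gen i) i' a b = (valid i' a b && (i == i') && (a == 0)%N && (b == 0)%N)%:R.
Proof. by rewrite cf_mk; case: ifP. Qed.

Lemma gen_ee i : ract fproj (ee (v i)) (gen i) = gen i.
Proof.
apply: cf_ext => i' a b vld; rewrite free_eeE !cf_gen.
case: eqP => // ne; case: (eqVneq i i') => [ei|]; last by rewrite andbF.
by case: (a =P 0)%N => [ea|]; case: (b =P 0)%N => [eb|]; rewrite ?andbF // in ne *; subst; rewrite !addn0 in ne.
Qed.

Lemma free_expand (z : fproj) : z = \sum_i \sum_(a < n.+1) \sum_(b < n.+1)
  cf z i a b *: ract fproj (mon K m a b) (gen i).
Proof.
apply: cf_ext => i a b vld.
have [ha hb] : (a < n.+1)%N /\ (b < n.+1)%N by move: vld; rewrite /valid; lia.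
have out : forall i' (a' b' : 'I_n.+1), (i', a', b') != (i, Ordinal ha, Ordinal hb) ->
    cf (cf z i' a' b' *: ract fproj (mon K m a' b') (gen i')) i a b = 0.
  move=> i' a' b' ne; rewrite cfZ free_monE cf_gen.
  case: ifP => [h|]; last by rewrite mulr0.
  case: (boolP (_ && _)) => h'; last by rewrite mulr0.
  case/eqP: ne; move: h'; case: eqP => [->|]; last by rewrite andbF.
  move=> h'; congr (_, _, _); apply: val_inj => /=; move: h h'; lia.
rewrite cf_sum (bigD1 i) //= cf_sum (bigD1 (Ordinal ha)) //= cf_sum (bigD1 (Ordinal hb)) //=.
rewrite cfZ free_monE cf_gen !subnn vld !leqnn !eqxx.
have -> : valid i 0 0 by move: vld; rewrite /valid; lia.
rewrite mulr1 !big1 ?addr0 // => [i' ni|a' na|b' nb].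
- rewrite cf_sum big1 // => a' _; rewrite cf_sum big1 // => b' _; apply: out.
  by apply: contra ni => /eqP [->].
- by rewrite cf_sum big1 // => b' _; apply: out; apply: contra na => /eqP [->].
- by apply: (out i (Ordinal ha) b'); apply: contra nb => /eqP [->].
Qed.

(** The universal property, for any linear right action: besides modules it is
    applied to the algebra acting on itself. *)
Section Universal.
Variables (W : lmodType K) (act : A -> W -> W) (w : I -> W).
Hypotheses (actL : forall a, linear (act a))
  (act_linear : forall k a b x, act (k *: a + b) x = k *: act a x + act b x)
  (actM : forall a b x, act (a * b) x = act b (act a x))
  (w_ee : forall i, act (ee (v i)) (w i) = w i).

Definition umap (z : fproj) : W := \sum_i \sum_(a < n.+1) \sum_(b < n.+1)
  cf z i a b *: act (mon K m a b) (w i).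

Let act0 x : act 0 x = 0.
Proof. by have := act_linear (-1) 0 0 x; rewrite scaler0 addr0 scaleN1r addNr. Qed.
Let actw0 i a b : ~~ valid i a b -> act (mon K m a b) (w i) = 0.
Proof. by move=> h; rewrite -w_ee -actM ee_mon0 ?act0. Qed.
Let actx0 a : act a 0 = 0.
Proof. by have := actL a (-1) 0 0; rewrite scaler0 addr0 scaleN1r addNr. Qed.
Let actD a x y : act a (x + y) = act a x + act a y.
Proof. by rewrite -[x in LHS]scale1r actL scale1r. Qed.
Let act_sum a (J : Type) (r : seq J) (F : J -> W) :
  act a (\sum_(j <- r) F j) = \sum_(j <- r) act a (F j).
Proof. by elim/big_rec2: _ => [|j y1 y2 _ <-]; rewrite ?actx0 ?actD. Qed.
Let actZ a k x : act a (k *: x) = k *: act a x.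
Proof. by rewrite -[_ *: x]addr0 actL actx0 addr0. Qed.

Lemma umap_linear : linear umap.
Proof.
move=> k z z'; rewrite /umap scaler_sumr -big_split /=; apply: eq_bigr => i _.
rewrite scaler_sumr -big_split /=; apply: eq_bigr => a _.
rewrite scaler_sumr -big_split /=; apply: eq_bigr => b _.
by rewrite cfL scalerDl scalerA.
Qed.

Lemma umap_gen i : act 1 (w i) = w i -> umap (gen i) = w i.
Proof.
move=> w1; rewrite /umap (bigD1 i) //= (bigD1 ord0) //= (bigD1 ord0) //=.
rewrite cf_gen !eqxx !andbT mon00 w1 !big1 ?addr0 => [|i' ni|a na|b nb].
- have [vld|nv] := boolP (valid i 0 0); first by rewrite scale1r.
  by rewrite scale0r -w1 -mon00 actw0.
- rewrite big1 // => a _; rewrite big1 // => b _.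
  by rewrite cf_gen [i == i']eq_sym (negbTE ni) andbF scale0r.
- rewrite big1 // => b _; rewrite cf_gen.
  by have /negbTE -> : (a != 0 :> nat)%N; [exact: na|rewrite andbF scale0r].
- rewrite cf_gen.
  by have /negbTE -> : (b != 0 :> nat)%N; [exact: nb|rewrite andbF scale0r].
Qed.

Lemma umap_act c z : umap (ract fproj c z) = act c (umap z).
Proof.
elim/preproj_ind: c z => [k a b ha hb|a b ha hb|k| |] z.
- by rewrite ractD ractZ umap_linear ha hb act_linear.
- by rewrite ractMx hb ha actM.
- rewrite /umap act_sum; apply: eq_bigr => i _; rewrite act_sum; apply: eq_bigr => a _.
  rewrite act_sum; apply: eq_bigr => b _; rewrite actZ free_eeE.
  have [vld|nv] := boolP (valid i a b); last by rewrite !cf_out ?scale0r // if_same scale0r.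
  rewrite -actM -[in RHS](w_ee i) -actM mulrA ee_mon; last by case/andP: vld.
  rewrite -mulrA ee_mul.
  have -> : (v i + b - a == k)%N = (v i + b == k + a)%N by move: vld; rewrite /valid; lia.
  case: ifP => h; last by rewrite mulr0 act0 scaler0 scale0r.
  by rewrite -ee_mon ?actM ?w_ee //; case/andP: vld.
- rewrite /umap act_sum; apply: eq_bigr => i _.
  rewrite act_sum big_ord_recl [RHS]big_ord_recr /= [X in X + _]big1 ?add0r => [|b _]; last first.
    by rewrite free_xxE; case: ifP; rewrite scale0r.
  rewrite act_sum [X in _ + X]big1 ?addr0 => [|b _]; last first.
    by rewrite cf_out ?scale0r ?actx0 // /valid; lia.
  apply: eq_bigr => a _; rewrite act_sum; apply: eq_bigr => b _.
  rewrite actZ -actM mon_xx free_xxE /bump /= add1n.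
  have [vld|nv] := boolP (valid i a.+1 b); first by [].
  by rewrite actw0 // !scaler0.
rewrite /umap act_sum; apply: eq_bigr => i _; rewrite act_sum; apply: eq_bigr => a _.
rewrite act_sum big_ord_recl [RHS]big_ord_recr /= free_yyE if_same scale0r add0r.
rewrite [cf z i a n]cf_out ?scale0r ?actx0 ?addr0; last by rewrite /valid; lia.
apply: eq_bigr => b _; rewrite actZ -actM mon_yy free_yyE /bump /= add1n.
have [vld|nv] := boolP (valid i a b.+1); first by [].
by rewrite actw0 // !scaler0.
Qed.
End Universal.

Lemma free_map (N : rmod A) (w : I -> N) : (forall i, ract N (ee (v i)) (w i) = w i) ->
  exists2 f : 'Hom(fproj, N), rhom f & forall i, f (gen i) = w i.
Proof.
move=> hw; have aL a : linear (ract N a) by move=> k x y; rewrite linearP.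
have al k a b x : ract N (k *: a + b) x = k *: ract N a x + ract N b x by rewrite ractD ractZ.
have aM a b x : ract N (a * b) x = ract N b (ract N a x) by rewrite ractMx.
exists (linfun (umap (fun a => ract N a) w)) => [a z|i].
  by rewrite !linfun_linE; [apply: umap_act|exact: umap_linear..].
by rewrite linfun_linE ?umap_gen ?ract1x //; exact: umap_linear.
Qed.

Lemma free_hom_eq (N : rmod A) (f g : 'Hom(fproj, N)) :
  rhom f -> rhom g -> (forall i, f (gen i) = g (gen i)) -> f = g.
Proof.
move=> hf hg e; apply/lfunP => z; rewrite [z]free_expand.
rewrite !linear_sum; apply: eq_bigr => i _; rewrite !linear_sum; apply: eq_bigr => a _.
by rewrite !linear_sum; apply: eq_bigr => b _; rewrite !linearZ /= hf hg e.
Qed.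

Lemma free_proj : rproj fproj.
Proof.
move=> M N g f hg hf /surjP sj.
have [p pP] := choice (fun i => sj (f (gen i))).
have [h hh eh] := @free_map M (fun i => ract M (ee (v i)) (p i)) (fun i => ract_ee _ _).
exists h => //; apply: free_hom_eq => //; first exact: rhom_comp.
by move=> i; rewrite comp_lfunE eh hg pP -hf gen_ee.
Qed.

Lemma top_rad (z : fproj) i : z \in jrad fproj -> cf z i 0 0 = 0.
Proof. by move=> /radP [z1 [z2 ->]]; rewrite cfD free_xxE free_yyE !if_same addr0. Qed.

Lemma rad_top (z : fproj) : (forall i, cf z i 0 0 = 0) -> z \in jrad fproj.
Proof.
move=> h; rewrite [z]free_expand; apply: rpred_sum => i _; apply: rpred_sum => a _.
apply: rpred_sum => b _; case: (posnP (a + b)) => [e|ab]; last by rewrite memvZ ?mon_rad.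
have [-> ->] : a = 0%N :> nat /\ b = 0%N :> nat by lia.
by rewrite h scale0r mem0v.
Qed.
End FreeModule.

Arguments fproj : simpl never.
Arguments gen : simpl never.

(* Linear arithmetic on the endpoints of intervals, apart from membership. *)
Ltac nlia := repeat match goal with
  | H : is_true (?f _) |- _ => match type of f with pred nat => clear H end
  | H : is_true (~~ ?f _) |- _ => match type of f with pred nat => clear H end
  | H : is_true (predC _ _) |- _ => clear H
  | H : is_true (~~ predC _ _) |- _ => clear H
  | H : is_true (_ || _) |- _ => clear H
  | H : forall _, _ |- _ => clear H
  end; lia.

(** * The zigzag complex of a set of integers *)

Section Boundaries.
Implicit Types (S : pred nat) (i j p q : nat).

(** A maximal interval of [S], of the [k] with [i <= k < j], has the entry [i] and the
    exit [j]. *)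
Definition entry S i : bool := S i && ((i == 0) || ~~ S i.-1)%N.
Definition exit S j : bool := [&& ~~ S j, (0 < j)%N & S j.-1].

(** An entry and an exit are adjacent when they bound the same interval of [S]
    or the same gap. *)
Definition adj S i j : bool := [&& entry S i, exit S j &
  ((i < j) && all S (iota i (j - i)) || (j < i) && all (predC S) (iota j (i - j)))%N].

Lemma all_seg S i j : reflect (forall k, (i <= k < j)%N -> S k) (all S (iota i (j - i))).
Proof.
apply: (iffP allP) => h k; first by move=> kij; apply: h; rewrite mem_iota; lia.
by rewrite mem_iota => kij; apply: h; lia.
Qed.

Lemma adjP S i j : adj S i j -> [/\ entry S i, exit S j &
  (i < j)%N /\ (forall k, (i <= k < j)%N -> S k) \/
  (j < i)%N /\ (forall k, (j <= k < i)%N -> ~~ S k)].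
Proof.
case/and3P => si sj /orP [|] /andP [lt /all_seg h]; split=> //; by [left|right].
Qed.

Lemma adj_up S i j : entry S i -> exit S j -> (i < j)%N ->
  (forall k, (i <= k < j)%N -> S k) -> adj S i j.
Proof. by move=> h1 h2 lt h; rewrite /adj h1 h2 lt /=; apply/orP; left; apply/all_seg. Qed.
Lemma adj_down S i j : entry S i -> exit S j -> (j < i)%N ->
  (forall k, (j <= k < i)%N -> ~~ S k) -> adj S i j.
Proof. by move=> h1 h2 lt h; rewrite /adj h1 h2 lt /=; apply/orP; right; apply/all_seg. Qed.

(** Used for the interval of [S] that contains [i] and, on the complement of [S], for
    the gap that contains [i]. *)
Lemma first_change (S : pred nat) i N : S i -> (i < N)%N -> ~~ S N ->
  exists q, [/\ (i < q <= N)%N, ~~ S q & forall k, (i <= k < q)%N -> S k].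
Proof.
move=> Si iN SN; have ex : exists q, (i < q)%N && ~~ S q by exists N; rewrite iN.
case: (ex_minnP ex) => q /andP [iq Sq] qmin; exists q; split=> //.
  by rewrite iq qmin // iN.
move=> k /andP [ik kq]; apply/negPn/negP => Sk.
move: ik; rewrite leq_eqVlt => /orP [/eqP ek|ik]; first by rewrite -ek Si in Sk.
by have := qmin k; rewrite ik Sk => /(_ isT); lia.
Qed.

Lemma last_change (S : pred nat) j : S j ->
  exists p, [/\ (p <= j)%N, (p == 0)%N || ~~ S p.-1 & forall k, (p <= k <= j)%N -> S k].
Proof.
elim: j => [|j IH] Sj.
  by exists 0%N; split=> // k; rewrite leqn0 => /eqP ->.
have [Sj'|nSj] := boolP (S j); last first.
  exists j.+1; split=> //= k kj; by have -> : k = j.+1 by lia.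
have [p [pj hp h]] := IH Sj'; exists p; split=> //; first exact: leqW.
move=> k /andP [pk]; rewrite leq_eqVlt => /orP [/eqP -> //|kj]; apply: h; lia.
Qed.

Lemma entry_exitF S i : entry S i -> exit S i = false.
Proof. by rewrite /exit => /andP [->]. Qed.
End Boundaries.

(** Travelling along two zigzags. A state [(i, j, a, b)] stands for the map sending
    the generator at the entry [i] of [S] to [x^a y^b] times the generator at the
    exit [j] of [T]. Modulo maps that factor through a differential, such a map
    can be traded for those at the other neighbours of an exit [q] of [S], or of
    an entry [p] of [T], through which the path passes. When [S] and [T] are
    nested one can always move in the same direction, so that every state
    eventually falls off the end of a zigzag. *)
Section Push.
Variables (S T : pred nat) (M : nat) (Z : nat -> nat -> nat -> nat -> Prop).
Hypotheses (S_out : forall k, (M <= k)%N -> ~~ S k) (T_out : forall k, (M <= k)%N -> ~~ T k).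
Hypothesis umove : forall i j q a b, exit T j -> adj S i q -> (q <= M)%N ->
  (j + b = q + a)%N ->
  (forall i', i' != i -> adj S i' q -> Z i' j (a + (q - i')) (b + (i' - q))) ->
  Z i j (a + (q - i)) (b + (i - q)).
Hypothesis vmove : forall i j p a b, entry S i -> adj T p j -> (p <= M)%N ->
  (p + b = i + a)%N ->
  (forall j', j' != j -> adj T p j' -> Z i j' (a + (j' - p)) (b + (p - j'))) ->
  Z i j (a + (j - p)) (b + (p - j)).

Lemma entry_lt i : entry S i -> (i < M)%N.
Proof. by move=> /andP [Si _]; rewrite ltnNge; apply/negP => /S_out; rewrite Si. Qed.
Lemma exit_le j : exit T j -> (j <= M)%N.
Proof.
move=> /and3P [_ _ Tj]; rewrite leqNgt; apply/negP => l.
by suff : ~~ T j.-1; [rewrite Tj|apply: T_out; nlia].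
Qed.

Lemma push_up : (forall k, S k -> T k) -> forall N i j a b,
  (2 * M - (i + j) < N)%N -> entry S i -> exit T j -> (j + b = i + a)%N -> Z i j a b.
Proof.
move=> sub; elim=> // N IH i j a b lt si tj e.
have iN := entry_lt si; have jN := exit_le tj.
have [Si hi] := andP si; have [Tj j0 Tj1] := and3P tj.
have [q [/andP [iq qn] nSq Sseg]] := first_change Si iN (S_out (leqnn _)).
(* for large [a] the path ends with the steps from the next exit [q] of [S] down to [i] *)
have [aq|aq] := leqP (q - i) a.
  have xq : exit S q by rewrite /exit nSq Sseg ?andbT /=; nlia.
  have ai : adj S i q by apply: adj_up.
  have := @umove i j q (a - (q - i)) b tj ai qn.
  have -> : (i - q = 0)%N by nlia.
  rewrite addn0 subnK //; apply; first by nlia.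
  move=> i' ni /adjP [si' _ [[lt' seg]|[lt' seg]]].
    case/eqP: ni; have /andP [_ hi'] := si'.
    have [l|l|//] := ltngtP i' i.
      by move: hi; rewrite seg ?orbF => [/eqP|]; nlia.
    by move: hi'; rewrite Sseg ?orbF => [/eqP|]; nlia.
  by have i'M := entry_lt si'; apply: IH => //; nlia.
(* otherwise the path starts with the steps from [j] up to the next entry [p] of [T] *)
have ji : (j < i)%N.
  rewrite ltnNge; apply/negP => ij; have : S j by apply: Sseg; nlia.
  by move/sub; rewrite (negbTE Tj).
have [p [/andP [jp pi] Tp Tseg]] := @first_change (predC T) j i Tj ji (introT negPn (sub _ Si)).
have ep : entry T p.
  rewrite /entry (negPn Tp) /=; apply/orP; right.
  by apply: (Tseg p.-1); nlia.
have apj : adj T p j by apply: adj_down.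
have := @vmove i j p a (b - (p - j)) si apj.
have -> : (j - p = 0)%N by nlia.
rewrite addn0 subnK; last by nlia.
apply; [nlia|nlia|].
move=> j' nj /adjP [_ tj' [[lt' seg]|[lt' seg]]].
  by have j'M := exit_le tj'; apply: IH => //; nlia.
case/eqP: nj; have /and3P [_ j0' Tj1'] := tj'.
have [l|l|//] := ltngtP j' j.
  by suff : ~~ T j.-1; [rewrite Tj1|apply: seg; nlia].
by suff : ~~ T j'.-1; [rewrite Tj1'|apply: Tseg; nlia].
Qed.

Lemma push_down : (forall k, T k -> S k) -> forall N i j a b,
  (i + j < N)%N -> entry S i -> exit T j -> (j + b = i + a)%N -> Z i j a b.
Proof.
move=> sub; elim=> // N IH i j a b lt si tj e.
have iN := entry_lt si; have jN := exit_le tj.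
have [Si hi] := andP si; have [Tj j0 Tj1] := and3P tj.
have [p [pj hp Tseg]] := last_change Tj1.
have ltpj : (p < j)%N by nlia.
(* the path starts with the steps from [j] down to the previous entry [p] of [T] *)
have [aq|aq] := leqP (j - p) a.
  have ep : entry T p by rewrite /entry hp Tseg //; nlia.
  have apj : adj T p j by apply: adj_up => //= k kj; apply: Tseg; nlia.
  have := @vmove i j p (a - (j - p)) b si apj.
  have -> : (p - j = 0)%N by nlia.
  rewrite addn0 subnK //; apply; [nlia|nlia|].
  move=> j' nj /adjP [_ tj' [[lt' seg]|[lt' seg]]]; last by apply: IH => //; nlia.
  case/eqP: nj; have /and3P [Tj' j0' Tj1'] := tj'.
  have [l|l|//] := ltngtP j' j.
    by move: Tj'; rewrite Tseg //; nlia.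
  by move: Tj; rewrite seg //=; nlia.
(* or else it ends with the steps from the previous exit [q] of [S] up to [i] *)
have nSi1 : ~~ S i.-1 by case/orP: hi => // /eqP i0; nlia.
have ji : (j < i)%N.
  rewrite ltnNge; apply/negP => ij; have /sub : T i.-1 by apply: Tseg; nlia.
  by rewrite (negbTE nSi1).
have [q [qi hq Sseg]] := @last_change (predC S) i.-1 nSi1.
have jq : (j <= q)%N.
  rewrite leqNgt; apply/negP => qj.
  by suff : ~~ S j.-1; [rewrite (sub _ Tj1)|apply: Sseg; nlia].
have Sq1 : S q.-1 by move: hq; have /negbTE -> : (q != 0)%N; [nlia|rewrite /= negbK].
have nSq : ~~ S q by apply: Sseg; nlia.
have xq : exit S q by rewrite /exit Sq1 nSq andbT /=; nlia.
have ai : adj S i q by apply: adj_down => //= [|k kq]; [nlia|apply: Sseg; nlia].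
have := @umove i j q a (b - (i - q)) tj ai.
have -> : (q - i = 0)%N by nlia.
rewrite addn0 subnK; last by nlia.
apply; [nlia|nlia|].
move=> i' ni /adjP [si' _ [[lt' seg]|[lt' seg]]]; first by apply: IH => //; nlia.
case/eqP: ni; have /andP [Si' hi'] := si'.
have [l|l|//] := ltngtP i' i.
  by suff : ~~ S i'; [rewrite Si'|apply: Sseg; nlia].
by suff : ~~ S i; [rewrite Si|apply: seg; nlia].
Qed.

Lemma push_ind : (forall k, S k -> T k) \/ (forall k, T k -> S k) -> forall i j a b,
  entry S i -> exit T j -> (j + b = i + a)%N -> Z i j a b.
Proof.
by case=> sub i j a b; [apply: (push_up sub (leqnn _))|apply: (push_down sub (leqnn _))].
Qed.
End Push.

Section Zigzag.
Variables (K : fieldType) (m : nat).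
Local Notation n := m.+1.
Local Notation A := (preproj K n).
Local Notation ee := (@ee K m).
Local Notation mon := (mon K m).
Implicit Types (S : pred nat) (i j p q : 'I_n.+2).

Definition lab_in S i : nat := if entry S i then nat_of_ord i else 0%N.
Definition lab_out S j : nat := if exit S j then nat_of_ord j else 0%N.

Lemma ee_mon_fix (M : rmod A) l k a b (z : M) : (l + b = k + a)%N ->
  ract M (ee l) z = z -> ract M (ee k) (ract M (mon a b) z) = ract M (mon a b) z.
Proof.
move=> e hz; rewrite -[in LHS]hz -[in RHS]hz -!ractMx (mulrA _ (mon a b)).
have [h|h] := boolP ((a < l) && (l + b <= n))%N.
  rewrite ee_mon; last by case/andP: h.
  by have -> : (l + b - a = k)%N; [lia|rewrite -[X in ract M X z = _]mulrA ee_mul eqxx].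
by rewrite ee_mon0 // ?mul0r.
Qed.

Lemma gen_out_ee S (j : 'I_n.+2) : exit S j ->
  ract (fproj K m (lab_out S)) (ee j) (gen _ _ _ j) = gen _ _ _ j.
Proof. by move=> h; have := gen_ee K m (lab_out S) j; rewrite /lab_out h. Qed.
Lemma gen_in_ee S (i : 'I_n.+2) : entry S i ->
  ract (fproj K m (lab_in S)) (ee i) (gen _ _ _ i) = gen _ _ _ i.
Proof. by move=> h; have := gen_ee K m (lab_in S) i; rewrite /lab_in h. Qed.

Definition zz_val S (i : 'I_n.+2) : fproj K m (lab_out S) :=
  \sum_(j < n.+2 | adj S i j) ract _ (mon (j - i) (i - j)) (gen _ _ _ j).

Lemma zz_val_ee S i : ract _ (ee (lab_in S i)) (zz_val S i) = zz_val S i.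
Proof.
rewrite linear_sum; apply: eq_bigr => j /adjP [si sj _] /=.
by rewrite /lab_in si (@ee_mon_fix (fproj K m (lab_out S)) j) ?gen_out_ee //; lia.
Qed.

Definition zz_diff S : 'Hom(fproj K m (lab_in S), fproj K m (lab_out S)) :=
  s2val (cid2 (free_map (zz_val_ee S))).
Lemma zz_diff_hom S : rhom (zz_diff S).
Proof. exact: s2valP (cid2 (free_map (zz_val_ee S))). Qed.
Lemma zz_diff_gen S i : zz_diff S (gen _ _ _ i) = zz_val S i.
Proof. exact: (s2valP' (cid2 (free_map (zz_val_ee S)))). Qed.

(** Entries give the term in degree -1 and exits the term in degree 0; the
    differential joins adjacent boundary points by shortest paths. *)
Definition zigzag S : tcx A := Tcx (@zz_diff_hom S).

Section Vanish.
Variables S T : pred nat.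
Hypotheses (S_out : forall k, (n < k)%N -> ~~ S k) (T_out : forall k, (n < k)%N -> ~~ T k).
Local Notation P1 := (fproj K m (lab_in S)).
Local Notation P0 := (fproj K m (lab_out S)).
Local Notation P1' := (fproj K m (lab_in T)).
Local Notation P0' := (fproj K m (lab_out T)).

Let solv (h : 'Hom(P1, P0')) := exists (v : 'Hom(P1, P1')) (u : 'Hom(P0, P0')),
  [/\ rhom v, rhom u & h = (zz_diff T \o v)%VF + (u \o zz_diff S)%VF].

Let solv0 : solv 0.
Proof.
by exists 0, 0; split; try exact: rhom0; rewrite comp_lfun0l comp_lfun0r addr0.
Qed.
Let solvL k h h' : solv h -> solv h' -> solv (k *: h + h').
Proof.
move=> [v [u [hv hu ->]]] [v' [u' [hv' hu' ->]]]; exists (k *: v + v'), (k *: u + u').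
split; try by apply: rhomD => //; apply: rhomZ.
rewrite scalerDr comp_lfunDl comp_lfunDr -comp_lfunZl -comp_lfunZr !addrA.
by congr (_ + _); rewrite addrAC.
Qed.
Let solv_sum (J : Type) (r : seq J) (P : pred J) (F : J -> 'Hom(P1, P0')) :
  (forall x, P x -> solv (F x)) -> solv (\sum_(x <- r | P x) F x).
Proof.
move=> h; apply: big_ind => // x y hx hy; rewrite -[x]scale1r; exact: solvL.
Qed.

Lemma elem_ex i (w : P0') :
  exists2 f : 'Hom(P1, P0'), rhom f &
    forall i', f (gen _ _ _ i') = if i == i' then ract P0' (ee (lab_in S i)) w else 0.
Proof.
apply: free_map => i'; case: eqP => [<-|_]; last by rewrite linear0.
exact: ract_ee.
Qed.
Let elem i w := s2val (cid2 (elem_ex i w)).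
Let elem_hom i w : rhom (elem i w).
Proof. exact: s2valP (cid2 (elem_ex i w)). Qed.
Let elem_gen i w i' : elem i w (gen _ _ _ i') =
  if i == i' then ract P0' (ee (lab_in S i)) w else 0.
Proof. exact: (s2valP' (cid2 (elem_ex i w))). Qed.

(** The map sending the generator [i] to [gen j x^a y^b], and the others to 0. *)
Let th i j a b := elem i (ract P0' (mon a b) (gen _ _ _ j)).
Let thE i j a b i' : entry S i -> exit T j -> (j + b = i + a)%N ->
  th i j a b (gen _ _ _ i') = if i == i' then ract P0' (mon a b) (gen _ _ _ j) else 0.
Proof.
move=> si tj e; rewrite elem_gen; case: ifP => // _.
by rewrite /lab_in si (ee_mon_fix (l := j)) ?gen_out_ee.
Qed.

Let umove i j q a b : exit T j -> adj S i q -> (j + b = q + a)%N ->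
    (forall i', i' != i -> adj S i' q -> solv (th i' j (a + (q - i')) (b + (i' - q)))) ->
  solv (th i j (a + (q - i)) (b + (i - q))).
Proof.
move=> tj aiq e IH; have [si sq _] := adjP aiq.
have [|u hu ug] := @free_map K m _ (lab_out S) P0'
    (fun j' => if j' == q then ract P0' (mon a b) (gen _ _ _ j) else 0).
  move=> j'; case: eqP => [->|_]; last by rewrite linear0.
  by rewrite /lab_out sq (ee_mon_fix (l := j)) ?gen_out_ee.
have -> : th i j (a + (q - i)) (b + (i - q)) = (u \o zz_diff S)%VF +
   (-1) *: \sum_(i' | (i' != i) && adj S i' q) th i' j (a + (q - i')) (b + (i' - q)).
  apply: free_hom_eq; first exact: elem_hom.
    apply: rhomD; first by apply: rhom_comp => //; exact: zz_diff_hom.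
    by apply: rhomZ; apply: rhom_sum => *; exact: elem_hom.
  move=> i0; rewrite add_lfunE comp_lfunE zz_diff_gen scale_lfunE sum_lfunE linear_sum.
  have -> : \sum_(j0 < n.+2 | adj S i0 j0) u (ract P0 (mon (j0 - i0) (i0 - j0)) (gen _ _ _ j0))
     = if adj S i0 q then ract P0' (mon (a + (q - i0)) (b + (i0 - q))) (gen _ _ _ j) else 0.
    have tm j0 : u (ract P0 (mon (j0 - i0) (i0 - j0)) (gen _ _ _ j0)) =
       if j0 == q then ract P0' (mon (a + (q - i0)) (b + (i0 - q))) (gen _ _ _ j) else 0.
      rewrite hu ug; case: eqP => [->|_]; last by rewrite linear0.
      by rewrite -ractMx mon_mul.
    under eq_bigr do rewrite tm.
    case: ifP => aq; last by rewrite big1 // => j0 aj; case: eqP => // e0; rewrite e0 aq in aj.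
    by rewrite (bigD1 q) //= eqxx big1 ?addr0 // => j0 /andP [_ /negbTE ->].
  have th' i' : adj S i' q -> th i' j (a + (q - i')) (b + (i' - q)) (gen _ _ _ i0) =
     if i' == i0 then ract P0' (mon (a + (q - i')) (b + (i' - q))) (gen _ _ _ j) else 0.
    by move=> /adjP [si' _ _]; apply: thE => //; lia.
  rewrite [LHS](th' i aiq); have [ei|ni] := eqVneq i i0.
    subst i0; rewrite aiq big1 ?scaler0 ?addr0 // => i' /andP [ni' ai']; rewrite th' //.
    by rewrite (negbTE ni').
  case: ifP => ai0; last first.
    rewrite big1 ?scaler0 ?addr0 // => i' /andP [_ ai']; rewrite th' //.
    by case: eqP => // ei; rewrite ei ai0 in ai'.
  rewrite (bigD1 i0) /=; last by rewrite eq_sym ni.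
  rewrite th' // eqxx big1 ?addr0 ?scaleN1r ?subrr // => i' /andP [/andP [_ ai'] ni'].
  by rewrite th' // (negbTE ni').
rewrite addrC; apply: solvL; first by apply: solv_sum => i' /andP [? ?]; apply: IH.
exists 0, u; split; [exact: rhom0|by []|by rewrite comp_lfun0r add0r].
Qed.

Let vmove i j p a b : entry S i -> adj T p j -> (p + b = i + a)%N ->
    (forall j', j' != j -> adj T p j' -> solv (th i j' (a + (j' - p)) (b + (p - j')))) ->
  solv (th i j (a + (j - p)) (b + (p - j))).
Proof.
move=> si apj e IH; have [tp tj _] := adjP apj.
have [|v hv vg] := @free_map K m _ (lab_in S) P1'
    (fun i' => if i == i' then ract P1' (mon a b) (gen _ _ _ p) else 0).
  move=> i'; case: eqP => [<-|_]; last by rewrite linear0.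
  by rewrite /lab_in si (ee_mon_fix (l := p)) ?gen_in_ee.
have -> : th i j (a + (j - p)) (b + (p - j)) = (zz_diff T \o v)%VF +
   (-1) *: \sum_(j' | (j' != j) && adj T p j') th i j' (a + (j' - p)) (b + (p - j')).
  apply: free_hom_eq; first exact: elem_hom.
    apply: rhomD; first by apply: rhom_comp => //; exact: zz_diff_hom.
    by apply: rhomZ; apply: rhom_sum => *; exact: elem_hom.
  have th' i0 j' : adj T p j' -> th i j' (a + (j' - p)) (b + (p - j')) (gen _ _ _ i0) =
     if i == i0 then ract P0' (mon (a + (j' - p)) (b + (p - j'))) (gen _ _ _ j') else 0.
    by move=> /adjP [_ tj' _]; apply: thE => //; lia.
  move=> i0; rewrite add_lfunE comp_lfunE vg scale_lfunE sum_lfunE th' //.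
  case: eqP => [<-|ni]; last first.
    rewrite linear0 ?sum_lfunE big1 ?zero_lfunE ?scaler0 ?addr0 // => j' /andP [_ aj]; rewrite th' //.
    by case: eqP.
  rewrite zz_diff_hom zz_diff_gen /zz_val (bigD1 j) //= linearD /= linear_sum /=.
  rewrite -ractMx mon_mul addnC [(_ + b)%N]addnC -addrA -[LHS]addr0; congr (_ + _).
  apply/esym/eqP; rewrite scaleN1r subr_eq0; apply/eqP.
  rewrite (eq_bigl (fun j' => (j' != j) && adj T p j')); last by move=> j'; rewrite andbC.
  apply: eq_bigr => j' /andP [nj aj]; rewrite th' // eqxx -ractMx mon_mul.
  by rewrite addnC [(_ + b)%N]addnC.
rewrite addrC; apply: solvL; first by apply: solv_sum => j' /andP [? ?]; apply: IH.
exists v, 0; split; [by []|exact: rhom0|by rewrite comp_lfun0l addr0].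
Qed.

Let all_solv : (forall k, S k -> T k) \/ (forall k, T k -> S k) ->
  forall i j a b, entry S i -> exit T j -> (j + b = i + a)%N -> solv (th i j a b).
Proof.
move=> nest i j a b si tj e.
pose Z (i j a b : nat) := forall (hi : (i < n.+2)%N) (hj : (j < n.+2)%N),
  solv (th (Ordinal hi) (Ordinal hj) a b).
suff z : Z i j a b.
  have -> : i = Ordinal (ltn_ord i) by apply: val_inj.
  by have -> : j = Ordinal (ltn_ord j) by apply: val_inj.
apply: (@push_ind S T n.+1 Z S_out T_out) => // {si tj e}.
- move=> i' j' q a' b' tj aiq qn e IH hi hj.
  apply: (@umove (Ordinal hi) (Ordinal hj) (Ordinal (qn : q < n.+2)%N)) => // i2 ne ai2.
  have := IH i2 _ ai2 (ltn_ord i2) hj.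
  have -> : Ordinal (ltn_ord i2) = i2 by apply: val_inj.
  by apply; apply: contra ne => /eqP ne; apply/eqP/val_inj.
- move=> i' j' p a' b' si apj pn e IH hi hj.
  apply: (@vmove (Ordinal hi) (Ordinal hj) (Ordinal (pn : p < n.+2)%N)) => // j2 ne aj2.
  have := IH j2 _ aj2 hi (ltn_ord j2).
  have -> : Ordinal (ltn_ord j2) = j2 by apply: val_inj.
  by apply; apply: contra ne => /eqP ne; apply/eqP/val_inj.
Qed.

Theorem zigzag_vanish : (forall k, S k -> T k) \/ (forall k, T k -> S k) ->
  tvanish (zigzag S) (zigzag T).
Proof.
move=> nest h hh; change (solv h).
have key i j a b : entry S i -> exit T j -> (j + b = i + a)%N -> solv (th i j a b).
  exact: all_solv.
have hE i : ract P0' (ee (lab_in S i)) (h (gen _ _ _ i)) = h (gen _ _ _ i).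
  by rewrite -hh gen_ee.
have -> : h = \sum_i \sum_j \sum_(a < n.+1) \sum_(b < n.+1)
     cf (h (gen _ _ _ i)) j a b *: th i j a b.
  apply: free_hom_eq => //.
    by do 4![apply: rhom_sum => ? _]; apply: rhomZ; exact: elem_hom.
  move=> i0; rewrite sum_lfunE (bigD1 i0) //= [X in _ + X]big1 ?addr0 => [|i ni]; last first.
    do 3![rewrite sum_lfunE big1 // => ? _].
    by rewrite scale_lfunE elem_gen (negbTE ni) scaler0.
  rewrite -[LHS]hE [X in ract P0' _ X]free_expand !linear_sum sum_lfunE; apply: eq_bigr => j _.
  rewrite !linear_sum sum_lfunE; apply: eq_bigr => a _.
  rewrite !linear_sum sum_lfunE; apply: eq_bigr => b _.
  by rewrite linearZ scale_lfunE elem_gen eqxx.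
apply: solv_sum => i _; apply: solv_sum => j _; apply: solv_sum => a _; apply: solv_sum => b _.
rewrite -[_ *: _]addr0.
have [->|nz] := eqVneq (cf (h (gen _ _ _ i)) j a b) 0; first by rewrite scale0r addr0.
apply: solvL => //; have vld : valid m (lab_out T) j a b.
  by apply/negPn/negP => nv; rewrite cf_out ?eqxx in nz.
have tj : exit T j by move: vld; rewrite /valid /lab_out; case: ifP.
have e : (lab_out T j + b = lab_in S i + a)%N.
  by apply/eqP/negPn/negP => ne; move: nz; rewrite -hE free_eeE (negbTE ne) eqxx.
have si : entry S i.
  move: e vld; rewrite /valid /lab_in; case: ifP => // _; lia.
by apply: key => //; move: e; rewrite /lab_in /lab_out si tj.
Qed.
End Vanish.
End Zigzag.

(** * Endomorphisms of a zigzag complex *)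

Section RadicalMaps.
Variables (K : fieldType) (m : nat).
Local Notation n := m.+1.
Local Notation A := (preproj K n).
Local Notation ee := (@ee K m).
Local Notation mon := (mon K m).

Lemma rad_mon (M : rmod A) a b z : z \in jrad M -> ract M (mon a b) z \in jrad M.
Proof.
move=> /radP [z1 [z2 ->]]; rewrite linearD /= -!ractMx.
have -> : xx K m * mon a b = mon a b * xx K m.
  by rewrite mon_xx /mon mulrA -exprS.
have -> : yy K m * mon a b = mon a b * yy K m.
  by rewrite mon_yy /mon mulrA -[X in X * _ * _]expr1 -commXY -mulrA -exprD add1n.
rewrite (ractMx (mon a b) (xx K m)) (ractMx (mon a b) (yy K m)); apply/radP.
by exists (ract M (mon a b) z1), (ract M (mon a b) z2).
Qed.

(** By dimension, a surjective endomorphism is injective. *)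
Lemma end_surj_inverse (B : algType K) (M : rmod B) (e : 'End(M)) : rhom e -> limg e = fullv ->
  exists e' : 'End(M), [/\ rhom e', (e' \o e)%VF = \1%VF & (e \o e')%VF = \1%VF].
Proof.
move=> he sj; have k0 : lker e == 0%VS.
  rewrite -dimv_eq0; have := limg_ker_dim e fullv.
  by rewrite capfv sj => /eqP; rewrite -[X in _ == X]add0n eqn_add2r.
exists (e^-1)%VF; rewrite lker0_compVf // lker0_compfV //; split=> // a x.
have inj : injective e by apply/lker0P.
have eK y : e (e^-1%VF y) = y by rewrite -comp_lfunE lker0_compfV // id_lfunE.
by apply: inj; rewrite he !eK.
Qed.

Section Diagonal.
Variables (I : finType) (v : I -> nat).
Hypothesis v_inj : forall i i', valid m v i 0 0 -> v i = v i' -> i = i'.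
Local Notation F := (fproj K m v).

Lemma cf_deg (z : F) k i : ract F (ee k) z = z -> v i != k -> cf z i 0 0 = 0.
Proof. by move=> <- /negbTE ne; rewrite free_eeE !addn0 ne. Qed.

(** Distinct generators have distinct labels, so [e] is [c] times the identity
    modulo the radical, and is surjective by the lemma of Nakayama. *)
Lemma diag_unit (e : 'End(F)) (c : K) : rhom e -> c != 0 ->
    (forall i, valid m v i 0 0 -> cf (e (gen K m v i)) i 0 0 = c) ->
  exists e' : 'End(F), [/\ rhom e', (e' \o e)%VF = \1%VF & (e \o e')%VF = \1%VF].
Proof.
move=> he c0 dc; apply: end_surj_inverse => //; apply: nakayama; first exact: rsubmod_img.
apply/vspaceP => z; rewrite memvf.
pose y := \sum_i (cf z i 0 0 / c) *: e (gen K m v i).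
have yI : y \in limg e.
  by apply: rpred_sum => i _; apply: memvZ; apply: memv_img; apply: memvf.
rewrite -[z](subrK y) addrC memv_add //; apply: rad_top => i.
rewrite -[_ - _]addrC -scaleN1r cfL mulN1r addrC; apply/eqP; rewrite subr_eq0; apply/eqP.
rewrite /y cf_sum; have [vi|nvi] := boolP (valid m v i 0 0); last first.
  by rewrite cf_out // big1 // => j _; rewrite cf_out.
rewrite (bigD1 i) //= cfZ dc // mulfVK // big1 ?addr0 // => j ji.
have ej : ract F (ee (v j)) (e (gen K m v j)) = e (gen K m v j) by rewrite -he gen_ee.
rewrite cfZ (cf_deg ej) ?mulr0 //.
by apply: contra ji => /eqP /(v_inj vi) ->.
Qed.
End Diagonal.

(** Without a generator of [w] at the vertex [v i], the image of [gen i] would lie in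
    the radical. *)
Lemma top_label (I J : finType) (v : I -> nat) (w : J -> nat)
    (f : 'Hom(fproj K m v, fproj K m w)) (g : 'Hom(fproj K m w, fproj K m v)) i :
    rhom f -> rhom g -> valid m v i 0 0 ->
    g (f (gen K m v i)) - gen K m v i \in jrad _ ->
  exists j, w j = v i.
Proof.
move=> hf hg vi /(top_rad i) /eqP; rewrite -scaleN1r addrC cfL mulN1r addrC subr_eq0.
rewrite cf_gen vi !eqxx /= => e1.
apply: contrapT => no; have fr : f (gen K m v i) \in jrad (fproj K m w).
  have ei : ract (fproj K m w) (ee (v i)) (f (gen K m v i)) = f (gen K m v i).
    by rewrite -hf gen_ee.
  apply: rad_top => j; apply: (cf_deg ei).
  by apply/eqP => e; apply: no; exists j.
by move: e1; rewrite (top_rad i (rad_hom hg fr)) eq_sym oner_eq0.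
Qed.
End RadicalMaps.

Section ZigzagEnd.
Variables (K : fieldType) (m : nat).
Local Notation n := m.+1.
Local Notation A := (preproj K n).
Local Notation ee := (@ee K m).
Local Notation mon := (mon K m).
Implicit Types (S : pred nat) (i j p q : 'I_n.+2).

Lemma adj_neq S (i j : nat) : adj S i j -> (0 < (j - i) + (i - j))%N.
Proof. by move=> /adjP [_ _ [[]|[]]]; nlia. Qed.

Lemma zz_val_cf S i j c d : cf (zz_val K S i) j c d =
  (adj S i j && valid m (lab_out S) j c d && (c == j - i)%N && (d == i - j)%N)%:R.
Proof.
rewrite /zz_val cf_sum; case: (boolP (adj S i j)) => [aij|naij]; last first.
  rewrite big1 // => j' aj'; rewrite free_monE cf_gen; case: ifP => // _.
  by case: eqP => [e|]; [rewrite -e aj' in naij|rewrite andbF].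
rewrite (bigD1 j) //= big1 => [|j' /andP [_ /negbTE nj]]; last first.
  by rewrite free_monE cf_gen nj andbF; case: ifP.
rewrite addr0 free_monE cf_gen eqxx andbT; case: (boolP (valid m _ j c d)) => //= vld.
have vld' x y : (x <= c)%N -> (y <= d)%N -> valid m (lab_out S) j x y.
  by move: vld; rewrite /valid; nlia.
case: ifP => h; last by have -> : (c == j - i)%N && (d == i - j)%N = false by nlia.
by rewrite vld' ?leq_subr //=; congr ((nat_of_bool _)%:R); nlia.
Qed.

Lemma zz_diff_cf S z j c d : valid m (lab_out S) j c d ->
  cf (zz_diff K m S z) j c d = \sum_(i < n.+2 | [&& adj S i j, j - i <= c & i - j <= d]%N)
     cf z i (c - (j - i)) (d - (i - j)).
Proof.
move=> vld; rewrite [z in LHS]free_expand linear_sum cf_sum [RHS]big_mkcond /=.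
have vld' x y : (x <= c)%N -> (y <= d)%N -> valid m (lab_out S) j x y.
  by move: vld; rewrite /valid; nlia.
apply: eq_bigr => i _; rewrite linear_sum cf_sum.
have tm (a b : 'I_n.+1) : cf (zz_diff K m S (cf z i a b *: ract _ (mon a b) (gen K m _ i))) j c d =
   if [&& adj S i j, a + (j - i) == c & b + (i - j) == d]%N then cf z i a b else 0.
  rewrite linearZ /= cfZ zz_diff_hom zz_diff_gen free_monE vld zz_val_cf.
  case: (boolP (adj S i j)) => aij /=; last by rewrite if_same mulr0.
  case: ifP => h.
    rewrite vld' ?leq_subr //=; case: ifP => h'.
      have -> : (c - a == j - i)%N by nlia.
      by have -> : (d - b == i - j)%N; [nlia|rewrite mulr1].
    by have -> : (c - a == j - i)%N && (d - b == i - j)%N = false; [nlia|rewrite mulr0].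
  by rewrite mulr0; case: ifP => // h'; exfalso; move: h h'; nlia.
under eq_bigr do rewrite linear_sum cf_sum; under eq_bigr do under eq_bigr do rewrite tm.
case: ifP => [/and3P [aij hc hd]|h]; last first.
  by rewrite big1 // => a _; rewrite big1 // => b _; case: ifP => // h'; exfalso; move: h h'; case: (adj S i j) => //=; nlia.
have [ha hb] : (c - (j - i) < n.+1)%N /\ (d - (i - j) < n.+1)%N by move: vld; rewrite /valid; nlia.
rewrite (bigD1 (Ordinal ha)) //= (bigD1 (Ordinal hb)) //= aij !subnK // !eqxx /=.
rewrite !big1 ?addr0 // => [a na|b nb].
  rewrite big1 // => b _; case: ifP => // h; case/eqP: na; apply: val_inj => /=; nlia.
by case: ifP => // h; case/eqP: nb; apply: val_inj => /=; nlia.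
Qed.

Lemma zz_diff_rad S z : zz_diff K m S z \in jrad _.
Proof.
rewrite [z]free_expand !linear_sum; apply: rpred_sum => i _; rewrite linear_sum.
apply: rpred_sum => a _; rewrite linear_sum; apply: rpred_sum => b _; rewrite linearZ /=.
apply: memvZ; rewrite zz_diff_hom zz_diff_gen; apply: (@rad_mon _ _ (fproj K m (lab_out S))); apply: rpred_sum => j aij.
by apply: mon_rad; apply: adj_neq aij.
Qed.

Lemma lab_in_inj S i i' : valid m (lab_in S) i 0 0 -> lab_in S i = lab_in S i' -> i = i'.
Proof. by rewrite /valid /lab_in; do 2!case: ifP => // _; [move=> _ /val_inj|move=> h e; move: h; rewrite e]. Qed.
Lemma lab_out_inj S j j' : valid m (lab_out S) j 0 0 -> lab_out S j = lab_out S j' -> j = j'.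
Proof. by rewrite /valid /lab_out; do 2!case: ifP => // _; [move=> _ /val_inj|move=> h e; move: h; rewrite e]. Qed.

Lemma adj_uniq_up S (i j j' : nat) : adj S i j -> adj S i j' -> (i < j)%N -> (i < j')%N -> j = j'.
Proof.
move=> /adjP [_ /and3P [nj _ _] c] /adjP [_ /and3P [nj' _ _] c'] l l'.
have [[_ s]|[? _]] := c; last by nlia.
have [[_ s']|[? _]] := c'; last by nlia.
apply/eqP; rewrite eqn_leq; apply/andP; split; rewrite leqNgt; apply/negP => h.
  by suff : S j'; [rewrite (negbTE nj')|apply: s; nlia].
by suff : S j; [rewrite (negbTE nj)|apply: s'; nlia].
Qed.
Lemma adj_uniq_down S (i j j' : nat) : adj S i j -> adj S i j' -> (j < i)%N -> (j' < i)%N -> j = j'.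
Proof.
move=> /adjP [_ /and3P [nj _ sj] c] /adjP [_ /and3P [nj' _ sj'] c'] l l'.
have [[? _]|[_ s]] := c; first by nlia.
have [[? _]|[_ s']] := c'; first by nlia.
apply/eqP; rewrite eqn_leq; apply/andP; split; rewrite leqNgt; apply/negP => h.
  by suff : ~~ S j.-1; [rewrite sj|apply: s'; nlia].
by suff : ~~ S j'.-1; [rewrite sj'|apply: s; nlia].
Qed.
Lemma adj_uniq_up' S (i i' j : nat) : adj S i j -> adj S i' j -> (i < j)%N -> (i' < j)%N -> i = i'.
Proof.
move=> /adjP [/andP [_ h1] _ c] /adjP [/andP [_ h2] _ c'] l l'.
have [[_ s]|[? _]] := c; last by nlia.
have [[_ s']|[? _]] := c'; last by nlia.
apply/eqP; rewrite eqn_leq; apply/andP; split; rewrite leqNgt; apply/negP => h.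
  by move: h1; have -> : (i == 0)%N = false; [nlia|rewrite /= s' //; nlia].
by move: h2; have -> : (i' == 0)%N = false; [nlia|rewrite /= s //; nlia].
Qed.
Lemma adj_uniq_down' S (i i' j : nat) : adj S i j -> adj S i' j -> (j < i)%N -> (j < i')%N -> i = i'.
Proof.
move=> /adjP [/andP [h1 _] _ c] /adjP [/andP [h2 _] _ c'] l l'.
have [[? _]|[_ s]] := c; first by nlia.
have [[? _]|[_ s']] := c'; first by nlia.
apply/eqP; rewrite eqn_leq; apply/andP; split; rewrite leqNgt; apply/negP => h.
  by suff : ~~ S i'; [rewrite h2|apply: s; nlia].
by suff : ~~ S i; [rewrite h1|apply: s'; nlia].
Qed.

(** Comparing the coefficients of the shortest path from [j] to [i] on both
    sides of [u f = f v]: on either side only one summand reaches it. *)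
Lemma zz_diag_adj S (f : tmor (zigzag K m S) (zigzag K m S)) i j : tchain f -> adj S i j ->
    (0 < i <= n)%N -> (0 < j <= n)%N ->
  cf (f.1 (gen K m (lab_in S) i)) i 0 0 = cf (f.2 (gen K m (lab_out S) j)) j 0 0.
Proof.
move=> [h1 h2 e] aij hi hj; have [si sj ij] := adjP aij.
have vld : valid m (lab_out S) j (j - i) (i - j).
  by rewrite /valid /lab_out sj; nlia.
have := congr1 (fun g : 'Hom(_, _) => cf (g (gen K m (lab_in S) i)) j (j - i) (i - j)) e.
rewrite !comp_lfunE zz_diff_cf // zz_diff_gen /zz_val linear_sum cf_sum.
rewrite (bigD1 j) //= big1 ?addr0 => [|j' /andP [aj' nj']]; last first.
  rewrite h2 free_monE vld /=; case: ifP => // h; case/eqP: nj'; apply: val_inj.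
  have := adj_neq aj'; have [ltij|ltji] : (i < j \/ j < i)%N by case: ij => -[]; [left|right].
    by move=> _; apply/esym/(adj_uniq_up aij aj' ltij); have := adj_neq aj'; nlia.
  by move=> _; apply/esym/(adj_uniq_down aij aj' ltji); have := adj_neq aj'; nlia.
rewrite h2 free_monE vld !leqnn !subnn /= => ->.
rewrite (bigD1 i) /=; last by rewrite aij !leqnn.
rewrite !subnn big1 ?addr0 // => i' /andP [/and3P [ai' l1 l2] ni'].
case/eqP: ni'; apply: val_inj; have neq := adj_neq ai'.
have [ltij|ltji] : (i < j \/ j < i)%N by case: ij => -[]; [left|right].
  by apply/esym/(adj_uniq_up' aij ai' ltij); nlia.
by apply/esym/(adj_uniq_down' aij ai' ltji); nlia.
Qed.

Definition zz_diag S (f : tmor (zigzag K m S) (zigzag K m S)) i : K :=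
  if entry S i then cf (f.1 (gen K m (lab_in S) i)) i 0 0
  else cf (f.2 (gen K m (lab_out S) i)) i 0 0.

Definition boundary S (i : nat) : bool := [&& entry S i || exit S i, (0 < i)%N & (i <= n)%N].

(** Entries and exits alternate, and two consecutive ones are adjacent. *)
Lemma next_boundary S (p q : nat) : boundary S p -> boundary S q -> (p < q)%N ->
  exists r, [/\ (p < r <= q)%N & entry S p /\ exit S r /\ adj S p r \/ exit S p /\ entry S r /\ adj S r p].
Proof.
move=> /and3P [/orP [ep|ep] p0 pn] /and3P [eq q0 qn] pq.
- have [Sp _] := andP ep.
  have [N [pN Nq SN]] : exists N, [/\ (p < N)%N, (N <= q)%N & ~~ S N].
    case/orP: eq => [/andP [Sq]|/and3P [nSq _ _]]; last by exists q.
    have -> /= : (q == 0)%N = false by nlia.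
    move=> nS; exists q.-1; split=> //; last by nlia.
    by rewrite ltn_neqAle; apply/andP; split; [apply: contra nS => /eqP <-|nlia].
  have [r [/andP [pr rN] Sr seg]] := first_change Sp pN SN.
  have xr : exit S r by rewrite /exit Sr seg; nlia.
  by exists r; split; [nlia|left; split=> //; split=> //; apply: adj_up].
have [Sp _ _] := and3P ep.
have [N [pN Nq SN]] : exists N, [/\ (p < N)%N, (N <= q)%N & S N].
  case/orP: eq => [/andP [Sq _]|/and3P [_ _ Sq]]; first by exists q.
  exists q.-1; split=> //; last by nlia.
  by rewrite ltn_neqAle; apply/andP; split; [apply: contra Sp => /eqP ->|nlia].
have [r [/andP [pr rN] Sr seg]] := @first_change (predC S) p N Sp pN (introT negPn SN).
have xr : entry S r.
  by rewrite /entry (negPn Sr) /=; apply/orP; right; apply: (seg r.-1); nlia.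
by exists r; split; [nlia|right; split=> //; split=> //; apply: adj_down].
Qed.

(** Adjacent boundary points have the same coefficient, and any two boundary points
    are linked by a chain of adjacent ones. *)
Lemma zz_diag_const S (f : tmor (zigzag K m S) (zigzag K m S)) p q : tchain f ->
  boundary S p -> boundary S q -> zz_diag f p = zz_diag f q.
Proof.
move=> cf_; wlog pq : p q / (p < q)%N.
  move=> W bp bq; have [l|l|/val_inj -> //] := ltngtP (p : nat) q; first exact: W.
  by apply/esym/W.
move: {2}(q - p)%N (leqnn (q - p)) => N; elim: N p pq => [|N IH] p pq lt bp bq; first by nlia.
have [r [/andP [pr rq] h]] := next_boundary bp bq pq.
have rn : (r < n.+2)%N by have := ltn_ord q; nlia.
have [/and3P [_ p0 pn] /and3P [_ q0 qn]] := (bp, bq).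
have br : boundary S r by rewrite /boundary; case: h => [[_ [-> _]]|[_ [-> _]]]; rewrite ?orbT /=; nlia.
have e : zz_diag f p = zz_diag f (Ordinal rn).
  case: h => [[ep [xr ar]]|[xp [er ar]]].
    rewrite /zz_diag ep; have -> : entry S (Ordinal rn) = false.
      by apply/negbTE/negP => /entry_exitF; rewrite xr.
    by apply: zz_diag_adj => //=; nlia.
  rewrite /zz_diag; have -> : entry S p = false.
    by apply/negbTE/negP => /entry_exitF; rewrite xp.
  rewrite er; apply/esym/zz_diag_adj => //=; nlia.
rewrite e; move: rq; rewrite leq_eqVlt => /orP [/eqP erq|rq].
  by congr (zz_diag f _); apply: val_inj.
by apply: IH => //=; nlia.
Qed.

(** A chain endomorphism of a zigzag complex is a scalar modulo the radical, so
    it is invertible as soon as one diagonal coefficient is not zero. *)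
Lemma zz_unit S (f : tmor (zigzag K m S) (zigzag K m S)) p : tchain f -> boundary S p ->
    zz_diag f p != 0 ->
  exists g : tmor (zigzag K m S) (zigzag K m S),
    [/\ tchain g, tcomp g f = tid _ & tcomp f g = tid _].
Proof.
move=> c bp nz; have [h1 h2 e] := c.
have [g1 [hg1 e1 e1']] : exists g1 : 'End(fproj K m (lab_in S)),
   [/\ rhom g1, (g1 \o f.1)%VF = \1%VF & (f.1 \o g1)%VF = \1%VF].
  apply: (@diag_unit _ _ _ _ (@lab_in_inj S) f.1 (zz_diag f p)) => // i vi.
  have si : entry S i by move: vi; rewrite /valid /lab_in; case: ifP.
  rewrite (@zz_diag_const S f p i) //; first by rewrite /zz_diag si.
  by move: vi; rewrite /valid /boundary /lab_in si /=; nlia.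
have [g2 [hg2 e2 e2']] : exists g2 : 'End(fproj K m (lab_out S)),
   [/\ rhom g2, (g2 \o f.2)%VF = \1%VF & (f.2 \o g2)%VF = \1%VF].
  apply: (@diag_unit _ _ _ _ (@lab_out_inj S) f.2 (zz_diag f p)) => // i vi.
  have si : exit S i by move: vi; rewrite /valid /lab_out; case: ifP.
  have ni : entry S i = false by apply/negbTE/negP => /entry_exitF; rewrite si.
  rewrite (@zz_diag_const S f p i) //; first by rewrite /zz_diag ni.
  by move: vi; rewrite /valid /boundary /lab_out si orbT /=; nlia.
exists (g1, g2); split; rewrite /tcomp /tid /= ?e1 ?e1' ?e2 ?e2' //; split=> //=.
rewrite -[LHS]comp_lfun1r -e1' -comp_lfunA (comp_lfunA _ f.1) -e.
by rewrite !comp_lfunA e2 comp_lfun1l.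
Qed.

Lemma zz_diag_sum S (N : nat) (f : 'I_N -> tmor (zigzag K m S) (zigzag K m S)) p :
  zz_diag (\sum_k f k) p = \sum_k zz_diag (f k) p.
Proof. by rewrite /zz_diag tsum1 tsum2 !sum_lfunE !cf_sum; case: ifP. Qed.

Lemma zz_diag_id S p : boundary S p -> zz_diag (tid (zigzag K m S)) p = 1.
Proof.
move=> /and3P [bp p0 pn]; rewrite /zz_diag.
have [ep|nep] := boolP (entry S p).
  by rewrite id_lfunE cf_gen !eqxx /valid /lab_in ep p0 addn0 pn.
have ep : exit S p by move: bp; rewrite (negbTE nep).
by rewrite id_lfunE cf_gen !eqxx /valid /lab_out ep p0 addn0 pn.
Qed.

Lemma zz_diag_null S (f : tmor (zigzag K m S) (zigzag K m S)) p : tnull f -> zz_diag f p = 0.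
Proof.
move=> [h hh ->]; rewrite /zz_diag /= !comp_lfunE; case: ifP => _; apply: top_rad.
  by apply: rad_hom => //; apply: zz_diff_rad.
exact: zz_diff_rad.
Qed.
End ZigzagEnd.

(** * Classification of the projective modules *)

Section ProjClassify.
Variables (K : fieldType) (m : nat).
Local Notation n := m.+1.
Local Notation A := (preproj K n).
Local Notation ee := (@ee K m).
Variable P : rmod A.

(** A complement of the radical in the component at the vertex [k]. *)
Definition topc k : {vspace P} := (limg (ract P (ee k)) :\: jrad P)%VS.
Definition topdim k : nat := \dim (topc k).

Lemma jrad_ee k z : z \in jrad P -> ract P (ee k) z \in jrad P.
Proof.
move=> /radP [z1 [z2 ->]]; rewrite linearD /= -!ractMx -ee_xx; apply/radP.
exists (ract P (ee k.+1) z1); case: k => [|k].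
  by exists 0; rewrite [ee 0]ee_out // mulr0 ract0 linear0 ractMx.
by exists (ract P (ee k) z2); rewrite -ee_yy !ractMx.
Qed.

Lemma topc_ee k z : z \in topc k -> ract P (ee k) z = z.
Proof.
move=> /(subvP (diffvSl _ _)) /memv_imgP [y _ ->]; exact: ract_ee.
Qed.
Lemma topc_rad k z : z \in topc k -> z \in jrad P -> z = 0.
Proof.
move=> h1 h2; apply/eqP; rewrite -memv0 -(capv_diff (limg (ract P (ee k))) (jrad P)).
by rewrite memv_cap h1.
Qed.

Section Index.
Variables (I : finType) (v : I -> nat).
Hypothesis v_count : forall k, (0 < k <= n)%N -> (\sum_i (v i == k))%N = topdim k.

Let fib k := enum [pred i | v i == k].
Let size_fib k : (0 < k <= n)%N -> size (fib k) = topdim k.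
Proof.
move=> hk; rewrite -v_count // -cardE -sum1_card big_mkcond /=.
by apply: eq_bigr => i _; rewrite inE; case: eqP.
Qed.
Let w i : P := (vbasis (topc (v i)))`_(index i (fib (v i))).
Let w_top i : w i \in topc (v i).
Proof.
rewrite /w; case: (ltnP (index i (fib (v i))) (size (vbasis (topc (v i))))) => h.
  by apply: vbasis_mem; rewrite mem_nth.
by rewrite nth_default // mem0v.
Qed.
Let w_ee i : ract P (ee (v i)) (w i) = w i.
Proof. exact: topc_ee. Qed.
Let w_nth i0 k (j : nat) : (j < size (fib k))%N ->
  w (nth i0 (fib k) j) = (vbasis (topc k))`_j.
Proof.
move=> h; have : nth i0 (fib k) j \in fib k by rewrite mem_nth.
rewrite mem_enum inE => /eqP e; rewrite /w e index_uniq //; exact: enum_uniq.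
Qed.
Let sum_fib (V : nmodType) k (G : I -> V) i0 :
  \sum_(i | v i == k) G i = \sum_(j < size (fib k)) G (nth i0 (fib k) j).
Proof.
rewrite -(big_mkord xpredT (fun j => G (nth i0 (fib k) j))) -(big_nth i0 xpredT).
by rewrite big_enum_cond; apply: eq_bigl => i; rewrite inE andbT.
Qed.

(** Lifting a basis of the top gives a surjection, by the lemma of Nakayama; it
    splits as [P] is projective, and its kernel lies in the radical because the basis
    is free modulo the radical. The splitting is then surjective, again by the lemma
    of Nakayama. *)
Lemma proj_of_top : rproj P -> riso (fproj K m v) P.
Proof.
move=> pP; have [f hf fw] := free_map w_ee.
have sj : limg f = fullv.
  apply: nakayama; first exact: rsubmod_img.
  apply/vspaceP => z; rewrite memvf -[z]ract1x -(ee_sum K m) ract_sum.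
  apply: rpred_sum => k _; have [k0|kp] := posnP k.
    by rewrite k0 [X in ract P X]ee_out // ract0 mem0v.
  have hk : (0 < k <= n)%N by rewrite kp -ltnS ltn_ord.
  have : ract P (ee k) z \in limg (ract P (ee k)) by apply: memv_img; apply: memvf.
  rewrite -(addv_diff_cap (limg (ract P (ee k))) (jrad P)) => /memv_addP [x xC [y]].
  rewrite memv_cap => /andP [_ yJ] ->; apply: memv_add => //.
  rewrite (coord_vbasis xC); apply: rpred_sum => j _; apply: memvZ.
  have jl : (j < size (fib k))%N by rewrite size_fib.
  have i0 : I by case: (fib k) jl => // i.
  by rewrite -(w_nth i0 jl) -fw; apply: memv_img; apply: memvf.
have [g hg fg] := pP _ _ f \1%VF hf (@rhom_id _ _ P) sj.
have ker_top z i : f z = 0 -> cf z i 0 0 = 0.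
  move=> fz; have [vi|nvi] := boolP (valid m v i 0 0); last by rewrite cf_out.
  pose k := v i; have hk : (0 < k <= n)%N by move: vi; rewrite /valid -/k; nlia.
  pose y := \sum_i cf z i 0 0 *: gen K m v i.
  have zy : z - y \in jrad (fproj K m v).
    apply: rad_top => i'; rewrite -[_ - _]addrC -scaleN1r cfL mulN1r addrC.
    apply/eqP; rewrite subr_eq0; apply/eqP; rewrite /y cf_sum (bigD1 i') //= cfZ cf_gen !eqxx !andbT.
    rewrite big1 ?addr0 => [|i2 n2]; last by rewrite cfZ cf_gen (negbTE n2) andbF mulr0.
    by case: (boolP (valid m v i' 0 0)) => h; rewrite ?mulr1 // cf_out // mul0r.
  have fy : f y \in jrad P.
    have := rad_hom hf zy; rewrite linearB /= fz sub0r memvN //.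
  have := jrad_ee k fy; rewrite !linear_sum /=.
  have -> : \sum_i0 ract P (ee k) (f (cf z i0 0 0 *: gen K m v i0)) =
     \sum_(i0 | v i0 == k) cf z i0 0 0 *: w i0.
    rewrite [RHS]big_mkcond /=; apply: eq_bigr => i0 _; rewrite !linearZ /= fw -w_ee -ractMx ee_mul.
    by case: eqP => [->|_]; rewrite ?ract0 ?scaler0 // -w_ee.
  rewrite (sum_fib _ _ i) => h.
  have sC : \sum_(j < size (fib k)) cf z (nth i (fib k) j) 0 0 *: w (nth i (fib k) j) \in topc k.
    apply: rpred_sum => j _; apply: memvZ; rewrite w_nth //; apply: vbasis_mem.
    by apply: mem_nth; rewrite [X in (_ < X)%N]size_tuple; apply: leq_trans (ltn_ord j) _; rewrite size_fib.
  have := topc_rad sC h.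
  have := basis_free (vbasisP (topc k)) => /freeP fr e.
  have ii : i \in fib k by rewrite mem_enum inE.
  have il : (index i (fib k) < topdim k)%N by rewrite -size_fib // index_mem.
  have := fr (fun j => cf z (nth i (fib k) j) 0 0) _ (Ordinal il).
  rewrite /= nth_index //; apply; rewrite -[RHS]e size_fib //.
  by apply: eq_bigr => j _; rewrite w_nth // size_fib.
have sg : limg g = fullv.
  apply: nakayama; first exact: rsubmod_img.
  apply/vspaceP => z; rewrite memvf -[z](subrK (g (f z))) addrC.
  apply: memv_add; first by apply: memv_img; apply: memvf.
  apply: rad_top => i; apply: ker_top; rewrite linearB /=.
  by rewrite -(comp_lfunE f g) fg id_lfunE subrr.
apply: (riso_of_inverses hf (g := g)) => //.
apply/lfunP => z; have /memv_imgP [y _ ->] : z \in limg g by rewrite sg memvf.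
by rewrite comp_lfunE -(comp_lfunE f g) fg !id_lfunE.
Qed.
End Index.
End ProjClassify.

(** The boundary tells where membership changes. So two sets with the same boundary
    agree everywhere or nowhere; in the second case an entry of one is an exit
    of the other, so neither has a boundary, and [S] is empty or everything. *)
Lemma boundary_determines (S T : pred nat) (n : nat) :
    (exists2 k, (k <= n)%N & S k) -> (exists2 k, (k <= n)%N & ~~ S k) ->
    (forall k, (0 < k <= n)%N -> entry S k = entry T k /\ exit S k = exit T k) ->
  forall k, (k <= n)%N -> S k = T k.
Proof.
move=> [a an Sa] [b bn Sb] h.
have step k : (k < n)%N -> (S k = T k -> S k.+1 = T k.+1) /\
    (S k = ~~ T k -> S k.+1 = ~~ T k.+1 /\ S k.+1 = S k).
  move=> kn; have [] := h k.+1 kn; rewrite /entry /exit /=.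
  by case: (S k); case: (T k); case: (S k.+1); case: (T k.+1).
have [e|ne] := eqVneq (S 0%N) (T 0%N).
  by elim=> // k IH kn; apply: (proj1 (step k kn)); apply: IH; apply: ltnW.
have c k : (k <= n)%N -> S k = ~~ T k /\ S k = S 0%N.
  elim: k => [|k IH] kn; first by split=> //; case: (S 0%N) (T 0%N) ne => [] [].
  have [e1 e2] := IH (ltnW kn); have [h1 h2] := proj2 (step k kn) e1.
  by split=> //; rewrite h2.
by have [_ ea] := c a an; have [_ eb] := c b bn; rewrite ea -eb (negbTE Sb) in Sa.
Qed.

(** * Direct sums of complexes of projectives *)

Section BlockSum.
Variables (K : fieldType) (m : nat) (J I : finType).
Local Notation n := m.+1.
Local Notation A := (preproj K n).
Local Notation ee := (@ee K m).

Section OneTerm.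
Variable u : J -> I -> nat.
Definition ulab (p : J * I) : nat := u p.1 p.2.

Lemma sinc_ex j : exists2 f : 'Hom(fproj K m (u j), fproj K m ulab),
  rhom f & forall i, f (gen K m (u j) i) = gen K m ulab (j, i).
Proof. by apply: free_map => i; exact: (@gen_ee K m _ ulab (j, i)). Qed.
Lemma sprj_ex j : exists2 f : 'Hom(fproj K m ulab, fproj K m (u j)),
  rhom f & forall p, f (gen K m ulab p) = if p.1 == j then gen K m (u j) p.2 else 0.
Proof.
apply: free_map => -[j' i] /=; case: eqP => [->|_]; last by rewrite linear0.
exact: gen_ee.
Qed.
Definition sinc j := s2val (cid2 (sinc_ex j)).
Definition sprj j := s2val (cid2 (sprj_ex j)).
Lemma sinc_hom j : rhom (sinc j). Proof. exact: s2valP (cid2 (sinc_ex j)). Qed.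
Lemma sprj_hom j : rhom (sprj j). Proof. exact: s2valP (cid2 (sprj_ex j)). Qed.
Lemma sinc_gen j i : sinc j (gen K m (u j) i) = gen K m ulab (j, i).
Proof. exact: (s2valP' (cid2 (sinc_ex j))). Qed.
Lemma sprj_gen j p :
  sprj j (gen K m ulab p) = if p.1 == j then gen K m (u j) p.2 else 0.
Proof. exact: (s2valP' (cid2 (sprj_ex j))). Qed.

Lemma sprj_inc j : (sprj j \o sinc j)%VF = \1%VF.
Proof.
apply: free_hom_eq; [exact: (rhom_comp (@sprj_hom j) (@sinc_hom j))|exact: rhom_id|].
by move=> i; rewrite comp_lfunE sinc_gen sprj_gen eqxx id_lfunE.
Qed.
Lemma sprj_inc0 j j' : j' != j -> (sprj j \o sinc j')%VF = 0.
Proof.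
move=> ne; apply: free_hom_eq; [exact: (rhom_comp (@sprj_hom j) (@sinc_hom j'))|exact: rhom0|].
by move=> i; rewrite comp_lfunE sinc_gen sprj_gen (negbTE ne) zero_lfunE.
Qed.
Lemma sinc_prj : \sum_j (sinc j \o sprj j)%VF = \1%VF.
Proof.
apply: free_hom_eq; [|exact: rhom_id|].
  by apply: rhom_sum => j _; exact: (rhom_comp (@sinc_hom j) (@sprj_hom j)).
move=> [j i]; rewrite sum_lfunE (bigD1 j) //= big1 => [|j' /negbTE nj].
  by rewrite addr0 comp_lfunE sprj_gen eqxx sinc_gen id_lfunE.
by rewrite comp_lfunE sprj_gen /= eq_sym nj linear0.
Qed.
End OneTerm.

Variables (u1 u0 : J -> I -> nat).
Variable d : forall j, 'Hom(fproj K m (u1 j), fproj K m (u0 j)).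
Hypothesis dh : forall j, rhom (d j).

Definition bdiff : 'Hom(fproj K m (ulab u1), fproj K m (ulab u0)) :=
  \sum_j (sinc u0 j \o d j \o sprj u1 j)%VF.
Lemma bdiff_hom : rhom bdiff.
Proof.
apply: rhom_sum => j _; apply: rhom_comp; last exact: sprj_hom.
by apply: rhom_comp; [exact: sinc_hom|exact: dh].
Qed.
Definition bsum : tcx A := Tcx (@bdiff_hom).
Definition bpart j : tcx A := Tcx (@dh j).
Definition binc j : tmor (bpart j) bsum := (sinc u1 j, sinc u0 j).
Definition bprj j : tmor bsum (bpart j) := (sprj u1 j, sprj u0 j).

Lemma binc_chain j : tchain (binc j).
Proof.
split; [exact: sinc_hom|exact: sinc_hom|].
rewrite /= /bdiff comp_lfun_suml (bigD1 j) //= big1 => [|j' nj].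
  by rewrite addr0 -[RHS]comp_lfunA sprj_inc comp_lfun1r.
by rewrite -comp_lfunA sprj_inc0 1?eq_sym // comp_lfun0r.
Qed.
Lemma bprj_chain j : tchain (bprj j).
Proof.
split; [exact: sprj_hom|exact: sprj_hom|].
rewrite /= /bdiff comp_lfun_sumr (bigD1 j) //= big1 => [|j' nj].
  by rewrite addr0 !comp_lfunA sprj_inc comp_lfun1l.
by rewrite !comp_lfunA sprj_inc0 // !comp_lfun0l.
Qed.
Lemma bprj_inc j : tcomp (bprj j) (binc j) = tid (bpart j).
Proof. by rewrite /tcomp /= !sprj_inc. Qed.
Lemma binc_prj : \sum_j tcomp (binc j) (bprj j) = tid bsum.
Proof. by rewrite [LHS]surjective_pairing tsum1 tsum2 /= !sinc_prj. Qed.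
Lemma bsum_rigid : (forall i j, tvanish (bpart i) (bpart j)) -> trigid bsum.
Proof.
exact: (tvanish_sum binc_chain bprj_chain binc_chain bprj_chain binc_prj binc_prj).
Qed.
End BlockSum.

(** * Rigid complexes contain a zigzag complex *)

Section Core.
Variables (K : fieldType) (m : nat).
Local Notation n := m.+1.
Local Notation A := (preproj K n).

(** The predicate is false above [n], so that an interval of [s] reaching [n] gets
    the exit [n + 1], which is not a vertex. *)
Definition setp (s : {set 'I_n.+1}) : pred nat := fun k => (k <= n)%N && (inord k \in s).

Lemma setp_out s k : (n < k)%N -> ~~ setp s k.
Proof. by rewrite /setp ltnNge => /negbTE ->. Qed.

Lemma gen_invalid (I : finType) (v : I -> nat) i :
  ~~ valid m v i 0 0 -> gen K m v i = 0.
Proof.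
move=> nv; apply: cf_ext => i' a b vld; rewrite cf_gen cf0.
case: (boolP (_ && _)) => // /andP [/andP [/andP [_ /eqP e] /eqP ea] /eqP eb].
by subst; rewrite vld in nv.
Qed.

Lemma fproj_zero (I : finType) (v : I -> nat) :
  (forall i, ~~ valid m v i 0 0) -> \1%VF = 0 :> 'End(fproj K m v).
Proof.
move=> nv; apply: free_hom_eq; [exact: rhom_id|exact: rhom0|].
by move=> i; rewrite gen_invalid // !linear0.
Qed.

Lemma boundary_ex (S : pred nat) : (exists2 k, (k <= n)%N & S k) ->
  (exists2 k, (k <= n)%N & ~~ S k) -> exists p : 'I_n.+2, boundary m S p.
Proof.
move=> [a an Sa] [b bn Sb]; apply: contrapT => no.
have st k : (k < n)%N -> S k.+1 = S k.
  move=> kn; apply: contrapT => ne; apply: no.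
  have kn2 : (k.+1 < n.+2)%N by nlia.
  exists (Ordinal kn2); rewrite /boundary /entry /exit /= kn !andbT.
  by case: (S k.+1) (S k) ne => [] [].
have c k : (k <= n)%N -> S k = S 0%N.
  by elim: k => // k IH kn; rewrite st //; apply: IH; apply: ltnW.
by rewrite (c a an) -(c b bn) (negbTE Sb) in Sa.
Qed.

Lemma zigzag_zero (S : pred nat) : (forall k, (n < k)%N -> ~~ S k) ->
    ~ ((exists2 k, (k <= n)%N & S k) /\ (exists2 k, (k <= n)%N & ~~ S k)) ->
  tid (zigzag K m S) = 0.
Proof.
move=> S_out h; have const k : (0 < k <= n)%N -> S k = S k.-1.
  move=> hk; apply: contrapT => ne; apply: h.
  have kp : (k.-1 <= n)%N by nlia.
  have [_ kn] := andP hk.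
  by case Sk: (S k) ne; case Sk': (S k.-1) => // _; split; [exists k|exists k.-1|exists k.-1|exists k];
     rewrite ?Sk ?Sk'.
congr (_, _); apply: fproj_zero => i; apply/negP; rewrite /valid /lab_in /lab_out.
  case: ifP => // /andP [Si Si'] /andP [i0 iN]; have ine0 : (i == 0 :> nat)%N = false by nlia.
  by move: Si'; rewrite ine0 /= -const ?Si //; nlia.
case: ifP => // /and3P [Si i0 Si'] /andP [_ iN].
by move: Si; rewrite const ?Si' //; nlia.
Qed.

Section Counting.
Variables a b : nat -> nat.

(** Up to a constant that makes it nonnegative, the height is the function that
    changes by [b k - a k] from [k - 1] to [k]. *)
Definition height k := (\sum_(1 <= i < k.+1) b i + \sum_(k.+1 <= i < n.+1) a i)%N.
Definition hbound := (\sum_(1 <= i < n.+1) (a i + b i))%N.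

Lemma height_step k : (0 < k <= n)%N -> (height k + a k = height k.-1 + b k)%N.
Proof.
move=> /andP [k0 kn]; rewrite /height prednK //.
have -> : (\sum_(1 <= i < k.+1) b i = \sum_(1 <= i < k) b i + b k)%N by rewrite big_nat_recr.
have -> : (\sum_(k <= i < n.+1) a i = a k + \sum_(k.+1 <= i < n.+1) a i)%N by rewrite big_ltn.
nlia.
Qed.
Lemma height_bound k : (k <= n)%N -> (height k <= hbound)%N.
Proof.
move=> kn; rewrite /height /hbound big_split /= addnC.
rewrite (@big_cat_nat _ _ _ k.+1 1 n.+1 xpredT b) // (@big_cat_nat _ _ _ k.+1 1 n.+1 xpredT a) //=.
nlia.
Qed.
Lemma minab_bound k : (0 < k <= n)%N -> (minn (a k) (b k) <= hbound)%N.
Proof.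
move=> hk; rewrite /hbound (@big_cat_nat _ _ _ k 1 n.+1) /=; [|nlia..].
rewrite (@big_ltn _ _ _ k) /=; nlia.
Qed.

Definition level (c : nat) : pred nat := fun k => (k <= n)%N && (c < height k)%N.
Definition block := ('I_hbound + 'I_n.+2 * 'I_hbound)%type.
(** The labels of one contractible complex with a single generator at [k] in each of
    the two degrees; the indices [c] below [minn (a k) (b k)] carry one each. *)
Definition cone_lab (k c : nat) (i : 'I_n.+2) : nat :=
  if (i == ord0) && (c < minn (a k) (b k))%N && (0 < k <= n)%N then k else 0%N.
Definition blab1 (c : block) : 'I_n.+2 -> nat :=
  match c with inl c => lab_in (level c) | inr (k, c) => cone_lab k c end.
Definition blab0 (c : block) : 'I_n.+2 -> nat :=
  match c with inl c => lab_out (level c) | inr (k, c) => cone_lab k c end.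
Definition bd (c : block) : 'Hom(fproj K m (blab1 c), fproj K m (blab0 c)).
Proof. by case: c => [c|[k c]]; [exact: (zz_diff K m (level c))|exact: \1%VF]. Defined.
Lemma bd_hom c : rhom (bd c).
Proof. by case: c => [c|[k c]]; [exact: zz_diff_hom|exact: rhom_id]. Qed.

(** The superlevel sets of the heights form a chain of sets whose zigzag
    complexes, together with some contractible complexes, have prescribed
    numbers of generators. *)
Definition model : tcx A := bsum bd_hom.

Lemma level_out c k : (n < k)%N -> ~~ level c k.
Proof. by rewrite /level ltnNge => /negbTE ->. Qed.

(** A contractible complex has no maps to or from anything, and of two superlevel
    sets one contains the other. *)
Lemma bpart_vanish c c' : tvanish (bpart bd_hom c) (bpart bd_hom c').
Proof.
case: c => [c|[k c]]; last first.
  move=> h hh; exists 0, h; split=> //; first exact: rhom0.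
  by rewrite /= comp_lfun0r add0r comp_lfun1r.
case: c' => [c'|[k c']]; last first.
  move=> h hh; exists h, 0; split=> //; first exact: rhom0.
  by rewrite /= comp_lfun0l addr0 comp_lfun1l.
apply: zigzag_vanish; [exact: level_out|exact: level_out|].
have [cc|cc] := leqP c c'; [right|left] => k /andP [kn h]; rewrite /level kn /=; nlia.
Qed.

Lemma model_rigid : trigid model.
Proof. by apply: bsum_rigid; exact: bpart_vanish. Qed.

Lemma sum_lt_ord M x : (x <= M)%N -> (\sum_(c < M) (c < x)%N)%N = x.
Proof.
move=> xM; rewrite -(big_mkord xpredT (fun c => (c < x)%N : nat)).
rewrite (@big_cat_nat _ _ _ x) //= big_nat_cond (eq_bigr (fun => 1%N)).
  rewrite -big_nat_cond sum_nat_const_nat muln1 subn0 big_nat_cond big1 ?addn0 // => i.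
  by rewrite andbT => /andP [h _]; rewrite ltnNge h.
by move=> i /andP [/andP [_ ->]].
Qed.

Lemma sum_between M x y : (y <= M)%N -> (\sum_(c < M) ((c < y) && ~~ (c < x))%N)%N = (y - x)%N.
Proof.
move=> yM; have [xy|yx] := leqP x y; last first.
  rewrite big1 => [|c _]; first by nlia.
  by case: (ltnP c y) => //= cy; rewrite (ltn_trans cy yx).
apply: (@addnI x); rewrite subnKC // -[in RHS](sum_lt_ord yM) -[X in (X + _)%N](sum_lt_ord (leq_trans xy yM)).
rewrite -big_split /=; apply: eq_bigr => c _.
by case: (ltnP c x) => /= cx; rewrite ?andbF ?andbT ?(leq_trans cx xy).
Qed.

Lemma cone_count k : (0 < k <= n)%N ->
  (\sum_(p : 'I_n.+2 * 'I_hbound) \sum_i (cone_lab p.1 p.2 i == k))%N = minn (a k) (b k).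
Proof.
move=> hk; have kn : (k < n.+2)%N by nlia.
rewrite -(pair_bigA _ (fun (k' : 'I_n.+2) (c : 'I_hbound) => \sum_i (cone_lab k' c i == k)%N)%N) /=.
rewrite (bigD1 (Ordinal kn)) //= [X in (_ + X)%N]big1 ?addn0 => [|k' nk]; last first.
  rewrite big1 // => c _; rewrite big1 // => i _; rewrite /cone_lab.
  case: ifP => _; last by case: eqP => // e; move: hk; rewrite -e.
  by case: eqP => // e; case/eqP: nk; apply: val_inj.
rewrite -[RHS](sum_lt_ord (minab_bound hk)); apply: eq_bigr => c _.
rewrite (bigD1 ord0) //= big1 ?addn0 => [|i ni].
  rewrite /cone_lab eqxx hk andbT /=; case: ifP => _; first by rewrite eqxx.
  by case: eqP => // e; move: hk; rewrite -e.
by rewrite /cone_lab (negbTE ni) /=; case: eqP => // e; move: hk; rewrite -e.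
Qed.

Lemma sum_lab (P : nat -> bool) k : (0 < k <= n)%N ->
  (\sum_(i < n.+2) ((if P i then nat_of_ord i else 0) == k))%N = P k.
Proof.
move=> hk; have kn : (k < n.+2)%N by nlia.
rewrite (bigD1 (Ordinal kn)) //= big1 ?addn0 => [|i ni].
  by case: (P k); rewrite ?eqxx //; case: eqP => // e; move: hk; rewrite -e.
case: (P i); last by case: eqP => // e; move: hk; rewrite -e.
by case: eqP => // e; case/eqP: ni; apply: val_inj.
Qed.

Lemma entry_level c k : (0 < k <= n)%N ->
  entry (level c) k = (c < height k)%N && ~~ (c < height k.-1)%N.
Proof.
move=> /andP [k0 kn]; rewrite /entry /level kn /= (leq_trans (leq_pred k) kn) /=.
by rewrite eqn0Ngt k0.
Qed.
Lemma exit_level c k : (0 < k <= n)%N ->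
  exit (level c) k = (c < height k.-1)%N && ~~ (c < height k)%N.
Proof.
move=> /andP [k0 kn]; rewrite /exit /level kn k0 /= (leq_trans (leq_pred k) kn) /=.
by rewrite andbC.
Qed.

(** A level [c] has an entry at [k] when [height k.-1 <= c < height k]. So the
    zigzag complexes have [height k - height k.-1] generators at [k], a truncated
    difference, and the contractible ones supply the common part of [a k] and [b k]. *)
Lemma model_count1 k : (0 < k <= n)%N -> (\sum_p (ulab blab1 p == k))%N = b k.
Proof.
move=> hk; rewrite -(pair_bigA _ (fun c i => (blab1 c i == k)%N : nat)) /=.
rewrite big_sumType /=.
have -> : (\sum_(p : 'I_n.+2 * 'I_hbound) \sum_i (blab1 (inr p) i == k))%N = minn (a k) (b k).
  by rewrite -cone_count //; apply: eq_bigr => -[].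
have -> : (\sum_(c < hbound) \sum_i (blab1 (inl c) i == k) = height k - height k.-1)%N.
  rewrite -(@sum_between hbound); last by apply: height_bound; nlia.
  by apply: eq_bigr => c _; rewrite sum_lab // entry_level.
have := height_step hk; nlia.
Qed.
Lemma model_count0 k : (0 < k <= n)%N -> (\sum_p (ulab blab0 p == k))%N = a k.
Proof.
move=> hk; rewrite -(pair_bigA _ (fun c i => (blab0 c i == k)%N : nat)) /=.
rewrite big_sumType /=.
have -> : (\sum_(p : 'I_n.+2 * 'I_hbound) \sum_i (blab0 (inr p) i == k))%N = minn (a k) (b k).
  by rewrite -cone_count //; apply: eq_bigr => -[].
have -> : (\sum_(c < hbound) \sum_i (blab0 (inl c) i == k) = height k.-1 - height k)%N.
  rewrite -(@sum_between hbound); last by apply: height_bound; nlia.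
  by apply: eq_bigr => c _; rewrite sum_lab // exit_level.
have := height_step hk; nlia.
Qed.
End Counting.

Lemma setpP (S : pred nat) : (forall k, (n < k)%N -> ~~ S k) ->
  setp [set i : 'I_n.+1 | S i] = S.
Proof.
move=> S_out; apply: funext => k; rewrite /setp inE; case: leqP => kn.
  by rewrite inordK.
by apply/esym/negbTE/S_out.
Qed.

Lemma setp_proper (s : {set 'I_n.+1}) : s != set0 -> s != setT ->
  (exists2 k, (k <= n)%N & setp s k) /\ (exists2 k, (k <= n)%N & ~~ setp s k).
Proof.
move=> /set0Pn [i si] sT; split.
  by exists i; [rewrite -ltnS|rewrite /setp inord_val si andbT -ltnS].
have /set0Pn [j] : ~: s != set0 by apply: contra sT => /eqP e; rewrite -[s]setCK e setC0.
rewrite inE => sj; exists j; first by rewrite -ltnS.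
by rewrite /setp inord_val (negbTE sj) andbF.
Qed.

(** The terms of [X] are those of the model with the same numbers of generators, to
    which it is generically isomorphic. A summand of the model is not contractible, as
    [X] is not; it is a zigzag complex, whose identity is a sum of maps through [X].
    One of these is invertible, because the endomorphisms of a zigzag complex form a
    local ring. *)
Theorem zigzag_summand (X : tcx A) : rproj (t1 X) -> rproj (t0 X) -> trigid X ->
    ~ tnull (tid X) ->
  exists s : {set 'I_n.+1}, [/\ s != set0, s != setT &
    exists (i : tmor (zigzag K m (setp s)) X) (p : tmor X (zigzag K m (setp s))),
      [/\ tchain i, tchain p & tcomp p i = tid _]].
Proof.
move=> p1 p0 rX nX; pose a := topdim (t0 X); pose b := topdim (t1 X).
have i1 : riso (t1 X) (t1 (model a b)).
  by apply: riso_sym; apply: proj_of_top p1; exact: model_count1.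
have i0 : riso (t0 X) (t0 (model a b)).
  by apply: riso_sym; apply: proj_of_top p0; exact: model_count0.
have [N [f [g [cf_ cg gf fg]]]] := trigid_generic i1 i0 rX (@model_rigid a b).
have [c nc] : exists c, ~ tnull (tid (bpart (@bd_hom a b) c)).
  apply: contrapT => all; apply: nX; rewrite -gf; apply: tnull_sum => k.
  apply: tnull_compl => //; rewrite -[f k]tcomp_idl -binc_prj tcomp_suml.
  apply: tnull_sum => c; apply: tnull_compr => //.
  rewrite -[bprj _ c]tcomp_idl; apply: tnull_compl; first exact: binc_chain.
  apply: tnull_compr; first exact: bprj_chain.
  by apply: contrapT => h; apply: all; exists c.
case: c nc => [c|[k c]] nc; last first.
  case: nc; exists \1%VF; first exact: rhom_id.
  by rewrite /tid /= !comp_lfun1l.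
have S_out := @level_out a b c.
have prop := contrapT (fun h => nc (eq_ind_r (@tnull _ _ _ _) (tnull0 _ _) (zigzag_zero S_out h))).
have [q bq] := boundary_ex prop.1 prop.2.
have [k nz] : exists k, zz_diag (tcomp (tcomp (bprj (@bd_hom a b) (inl c)) (f k))
    (tcomp (g k) (binc (@bd_hom a b) (inl c)))) q != 0.
  apply: contrapT => all; have := zz_diag_id K bq.
  have -> : tid (zigzag K m (level a b c)) =
     \sum_k tcomp (tcomp (bprj (@bd_hom a b) (inl c)) (f k))
         (tcomp (g k) (binc (@bd_hom a b) (inl c))).
    rewrite -[LHS](bprj_inc (@bd_hom a b) (inl c)).
    rewrite -[binc _ _ in LHS]tcomp_idl -fg tcomp_suml tcomp_sumr.
    by apply: eq_bigr => k _; rewrite !tcompA.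
  rewrite zz_diag_sum big1 => [/eqP|k _]; first by rewrite eq_sym oner_eq0.
  by apply/eqP/negPn/negP => h; apply: all; exists k.
have ch : tchain (tcomp (tcomp (bprj (@bd_hom a b) (inl c)) (f k))
    (tcomp (g k) (binc (@bd_hom a b) (inl c)))).
  apply: tchain_comp; apply: tchain_comp => //; [exact: bprj_chain|exact: binc_chain].
have [h [hh e _]] := zz_unit ch bq nz.
have [[x xn Sx] [y yn Sy]] := prop.
exists [set i : 'I_n.+1 | level a b c i]; split.
- apply/set0Pn; exists (inord x); rewrite inE inordK //.
- apply/negP => /eqP /setP /(_ (inord y)); rewrite !inE inordK // => e'.
  by rewrite e' in Sy.
rewrite setpP //.
exists (tcomp (g k) (binc (@bd_hom a b) (inl c))).
exists (tcomp h (tcomp (bprj (@bd_hom a b) (inl c)) (f k))); split.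
- exact: (tchain_comp (cg k) (@binc_chain _ _ _ _ _ _ _ _ (inl c))).
- exact: (tchain_comp hh (tchain_comp (@bprj_chain _ _ _ _ _ _ _ _ (inl c)) (cf_ k))).
by rewrite -[RHS]e !tcompA.
Qed.
End Core.

(** * Homotopies *)

Section Homotopy.
Variables (K : fieldType) (A : algType K).
Implicit Types X Y Z T : pcomplex A.

Lemma chain_map_comp X Y Z (g : cmap Y Z) (f : cmap X Y) :
  chain_map g -> chain_map f -> chain_map (cmap_comp g f).
Proof.
move=> [g1 g2] [f1 f2]; split=> [i|i j]; first exact: rhom_comp.
by rewrite /cmap_comp -comp_lfunA f2 comp_lfunA g2 comp_lfunA.
Qed.

Lemma nullh_ext X Y (f g : cmap X Y) : (forall i, f i = g i) ->
  null_homotopic f -> null_homotopic g.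
Proof. by move=> e [h [hh hd]]; exists h; split=> // i; rewrite -e. Qed.
Lemma nullh_compl X Y Z (g : cmap Y Z) (f : cmap X Y) :
  chain_map g -> null_homotopic f -> null_homotopic (cmap_comp g f).
Proof.
move=> [g1 g2] [h [hh hd]]; exists (fun i j => (g j \o h i j)%VF); split=> [i j|i].
  exact: rhom_comp.
by rewrite /cmap_comp hd comp_lfunDr !comp_lfunA g2.
Qed.
Lemma nullh_compr X Y Z (g : cmap Y Z) (f : cmap X Y) :
  chain_map f -> null_homotopic g -> null_homotopic (cmap_comp g f).
Proof.
move=> [f1 f2] [h [hh hd]]; exists (fun i j => (h i j \o f i)%VF); split=> [i j|i].
  exact: rhom_comp.
by rewrite /cmap_comp hd comp_lfunDl -!comp_lfunA f2.
Qed.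
Lemma nullhB X Y (f g : cmap X Y) : null_homotopic f -> null_homotopic g ->
  null_homotopic (fun i => f i - g i : 'Hom(X i, Y i)).
Proof.
move=> [h [hh hd]] [k [hk kd]]; exists (fun i j => h i j - k i j); split=> [i j|i].
  exact: rhomB.
by rewrite hd kd comp_lfunBl comp_lfunBr opprD addrACA.
Qed.
Lemma homotopic_refl X Y (f : cmap X Y) : homotopic f f.
Proof.
exists (fun i j => 0); split=> [i j|i]; first exact: rhom0.
by rewrite subrr comp_lfun0l comp_lfun0r addr0.
Qed.
Lemma homotopic_eq X Y (f g : cmap X Y) : (forall i, f i = g i) -> homotopic f g.
Proof. by move=> e; apply: nullh_ext (homotopic_refl f) => i; rewrite e. Qed.
Lemma nullh_zero X Y : null_homotopic (fun i => 0 : 'Hom(X i, Y i)).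
Proof.
exists (fun i j => 0); split=> [i j|i]; first exact: rhom0.
by rewrite comp_lfun0l comp_lfun0r addr0.
Qed.

(** The identity of [Y] factors through [p] up to homotopy. *)
Lemma Kzero_retract X Y (p : cmap X Y) (i : cmap Y X) : chain_map i ->
  homotopic (cmap_comp p i) (@cmap_id _ _ Y) -> null_homotopic p -> Kzero Y.
Proof.
move=> ci e np; have := nullhB (nullh_compr ci np) e.
by apply: nullh_ext => k; rewrite subKr.
Qed.

(** Strictly idempotent chain maps split in the category of complexes, since the
    image of an idempotent is a direct summand in each degree. *)
Section Split.
Variables (T : pcomplex A) (e : cmap T T).
Hypotheses (ce : chain_map e) (ee : forall i, (e i \o e i)%VF = e i).

Let eh i : rhom (e i). Proof. exact: ce.1. Qed.
Let sub i : rsubmod (limg (e i)) := rsubmod_img (@eh i).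
Let term i : rmod A := rsub (@sub i).
Definition split_inc i : 'Hom(term i, T i) := rsub_inc (@sub i).
Definition split_prj i : 'Hom(T i, term i) := (rsub_proj (@sub i) \o e i)%VF.

Lemma split_inc_prj i : (split_inc i \o split_prj i)%VF = e i.
Proof.
apply/lfunP => x; rewrite !comp_lfunE rsub_projK //; apply: memv_img; exact: memvf.
Qed.
Lemma split_prj_inc i : (split_prj i \o split_inc i)%VF = \1%VF.
Proof.
apply/lfunP => x; rewrite !comp_lfunE id_lfunE.
have /memv_imgP [y _ ey] := rsub_inc_mem x.
have -> : e i (split_inc i x) = split_inc i x by rewrite ey -comp_lfunE ee.
exact: rsub_incK.
Qed.
Lemma split_inc_hom i : rhom (split_inc i).
Proof. exact: rsub_inc_rhom. Qed.
Lemma split_prj_hom i : rhom (split_prj i).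
Proof.
move=> a x; apply: (@rsub_inc_inj _ _ _ _ (@sub i)).
rewrite (rsub_inc_rhom (sU := @sub i)) -!(comp_lfunE (rsub_inc _)).
by rewrite -[(rsub_inc _ \o _)%VF]/(split_inc i \o split_prj i)%VF split_inc_prj eh.
Qed.

Definition split_diff i j : 'Hom(term i, term j) :=
  (split_prj j \o cdiff T i j \o split_inc i)%VF.
Fact split_proj i : rproj (term i).
Proof.
apply: (@rproj_retract _ _ (T i) (term i) (split_inc i) (split_prj i)).
- exact: split_inc_hom.
- exact: split_prj_hom.
- exact: split_prj_inc.
- exact: cterm_proj.
Qed.
Fact split_hom i j : rhom (split_diff i j).
Proof.
apply: rhom_comp; last exact: split_inc_hom.
by apply: rhom_comp; [exact: split_prj_hom|exact: cdiff_hom].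
Qed.
Fact split_shape i j : j <> i + 1 -> split_diff i j = 0.
Proof. by move=> ne; rewrite /split_diff cdiff_shape // comp_lfun0r comp_lfun0l. Qed.
Fact split_comp i j k : (split_diff j k \o split_diff i j)%VF = 0.
Proof.
have -> : (split_diff j k \o split_diff i j)%VF = (split_prj k \o
    (cdiff T j k \o ((split_inc j \o split_prj j) \o (cdiff T i j \o split_inc i))))%VF.
  by rewrite /split_diff !comp_lfunA.
rewrite split_inc_prj (comp_lfunA (e j)) ce.2 -comp_lfunA (comp_lfunA (cdiff T j k)).
by rewrite cdiff_comp comp_lfun0l comp_lfun0r.
Qed.
Fact split_bounded : exists m : nat, forall i, (m < absz i)%N -> rzero (term i).
Proof.
have [b hb] := cterm_bounded T; exists b => i hi x.
by apply: (@rsub_inc_inj _ _ _ _ (@sub i)); rewrite (hb i hi (rsub_inc _ x)) linear0.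
Qed.
Definition split_cx : pcomplex A :=
  PComplex split_proj split_hom split_shape split_comp split_bounded.

Lemma split_inc_chain : chain_map (split_inc : cmap split_cx T).
Proof.
split=> [i|i j]; first exact: split_inc_hom.
transitivity ((split_inc j \o split_prj j) \o (cdiff T i j \o split_inc i))%VF.
  by rewrite /= /split_diff !comp_lfunA.
rewrite split_inc_prj comp_lfunA ce.2 -comp_lfunA -{1}split_inc_prj -comp_lfunA.
by rewrite split_prj_inc comp_lfun1r.
Qed.
Lemma split_prj_chain : chain_map (split_prj : cmap T split_cx).
Proof.
split=> [i|i j]; first exact: split_prj_hom.
transitivity (split_prj j \o (cdiff T i j \o (split_inc i \o split_prj i)))%VF; last first.
  by rewrite /= /split_diff !comp_lfunA.
rewrite split_inc_prj -ce.2 comp_lfunA -[in RHS]split_inc_prj comp_lfunA.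
by rewrite split_prj_inc comp_lfun1l.
Qed.
End Split.

(** The complement of the retract is the image of the idempotent [1 - i p]. As [Y] is
    not zero in the homotopy category, this complement is. *)
Lemma Kindec_retract T Y (i : cmap Y T) (p : cmap T Y) : chain_map i -> chain_map p ->
    (forall k, (p k \o i k)%VF = \1%VF) -> ~ Kzero Y -> Kindec T -> Kiso Y T.
Proof.
move=> ci cp pi nY [_ ind]; pose e : cmap T T := fun k => \1%VF - (i k \o p k)%VF.
have ce : chain_map e.
  split=> [k|k l]; first by apply: rhomB; [exact: rhom_id|apply: rhom_comp; [exact: ci.1|exact: cp.1]].
  rewrite /e comp_lfunBl comp_lfunBr comp_lfun1l comp_lfun1r; congr (_ - _).
  by rewrite -comp_lfunA cp.2 comp_lfunA ci.2 comp_lfunA.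
have pe k : (p k \o e k)%VF = 0.
  by rewrite /e comp_lfunBr comp_lfun1r comp_lfunA pi comp_lfun1l subrr.
have ei k : (e k \o i k)%VF = 0.
  by rewrite /e comp_lfunBl comp_lfun1l -comp_lfunA pi comp_lfun1r subrr.
have ee k : (e k \o e k)%VF = e k.
  by rewrite {1}/e comp_lfunBl comp_lfun1l -comp_lfunA pe comp_lfun0r subr0.
pose Z := split_cx ce ee.
pose j : cmap Z T := split_inc ce; pose q : cmap T Z := split_prj ce.
have cj : chain_map j := split_inc_chain ce ee.
have cq : chain_map q := split_prj_chain ce ee.
have jq k : (j k \o q k)%VF = e k := split_inc_prj ce k.
have qj k : (q k \o j k)%VF = \1%VF := split_prj_inc ce ee k.
have bip : Kbiproduct T Y Z.
  exists i, j, p, q; split; [by []|split].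
  - by apply: homotopic_eq => k; exact: pi.
  - by apply: homotopic_eq => k; exact: qj.
  - apply: nullh_ext (nullh_zero _ _) => k; rewrite /cmap_comp.
    by rewrite -[j k]comp_lfun1r -qj (comp_lfunA (j k)) jq comp_lfunA pe comp_lfun0l.
  - apply: nullh_ext (nullh_zero _ _) => k; rewrite /cmap_comp.
    by rewrite -[q k]comp_lfun1l -qj -(comp_lfunA _ (j k)) jq -comp_lfunA ei comp_lfun0r.
  - apply: homotopic_eq => k; rewrite /cmap_add /cmap_comp jq /e addrC subrK //.
case: (ind Y Z bip) => // zZ; exists i, p; split=> //.
  by apply: homotopic_eq => k; exact: pi.
have : null_homotopic (cmap_comp (cmap_comp j (@cmap_id _ _ Z)) q).
  by apply: nullh_compr => //; apply: nullh_compl.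
move=> h; have := nullhB (nullh_zero T T) h; apply: nullh_ext => k.
by rewrite /cmap_comp /cmap_id comp_lfun1r jq /e sub0r opprB.
Qed.
End Homotopy.

(** * Two-term objects of the homotopy category *)

Section TwoTermObjects.
Variables (K : fieldType) (A : algType K).
Implicit Types (X Y : tcx A) (S T : pcomplex A).

Local Notation m1 := (Negz 0).
Local Notation z0 := (Posz 0).

Definition tc T : tcx A := Tcx (@cdiff_hom _ _ T m1 z0).

Definition cext S T (f : tmor (tc S) (tc T)) : cmap S T := fun i =>
  match i return 'Hom(S i, T i) with
  | Negz 0 => f.1 | Posz 0 => f.2 | _ => 0 end.
Definition crestr S T (f : cmap S T) : tmor (tc S) (tc T) := (f m1, f z0).

Lemma two_term_zero T i : two_term T -> i <> m1 -> i <> z0 -> rzero (T i).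
Proof. by move=> h n1 n0; apply: h. Qed.

Lemma two_term_source T i (N : rmod A) (f : 'Hom(T i, N)) : two_term T -> i <> m1 -> i <> z0 -> f = 0.
Proof. by move=> h n1 n0; apply: (rzero_hom0 (N := N)); left; apply: two_term_zero. Qed.
Lemma two_term_target T i (N : rmod A) (f : 'Hom(N, T i)) : two_term T -> i <> m1 -> i <> z0 -> f = 0.
Proof. by move=> h n1 n0; apply: (rzero_hom0 (M := N)); right; apply: two_term_zero. Qed.

Lemma cext_other S T (f : tmor (tc S) (tc T)) i : i <> m1 -> i <> z0 -> cext f i = 0.
Proof. by case: i => -[|i]. Qed.

Variant degree : int -> Type :=
  | Deg1 : degree m1 | Deg0 : degree z0 | DegN i : i <> m1 -> i <> z0 -> degree i.
Lemma degreeP i : degree i.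
Proof. by case: i => -[|i]; constructor. Qed.

Lemma crestr_chain S T (f : cmap S T) : chain_map f -> tchain (crestr f).
Proof. by move=> [h e]; split; [exact: h|exact: h|exact: e]. Qed.

Lemma cext_chain S T (f : tmor (tc S) (tc T)) : two_term S -> two_term T ->
  tchain f -> chain_map (cext f).
Proof.
move=> hS hT [h1 h0 e]; split=> [i|i j].
  by case: (degreeP i) => [| |k n1 n0]; [exact: h1|exact: h0|rewrite cext_other //; exact: rhom0].
have [->|ne] := eqVneq j (i + 1); last first.
  by rewrite !cdiff_shape ?comp_lfun0l ?comp_lfun0r //; apply/eqP.
case: (degreeP i) => [| |k n1 n0]; first exact: e.
  by rewrite (two_term_target (cdiff T z0 _)) // comp_lfun0l cext_other // comp_lfun0l.
by rewrite [LHS](two_term_source (T := S)) // [RHS](two_term_source (T := S)).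
Qed.

Lemma two_term_nullh S T (f : cmap S T) : two_term S -> two_term T ->
  null_homotopic f <-> tnull (crestr f).
Proof.
move=> hS hT; split=> [[h [hh e]]|[h hh e]].
  exists (h z0 m1); first exact: hh.
  congr (_, _).
    rewrite [LHS](e m1) (two_term_source (T := T) (cdiff T (m1 - 1) m1)) // comp_lfun0l add0r //.
  by rewrite [LHS](e z0) (two_term_source (T := S) (h (z0 + 1) z0)) // comp_lfun0l addr0.
pose k i j : 'Hom(S i, T j) := match i, j return 'Hom(S i, T j) with
  | Posz 0, Negz 0 => h | _, _ => 0 end.
exists k; split=> [i j|i].
  by case: i => -[|i]; case: j => -[|j]; rewrite /k; try exact: rhom0.
case: (degreeP i) => [| |l n1 n0].
- rewrite (two_term_source (T := T) (cdiff T (m1 - 1) m1)) // comp_lfun0l add0r.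
  by have := congr1 fst e.
- rewrite (two_term_source (T := S) (k (z0 + 1) z0)) // comp_lfun0l addr0.
  by have := congr1 snd e.
by rewrite [LHS](two_term_source (T := S)) // [RHS](two_term_source (T := S)).
Qed.

Lemma two_term_Kzero T : two_term T -> Kzero T <-> tnull (tid (tc T)).
Proof. by move=> hT; exact: (two_term_nullh (@cmap_id _ _ T) hT hT). Qed.

(** The maps to the shifts by two and more vanish for reasons of degree. *)
Lemma two_term_presilting T : two_term T -> presilting T <-> trigid (tc T).
Proof.
move=> hT; split=> [pT h hh|rT].
  pose f : cmap T (cshift 1 T) := fun i =>
    match i return 'Hom(T i, cshift 1 T i) with Negz 0 => h | _ => 0 end.
  have fc : chain_map f.
    split=> [i|i j]; first by case: i => -[|i] //; exact: rhom0.
    have [->|ne] := eqVneq j (i + 1); last first.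
      by rewrite !cdiff_shape ?comp_lfun0l ?comp_lfun0r //; apply/eqP.
    case: (degreeP i) => [| |k n1 n0].
    - rewrite [RHS](two_term_target (T := T) (i := z0 + 1)) //.
      by rewrite [LHS](two_term_target (T := T) (i := z0 + 1)).
    - rewrite [RHS](two_term_target (T := T) (i := z0 + 1 + 1)) //.
      by rewrite [LHS](two_term_target (T := T) (i := z0 + 1 + 1)).
    by rewrite [LHS](two_term_source (T := T)) // [RHS](two_term_source (T := T)).
  have [k [kh kd]] := pT 1 isT f fc.
  exists (- k m1 (m1 - 1)), (k z0 m1); split; [exact: (rhomN (kh m1 (m1 - 1)))|exact: (kh z0 m1)|].
  rewrite [LHS](kd m1); congr (_ + _).
  rewrite /= /shift_diff comp_lfunNr.
  by rewrite expr1 scaleN1r comp_lfunNl.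
move=> i i0 f [fh fc].
have ii : i = 1 \/ (1 < i)%R by clear -i0; lia.
case: ii => [ei|i1]; last first.
  have e k : f k = 0.
    case: (degreeP k) => [| |l n1 n0].
    - by apply: (two_term_target (T := T) (i := m1 + i)) => //; move: i1; case: (i) => [[|[|]]|].
    - by apply: (two_term_target (T := T) (i := z0 + i)) => //; move: i1; case: (i) => [[|[|]]|].
    exact: (two_term_source (T := T)).
  by apply: nullh_ext (nullh_zero T (cshift i T)) => k; rewrite e.
move: f fh fc; rewrite {}ei {i i0} => f fh fc.
have [v [u [hv hu e]]] := rT (f m1) (fh m1).
pose k i j : 'Hom(T i, cshift 1 T j) := match i, j return 'Hom(T i, cshift 1 T j) with
  | Negz 0, Negz 1 => - v | Posz 0, Negz 0 => u | _, _ => 0 end.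
exists k; split=> [i j|i].
  case: i => -[|i]; case: j => -[|[|j]]; rewrite /k; try exact: rhom0; try exact: hu.
  exact: (rhomN hv).
case: (degreeP i) => [| |l n1 n0].
- rewrite [LHS]e; congr (_ + _).
  rewrite /= /shift_diff expr1 scaleN1r comp_lfunNl.
  exact: (esym (etrans (congr1 _ (comp_lfunNr _ _)) (opprK _))).
- by rewrite [LHS](two_term_target (T := T) (i := z0 + 1)) // [RHS](two_term_target (T := T) (i := z0 + 1)).
by rewrite [LHS](two_term_source (T := T)) // [RHS](two_term_source (T := T)).
Qed.

Section Build.
Variables (X : tcx A).
Hypotheses (p1 : rproj (t1 X)) (p0 : rproj (t0 X)).

Definition cx_term (i : int) : rmod A :=
  match i with Negz 0 => t1 X | Posz 0 => t0 X | _ => zero_mod A end.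
Definition cx_diff i j : 'Hom(cx_term i, cx_term j) :=
  match i, j return 'Hom(cx_term i, cx_term j) with
  | Negz 0, Posz 0 => td X | _, _ => 0 end.
Fact cx_proj i : rproj (cx_term i).
Proof.
by case: i => -[|i] //=; apply: rproj_zero; exact: zero_mod_rzero.
Qed.
Fact cx_hom i j : rhom (cx_diff i j).
Proof. by case: i => -[|i]; case: j => -[|j]; try exact: rhom0; exact: td_hom. Qed.
Fact cx_shape i j : j <> i + 1 -> cx_diff i j = 0.
Proof. by case: i => -[|i]; case: j => -[|j]. Qed.
Fact cx_comp i j k : (cx_diff j k \o cx_diff i j)%VF = 0.
Proof.
by case: i => -[|i]; case: j => -[|j]; case: k => -[|k] //=; rewrite ?comp_lfun0l ?comp_lfun0r.
Qed.
Fact cx_bounded : exists m : nat, forall i, (m < absz i)%N -> rzero (cx_term i).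
Proof. by exists 1%N => -[[|i]|[|i]] //= _; exact: zero_mod_rzero. Qed.
Definition cx : pcomplex A := PComplex cx_proj cx_hom cx_shape cx_comp cx_bounded.

Lemma cx_two_term : two_term cx.
Proof. by move=> [[|i]|[|i]] // _ _; exact: zero_mod_rzero. Qed.
End Build.
End TwoTermObjects.

(** * Classification of the indecomposable two-term presilting complexes *)

Section Presilting.
Variables (K : fieldType) (m : nat).
Local Notation n := m.+1.
Local Notation A := (preproj K n).
Implicit Types s t : {set 'I_n.+1}.

Definition zzs s : tcx A := zigzag K m (setp s).
Definition zzcx s : pcomplex A :=
  cx (@free_proj K m _ (lab_in (setp s)) : rproj (t1 (zzs s)))
     (@free_proj K m _ (lab_out (setp s)) : rproj (t0 (zzs s))).

Lemma zzs_rigid s : trigid (zzs s).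
Proof. by apply: zigzag_vanish; [exact: setp_out|exact: setp_out|left]. Qed.

Lemma zzs_boundary s : s != set0 -> s != setT -> exists p : 'I_n.+2, boundary m (setp s) p.
Proof. by move=> s0 sT; have [e1 e2] := setp_proper s0 sT; exact: (boundary_ex e1 e2). Qed.

Lemma zzcx_two_term s : two_term (zzcx s).
Proof. exact: cx_two_term. Qed.

Lemma zzcx_presilting s : presilting (zzcx s).
Proof. by apply/(two_term_presilting (@zzcx_two_term s)); exact: (@zzs_rigid s). Qed.

Lemma zz_diagB (S : pred nat) (f g : tmor (zigzag K m S) (zigzag K m S)) p :
  zz_diag (f - g) p = zz_diag f p - zz_diag g p.
Proof.
rewrite /zz_diag; case: ifP => _.
  by rewrite add_lfunE opp_lfunE -scaleN1r addrC cfL mulN1r addrC.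
by rewrite add_lfunE opp_lfunE -scaleN1r addrC cfL mulN1r addrC.
Qed.

Lemma zzs_not_null s : s != set0 -> s != setT -> ~ tnull (tid (zzs s)).
Proof.
move=> s0 sT /zz_diag_null h; have [p bp] := zzs_boundary s0 sT.
by have /eqP := h p; rewrite zz_diag_id // oner_eq0.
Qed.

Lemma zzcx_not_Kzero s : s != set0 -> s != setT -> ~ Kzero (zzcx s).
Proof.
by move=> s0 sT /(two_term_Kzero (@zzcx_two_term s)); exact: zzs_not_null.
Qed.

(** The endomorphism [iX pX] is invertible, and [pY] kills it up to homotopy; hence
    [pY] is null-homotopic. *)
Lemma zzcx_complement s (X Y : pcomplex A) (iX : cmap X (zzcx s)) (pX : cmap (zzcx s) X)
    (iY : cmap Y (zzcx s)) (pY : cmap (zzcx s) Y) (p : 'I_n.+2) :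
    chain_map iX -> chain_map pX -> chain_map iY -> chain_map pY ->
    homotopic (cmap_comp pY iY) (@cmap_id _ _ Y) -> null_homotopic (cmap_comp pY iX) ->
    boundary m (setp s) p ->
    zz_diag (crestr (cmap_comp iX pX) : tmor (zzs s) (zzs s)) p != 0 ->
  Kzero Y.
Proof.
move=> ciX cpX ciY cpY e0 e1 bp nz.
pose e : cmap (zzcx s) (zzcx s) := cmap_comp iX pX.
have ce : chain_map e by exact: chain_map_comp.
have [g [cg _ eg]] := zz_unit (crestr_chain ce : tchain (crestr e : tmor (zzs s) (zzs s))) bp nz.
pose G : cmap (zzcx s) (zzcx s) := cext (g : tmor (tc (zzcx s)) (tc (zzcx s))).
have cG : chain_map G.
  apply: cext_chain; [exact: zzcx_two_term|exact: zzcx_two_term|exact: cg].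
apply: (Kzero_retract ciY e0).
have : null_homotopic (cmap_comp (cmap_comp (cmap_comp pY iX) pX) G).
  by apply: nullh_compr => //; apply: nullh_compr.
apply: nullh_ext => i.
have eG : (e i \o G i)%VF = \1%VF.
  case: (degreeP i) => [| |k n1 n0].
  - exact: (congr1 fst eg).
  - exact: (congr1 snd eg).
  rewrite [LHS](two_term_source (T := zzcx s)) //; last exact: zzcx_two_term.
  by rewrite [RHS](two_term_source (T := zzcx s)) //; exact: zzcx_two_term.
by rewrite /cmap_comp -[RHS]comp_lfun1r -eG /e /cmap_comp !comp_lfunA.
Qed.

(** The diagonal coefficients of the two projections add up to 1, so that one of them
    is not zero. *)
Lemma zzcx_Kindec s : s != set0 -> s != setT -> Kindec (zzcx s).
Proof.
move=> s0 sT; split; first exact: zzcx_not_Kzero.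
move=> X Y [iX [iY [pX [pY [[ciX ciY cpX cpY] [eX eY eXY eYX eT]]]]]].
have [p bp] := zzs_boundary s0 sT.
pose fX : tmor (zzs s) (zzs s) := crestr (cmap_comp iX pX).
pose fY : tmor (zzs s) (zzs s) := crestr (cmap_comp iY pY).
have sum1 : zz_diag fX p + zz_diag fY p = 1.
  have /(two_term_nullh _ (@zzcx_two_term s) (@zzcx_two_term s)) h := eT.
  have h' : @tnull _ _ (zzs s) (zzs s) (fX - (tid (zzs s) - fY)).
    rewrite opprB addrA; exact: h.
  have := zz_diag_null p h'.
  by rewrite !zz_diagB zz_diag_id // opprB addrA => /eqP; rewrite subr_eq0 => /eqP.
have [zX|nX] := eqVneq (zz_diag fX p) 0; last first.
  by right; apply: (@zzcx_complement s X Y iX pX iY pY p).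
left; apply: (@zzcx_complement s Y X iY pY iX pX p) => //.
by rewrite zX add0r in sum1; rewrite -/fY sum1 oner_neq0.
Qed.

(** A generator of a term survives in the top of the composite, hence comes from a
    generator of the other complex at the same vertex. *)
Lemma zigzag_labels (S T : pred nat) (f : tmor (zigzag K m S) (zigzag K m T))
    (g : tmor (zigzag K m T) (zigzag K m S)) : tchain f -> tchain g ->
    (forall z : fproj K m (lab_in S), g.1 (f.1 z) - z \in jrad (fproj K m (lab_in S))) ->
    (forall z : fproj K m (lab_out S), g.2 (f.2 z) - z \in jrad (fproj K m (lab_out S))) ->
  forall k, (0 < k <= n)%N -> (entry S k -> entry T k) /\ (exit S k -> exit T k).
Proof.
move=> [f1 f2 _] [g1 g2 _] h1 h2 k hk; have kn : (k < n.+2)%N by nlia.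
pose k' : 'I_n.+2 := Ordinal kn; split=> sk.
  have vk : valid m (lab_in S) k' 0 0 by rewrite /valid /lab_in /= sk; nlia.
  have [j] := @top_label K m _ _ _ _ f.1 g.1 k' f1 g1 vk (h1 _).
  by rewrite /lab_in /= sk; case: ifP => [ej <- //|_ e]; move: hk; rewrite -e.
have vk : valid m (lab_out S) k' 0 0 by rewrite /valid /lab_out /= sk; nlia.
have [j] := @top_label K m _ _ _ _ f.2 g.2 k' f2 g2 vk (h2 _).
by rewrite /lab_out /= sk; case: ifP => [ej <- //|_ e]; move: hk; rewrite -e.
Qed.

Lemma setp_inj s t : (forall k, (k <= n)%N -> setp s k = setp t k) -> s = t.
Proof.
move=> h; apply/setP => i; have := h i; rewrite -ltnS ltn_ord => /(_ isT).
by rewrite /setp inord_val -ltnS ltn_ord.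
Qed.

Lemma tnull_jrad (S : pred nat) (f : tmor (zigzag K m S) (zigzag K m S)) : tnull f ->
  (forall z, f.1 z \in jrad (fproj K m (lab_in S))) /\
  (forall z, f.2 z \in jrad (fproj K m (lab_out S))).
Proof.
move=> [h hh ->]; split=> z /=; rewrite comp_lfunE; last exact: zz_diff_rad.
by apply: rad_hom => //; apply: zz_diff_rad.
Qed.

(** The boundary of a proper nonempty set determines it, and it is read off
    from the tops of the two terms. *)
Lemma zigzag_eq s t (f : tmor (zzs s) (zzs t)) (g : tmor (zzs t) (zzs s)) :
    s != set0 -> s != setT -> tchain f -> tchain g ->
    (forall z : fproj K m (lab_in (setp s)), g.1 (f.1 z) - z \in jrad (fproj K m (lab_in (setp s)))) ->
    (forall z : fproj K m (lab_out (setp s)), g.2 (f.2 z) - z \in jrad (fproj K m (lab_out (setp s)))) ->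
    (forall z : fproj K m (lab_in (setp t)), f.1 (g.1 z) - z \in jrad (fproj K m (lab_in (setp t)))) ->
    (forall z : fproj K m (lab_out (setp t)), f.2 (g.2 z) - z \in jrad (fproj K m (lab_out (setp t)))) ->
  s = t.
Proof.
move=> s0 sT cf_ cg h1 h2 h3 h4; have [e1 e2] := setp_proper s0 sT.
apply: setp_inj; apply: boundary_determines e1 e2 _ => k hk.
have [c1 c2] := zigzag_labels cf_ cg h1 h2 hk; have [c3 c4] := zigzag_labels cg cf_ h3 h4 hk.
by split; apply/idP/idP.
Qed.

Lemma zigzag_inj s t (f : tmor (zzs s) (zzs t)) (g : tmor (zzs t) (zzs s)) :
    s != set0 -> s != setT -> tchain f -> tchain g ->
    tnull (tcomp g f - tid _) -> tnull (tcomp f g - tid _) -> s = t.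
Proof.
move=> s0 sT cf_ cg gf fg.
have [a1 a2] := tnull_jrad gf; have [b1 b2] := tnull_jrad fg.
apply: (zigzag_eq s0 sT cf_ cg) => z.
- by have := a1 z; rewrite /= add_lfunE opp_lfunE id_lfunE comp_lfunE; apply.
- by have := a2 z; rewrite /= add_lfunE opp_lfunE id_lfunE comp_lfunE; apply.
- by have := b1 z; rewrite /= add_lfunE opp_lfunE id_lfunE comp_lfunE; apply.
- by have := b2 z; rewrite /= add_lfunE opp_lfunE id_lfunE comp_lfunE; apply.
Qed.

Lemma zzcx_inj s t : s != set0 -> s != setT -> Kiso (zzcx s) (zzcx t) -> s = t.
Proof.
move=> s0 sT [f [g [cf_ cg gf fg]]].
have tf := crestr_chain cf_; have tg := crestr_chain cg.
have /(two_term_nullh _ (@zzcx_two_term s) (@zzcx_two_term s)) h1 := gf.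
have /(two_term_nullh _ (@zzcx_two_term t) (@zzcx_two_term t)) h2 := fg.
exact: (@zigzag_inj s t (crestr f) (crestr g) s0 sT tf tg h1 h2).
Qed.

Lemma presilting_zigzag (T : pcomplex A) : two_term T -> presilting T -> Kindec T ->
  exists2 s, s != set0 /\ s != setT & Kiso (zzcx s) T.
Proof.
move=> hT pT iT; have rT := (two_term_presilting hT).1 pT.
have nT : ~ tnull (tid (tc T)) by move=> h; apply: iT.1; apply/(two_term_Kzero hT).
have [s [s0 sT [i [p [ci cp pi]]]]] :=
  @zigzag_summand K m (tc T) (@cterm_proj _ _ T _) (@cterm_proj _ _ T _) rT nT.
exists s => //.
pose i' : tmor (tc (zzcx s)) (tc T) := i; pose p' : tmor (tc T) (tc (zzcx s)) := p.
apply: (@Kindec_retract _ _ T (zzcx s) (cext i') (cext p')) => //.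
- by apply: cext_chain => //; exact: zzcx_two_term.
- by apply: cext_chain => //; exact: zzcx_two_term.
- move=> k; case: (degreeP k) => [| |l n1 n0].
  + exact: (congr1 fst pi).
  + exact: (congr1 snd pi).
  rewrite [LHS](two_term_source (T := zzcx s)) //; last exact: zzcx_two_term.
  by rewrite [RHS](two_term_source (T := zzcx s)) //; exact: zzcx_two_term.
exact: zzcx_not_Kzero.
Qed.
End Presilting.

(** * The Auslander-Reiten translate *)

Section Translate.
Variables (K : fieldType) (A : algType K).
Implicit Types (M N P : rmod A) (L : leftmod A).

Lemma surj_factor P M N (g : 'Hom(P, M)) (h : 'Hom(P, N)) : rhom g -> rhom h ->
    limg g = fullv -> (lker g <= lker h)%VS ->
  exists2 k : 'Hom(M, N), rhom k & (k \o g)%VF = h.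
Proof.
move=> hg hh sj le; have gK y : g (g^-1%VF y) = y by apply: limg_lfunVK; rewrite sj memvf.
have key x : h (g^-1%VF (g x)) = h x.
  apply/eqP; rewrite -subr_eq0 -linearB -memv_ker; apply: (subvP le).
  by rewrite memv_ker linearB /= gK subrr.
exists (h \o g^-1)%VF; last by apply/lfunP => x; rewrite !comp_lfunE key.
by move=> a y; rewrite !comp_lfunE -{1}(gK y) -hg key hh.
Qed.

Lemma functional_ex (V : vectType K) (y : V) : y != 0 -> exists f : 'Hom(V, K^o), f y != 0.
Proof.
move=> y0; apply: contrapT => no.
case/eqP: y0; rewrite (coord_vbasis (memvf y)) big1 // => i _.
have [->|nz] := eqVneq (coord (vbasis fullv) i y) 0; first by rewrite scale0r.
case: no; exists (linfun (coord (vbasis fullv) i : V -> K^o)).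
by rewrite linfun_linE // => k a b; rewrite linearP.
Qed.

Section Pairing.
Variables (P M : rmod A).

Definition rank1 (w : M) (u : P -> A) : 'Hom(P, M) := linfun (fun x => ract M (u x) w).
Lemma rank1E w u x : rform u -> rank1 w u x = ract M (u x) w.
Proof. by move=> [ul _]; rewrite linfun_linE // => k a b; rewrite ul ractD ractZ. Qed.
Lemma rank1_hom w u : rform u -> rhom (rank1 w u).
Proof. by move=> fu a x; rewrite !rank1E // fu.2 ractMx. Qed.

Definition dual_basis_of (I : finType) (p : I -> P) (u : I -> P -> A) : Prop :=
  (forall i, rform (u i)) /\ forall x, x = \sum_i ract P (u i x) (p i).

(** The maps of rank one span the homomorphisms from a module with a dual basis. *)
Lemma dual_basis_expand (I : finType) (p : I -> P) (u : I -> P -> A) (h : 'Hom(P, M)) :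
  rhom h -> dual_basis_of p u -> h = \sum_i rank1 (h (p i)) (u i).
Proof.
move=> hh [fu e]; apply/lfunP => x; rewrite sum_lfunE {1}(e x) linear_sum.
by apply: eq_bigr => i _; rewrite rank1E //= hh.
Qed.
End Pairing.

Lemma rformL (P : rmod A) k (u v : P -> A) : rform u -> rform v ->
  rform (fun x => k *: u x + v x).
Proof.
move=> [ul ua] [vl va]; split=> [c x y|a x]; last by rewrite ua va mulrDl scalerAl.
by rewrite ul vl !scalerDr !scalerA addrACA mulrC.
Qed.
Lemma rform_mul (P : rmod A) a (u : P -> A) : rform u -> rform (fun x => a * u x).
Proof.
move=> [ul ua]; split=> [c x y|b x]; last by rewrite ua mulrA.
by rewrite ul mulrDr scalerAr.
Qed.
Lemma rform_comp (P Q : rmod A) (f : 'Hom(P, Q)) (u : Q -> A) : rhom f -> rform u ->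
  rform (fun x => u (f x)).
Proof. by move=> hf [ul ua]; split=> [c x y|a x]; rewrite ?linearP ?ul // hf ua. Qed.

Section Cokernel.
Variables (P1 P0 M : rmod A) (f : 'Hom(P1, P0)) (L : leftmod A) (c : (P1 -> A) -> L).
Hypotheses (hf : rhom f)
  (cL : forall k u v, rform u -> rform v -> c (fun x => k *: u x + v x) = k *: c u + c v)
  (cM : forall a u, rform u -> c (fun x => a * u x) = lact L a (c u))
  (cS : forall y, exists2 u, rform u & c u = y)
  (c0 : forall u, rform u -> (c u = 0 <-> exists2 w : P0 -> A, rform w & u = w \o f)).
Variables (I1 I0 : finType) (q1 : I1 -> P1) (u1 : I1 -> P1 -> A)
  (q0 : I0 -> P0) (u0 : I0 -> P0 -> A).
Hypotheses (db1 : dual_basis_of q1 u1) (db0 : dual_basis_of q0 u0).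

(** A functional [xi] on [Hom (P1, M)] that vanishes on the maps factoring through
    [f] gives the homomorphism [w |-> (c u |-> xi (rank1 w u))] from [M] to the dual of
    [L]. If all of these are zero, so is [xi], because the maps of rank one span;
    and a subspace killed by no nonzero functional is the whole space. *)
Lemma hom_zero_factor : hom_zero M (dualmod L) ->
  forall h : 'Hom(P1, M), rhom h -> exists2 k : 'Hom(P0, M), rhom k & h = (k \o f)%VF.
Proof.
move=> hz h hh.
have [W WP] : exists W : {vspace 'Hom(P1, M)}, forall g,
    g \in W <-> exists2 k : 'Hom(P0, M), rhom k & g = (k \o f)%VF.
  apply: vspace_of_pred => [|k x y [x' hx ->] [y' hy ->]].
    by exists 0; [exact: rhom0|rewrite comp_lfun0l].
  by exists (k *: x' + y'); [apply: rhomD => //; apply: rhomZ|rewrite comp_lfunDl comp_lfunZl].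
apply/WP; rewrite -vquo_eq0; apply/eqP; apply: contrapT => /eqP /functional_ex [z nz].
pose xi (g : 'Hom(P1, M)) : K := z (vquo W g).
have xiL k g g' : xi (k *: g + g') = k * xi g + xi g' by rewrite /xi !linearP.
have xi_eq w u v : rform u -> rform v -> c u = c v -> xi (rank1 w u) = xi (rank1 w v).
  move=> fu fv e; have fd : rform (fun x => -1 *: v x + u x) by exact: rformL.
  have [w' fw' ew] : exists2 w' : P0 -> A, rform w' & (fun x => -1 *: v x + u x) = w' \o f.
    by apply/c0 => //; rewrite cL // e scaleN1r addNr.
  have : xi (rank1 w (fun x => -1 *: v x + u x)) = 0.
    have -> : rank1 w (fun x => -1 *: v x + u x) = (rank1 w w' \o f)%VF.
      apply/lfunP => x; rewrite comp_lfunE !rank1E //.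
      by have := congr1 (fun F => F x) ew; rewrite /= => ->.
    have /eqP e0 : vquo W (rank1 w w' \o f)%VF == 0.
      by rewrite vquo_eq0; apply/WP; exists (rank1 w w') => //; exact: rank1_hom.
    by rewrite /xi e0 linear0.
  have -> : rank1 w (fun x => -1 *: v x + u x) = -1 *: rank1 w v + rank1 w u.
    by apply/lfunP => x; rewrite add_lfunE scale_lfunE !rank1E // ractD ractZ.
  by rewrite xiL mulN1r addrC => /eqP; rewrite subr_eq0 => /eqP.
have [s sP] := choice (fun y => let: ex_intro2 u fu e := cS y in
  ex_intro (fun u => rform u /\ c u = y) u (conj fu e)).
have philin (w : M) : linear (fun l => xi (rank1 w (s l)) : K^o).
  move=> k l l'; have [f1 e1] := sP l; have [f2 e2] := sP l'; have [f3 e3] := sP (k *: l + l').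
  rewrite (@xi_eq w _ (fun x => k *: s l x + s l' x)) //; last 1 first.
  - by rewrite cL // e1 e2.
  - have -> : rank1 w (fun x => k *: s l x + s l' x) = k *: rank1 w (s l) + rank1 w (s l').
      by apply/lfunP => x; rewrite add_lfunE scale_lfunE !rank1E // ?ractD ?ractZ //; exact: rformL.
    exact: xiL.
  - exact: rformL.
pose phi1 (w : M) : 'Hom(L, K^o) := linfun (fun l => xi (rank1 w (s l)) : K^o).
have phi1E w l : phi1 w l = xi (rank1 w (s l)) by rewrite linfun_linE.
have phi1L : linear phi1.
  move=> k w w'; apply/lfunP => l; rewrite add_lfunE scale_lfunE !phi1E.
  have [f1 _] := sP l; rewrite -[X in _ = X]xiL; congr xi.
  by apply/lfunP => x; rewrite add_lfunE scale_lfunE !rank1E // linearP.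
pose phi : 'Hom(M, dualmod L) := linfun phi1.
have phiE w : phi w = phi1 w by rewrite linfun_linE.
have hphi : rhom phi.
  move=> a w; rewrite !phiE /= [RHS]dual_actE; apply/lfunP => l; rewrite comp_lfunE !phi1E.
  have [f1 e1] := sP l; have [f2 e2] := sP (lact L a l).
  rewrite (@xi_eq w _ (fun x => a * s l x)) //; last 1 first.
  - by rewrite cM // e1.
  - by congr xi; apply/lfunP => x; rewrite !rank1E ?ractMx //; exact: rform_mul.
  - exact: rform_mul.
have phi0 := hz phi hphi.
have xi0 w u : rform u -> xi (rank1 w u) = 0.
  move=> fu; have [f1 e1] := sP (c u); rewrite (@xi_eq w u (s (c u))) //.
  by rewrite -phi1E -phiE phi0 zero_lfunE [LHS]zero_lfunE.
case/eqP: nz; rewrite -/(xi h) (dual_basis_expand hh db1) /xi !linear_sum big1 // => i _.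
exact: (xi0 _ _ (db1.1 i)).
Qed.

(** The converse construction: [phi] defines the functional [Xi] below, the trace of
    [phi] against a map [P1 -> M], which on [rank1 w u] is the value of [phi w] at
    [c u]. It kills the maps that factor through [f], and these are all. *)
Lemma factor_hom_zero :
  (forall h : 'Hom(P1, M), rhom h -> exists2 k : 'Hom(P0, M), rhom k & h = (k \o f)%VF) ->
  hom_zero M (dualmod L).
Proof.
move=> fac phi hphi; apply/lfunP => w; rewrite zero_lfunE; apply/lfunP => l.
rewrite [RHS]zero_lfunE; have [u fu <-] := cS l.
have cform0 (w' : M) (v : P0 -> A) : rform v -> (phi w' : 'Hom(L, K^o)) (c (fun x => v (f x))) = 0.
  move=> fv; have -> : c (fun x => v (f x)) = 0; last by rewrite linear0.
  by apply/c0; [exact: rform_comp|exists v].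
have bal (w' : M) a v : rform v ->
    (phi (ract M a w') : 'Hom(L, K^o)) (c v) = (phi w' : 'Hom(L, K^o)) (c (fun x => a * v x)).
  by move=> fv; rewrite hphi /= [ract (dualmod L) a _]dual_actE comp_lfunE cM.
have c00 : c (fun=> 0) = 0.
  apply/c0; first by split=> [k x y|a x]; rewrite ?scaler0 ?addr0 ?mul0r.
  by exists (fun=> 0) => //; split=> [k x y|a x]; rewrite ?scaler0 ?addr0 ?mul0r.
have csum (I : finType) (v : I -> P1 -> A) : (forall i, rform (v i)) ->
    c (fun x => \sum_i v i x) = \sum_i c (v i).
  move=> fv; have gen (r : seq I) : rform (fun x => \sum_(i <- r) v i x) /\
      c (fun x => \sum_(i <- r) v i x) = \sum_(i <- r) c (v i).
    elim: r => [|i r [IH1 IH2]].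
      have -> : (fun x => \sum_(i <- [::]) v i x) = (fun=> 0) by apply: funext => x; rewrite big_nil.
      by rewrite big_nil c00; split=> //; split=> [k x y|a x]; rewrite ?scaler0 ?addr0 ?mul0r.
    have -> : (fun x => \sum_(i <- i :: r) v i x) = (fun x => 1 *: v i x + \sum_(i <- r) v i x).
      by apply: funext => x; rewrite big_cons scale1r.
    by split; [exact: rformL|rewrite cL // IH2 big_cons scale1r].
  exact: (gen (index_enum I)).2.
(* a map of rank one, seen both on P1 and, after factoring, on P0 *)
have [k hk ek] := fac _ (@rank1_hom P1 M w u fu).
pose Xi (g : 'Hom(P1, M)) : K := \sum_i (phi (g (q1 i)) : 'Hom(L, K^o)) (c (u1 i)).
have eu : u = fun x => \sum_i u (q1 i) * u1 i x.
  apply: funext => x; rewrite {1}(db1.2 x).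
  have [ul ua] := fu.
  have us (r : seq I1) : u (\sum_(i <- r) ract P1 (u1 i x) (q1 i)) = \sum_(i <- r) u (q1 i) * u1 i x.
    elim: r => [|i r IH]; last by rewrite !big_cons -{1}(scale1r (ract _ _ _)) ul scale1r IH ua.
    by rewrite !big_nil; have := ua 0 0; rewrite mulr0 linear0.
  exact: us.
have Xi1 : (phi w : 'Hom(L, K^o)) (c u) = Xi (rank1 w u).
  rewrite {1}eu csum => [|i]; last by apply: rform_mul; exact: db1.1.
  rewrite linear_sum; apply: eq_bigr => i _ /=; rewrite -bal ?rank1E //; exact: db1.1.
rewrite Xi1 ek (dual_basis_expand hk db0) comp_lfun_suml.
have Xi0 (w' : M) (v : P0 -> A) : rform v -> Xi (rank1 w' v \o f)%VF = 0.
  move=> fv; have fvf := rform_comp hf fv.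
  have -> : (rank1 w' v \o f)%VF = rank1 w' (fun x => v (f x)).
    by apply/lfunP => x; rewrite comp_lfunE !rank1E.
  rewrite -(cform0 w' v fv).
  have ev : (fun x => v (f x)) = fun x => \sum_i v (f (q1 i)) * u1 i x.
    apply: funext => x; rewrite {1}(db1.2 x) linear_sum.
    have [vl va] := fv.
    have us (r : seq I1) : v (\sum_(i <- r) f (ract P1 (u1 i x) (q1 i))) =
        \sum_(i <- r) v (f (q1 i)) * u1 i x.
      elim: r => [|i r IH]; last by rewrite !big_cons -{1}(scale1r (f _)) vl scale1r IH hf va.
      by rewrite !big_nil; have := va 0 0; rewrite mulr0 linear0.
    exact: us.
  rewrite {2}ev csum => [|i]; last by apply: rform_mul; exact: db1.1.
  rewrite linear_sum; apply: eq_bigr => i _ /=; rewrite -bal ?rank1E //; exact: db1.1.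
have XiD (g g' : 'Hom(P1, M)) : Xi (g + g') = Xi g + Xi g'.
  rewrite /Xi -big_split; apply: eq_bigr => i _ /=; rewrite add_lfunE linearD.
  exact: (add_lfunE (phi (g (q1 i)) : 'Hom(L, K^o)) (phi (g' (q1 i))) (c (u1 i))).
have Xi00 : Xi 0 = 0 by apply: (addrI (Xi 0)); rewrite -XiD !addr0.
elim/big_rec: _ => [|j y _ IH]; first exact: Xi00.
by rewrite XiD IH addr0; exact: (Xi0 _ _ (db0.1 j)).
Qed.
End Cokernel.
End Translate.

(** * Existence of transposes *)

(** When the regular module is finite-dimensional, forms on [P] are homomorphisms from
    [P] to it; so the cokernel of [Hom (f, A)] is a quotient of a finite-dimensional
    space, and left multiplications act on it. *)
Section TransposeExists.
Variables (K : fieldType) (A : algType K) (AA : rmod A) (theta : A -> AA) (eta : AA -> A).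
Hypotheses (thetaL : linear theta) (thetaK : cancel theta eta) (etaK : cancel eta theta)
  (theta_act : forall a b, theta (a * b) = ract AA b (theta a)).

Let etaL : linear eta.
Proof. by move=> k x y; apply: (can_inj thetaK); rewrite etaK thetaL !etaK. Qed.
Let eta_act a z : eta (ract AA a z) = eta z * a.
Proof. by apply: (can_inj thetaK); rewrite etaK theta_act etaK. Qed.

Definition lmulr (a : A) : 'End(AA) := linfun (fun z => theta (a * eta z)).
Lemma lmulrE a z : lmulr a z = theta (a * eta z).
Proof. by rewrite linfun_linE // => k x y; rewrite etaL mulrDr -scalerAr thetaL. Qed.
Lemma lmulr_hom a : rhom (lmulr a).
Proof. by move=> b z; rewrite !lmulrE eta_act mulrA theta_act. Qed.

Definition form_hom (P : rmod A) (u : P -> A) : 'Hom(P, AA) := linfun (fun x => theta (u x)).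
Lemma form_homE (P : rmod A) (u : P -> A) x : rform u -> form_hom u x = theta (u x).
Proof. by move=> [ul _]; rewrite linfun_linE // => k y z; rewrite ul thetaL. Qed.
Lemma form_hom_hom (P : rmod A) (u : P -> A) : rform u -> rhom (form_hom u).
Proof. by move=> fu a x; rewrite !form_homE // fu.2 theta_act. Qed.
Lemma hom_form (P : rmod A) (g : 'Hom(P, AA)) : rhom g -> rform (fun x => eta (g x)).
Proof. by move=> hg; split=> [k x y|a x]; rewrite ?linearP ?etaL // hg eta_act. Qed.

Variables (P1 P0 : rmod A) (f : 'Hom(P1, P0)).
Hypothesis hf : rhom f.

Lemma transpose_exists : exists (L : leftmod A) (c : (P1 -> A) -> L),
  [/\ forall k u v, rform u -> rform v ->
          c (fun x => k *: u x + v x) = k *: c u + c v,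
        forall a u, rform u -> c (fun x => a * u x) = lact L a (c u),
        forall y, exists2 u, rform u & c u = y
      & forall u, rform u ->
          (c u = 0 <-> exists2 w : P0 -> A, rform w & u = w \o f)].
Proof.
have [D DP] : exists D : {vspace 'Hom(P1, AA)}, forall g, g \in D <-> rhom g.
  by apply: vspace_of_pred => [|k x y hx hy]; [exact: rhom0|apply: rhomD => //; exact: rhomZ].
pose V := subvs_of D; have vh (w : V) : rhom (vsval w) by apply/DP; exact: subvsP.
have [W WP] : exists W : {vspace V}, forall w, w \in W <->
    exists2 g : 'Hom(P0, AA), rhom g & vsval w = (g \o f)%VF.
  apply: vspace_of_pred => [|k x y [x' hx ex] [y' hy ey]].
    by exists 0; [exact: rhom0|rewrite comp_lfun0l].
  exists (k *: x' + y'); first by apply: rhomD => //; exact: rhomZ.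
  by rewrite linearP /= ex ey comp_lfunDl comp_lfunZl.
pose act a (w : V) : V := vsproj D (lmulr a \o vsval w)%VF.
have vact a w : vsval (act a w) = (lmulr a \o vsval w)%VF.
  by rewrite vsprojK //; apply/DP; apply: rhom_comp => //; exact: lmulr_hom.
have actL a : linear (act a).
  by move=> k x y; apply: val_inj; rewrite /= vact !linearP /= !vact comp_lfunDr comp_lfunZr.
have actW a w : w \in W -> act a w \in W.
  move=> /WP [g hg e]; apply/WP; exists (lmulr a \o g)%VF; last by rewrite vact e comp_lfunA.
  by apply: rhom_comp => //; exact: lmulr_hom.
pose LS : vectType K := vquo_space W.
pose qact a (l : LS) : LS := vquo W (act a (vlift W l)).
have qactE a w : qact a (vquo W w) = vquo W (act a w).
  apply/eqP; rewrite /qact -subr_eq0 -linearB /= vquo_eq0.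
  have -> : act a (vlift W (vquo W w)) - act a w = act a (vlift W (vquo W w) - w).
    by rewrite addrC -scaleN1r -actL scaleN1r addrC.
  exact/actW/vquo_lift.
have qactL a : linear (qact a) by move=> k x y; rewrite /qact linearP actL linearP.
pose la a : 'End(LS) := linfun (qact a).
have laE a w : la a (vquo W w) = vquo W (act a w) by rewrite linfun_linE.
have lext (F G : 'End(LS)) : (forall w, F (vquo W w) = G (vquo W w)) -> F = G.
  by move=> e; apply/lfunP => l; rewrite -[l]vquoK.
have laL : linear la.
  move=> k a b; apply: lext => w; rewrite add_lfunE scale_lfunE !laE -linearP; congr (vquo W _).
  apply: val_inj; rewrite /= !vact; apply/lfunP => x.
  by rewrite add_lfunE scale_lfunE !comp_lfunE !lmulrE mulrDl -scalerAl thetaL.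
have la1 : la 1 = \1%VF.
  apply: lext => w; rewrite id_lfunE laE; congr (vquo W _).
  by apply: val_inj; rewrite /= vact; apply/lfunP => x; rewrite comp_lfunE lmulrE mul1r etaK.
have laM a b : la (a * b) = (la a \o la b)%VF.
  apply: lext => w; rewrite comp_lfunE !laE; congr (vquo W _).
  by apply: val_inj; rewrite /= !vact; apply/lfunP => x; rewrite !comp_lfunE !lmulrE thetaK mulrA.
pose L := LeftMod laL la1 laM.
pose c (u : P1 -> A) : L := vquo W (vsproj D (form_hom u)).
have vform u : rform u -> vsval (vsproj D (form_hom u)) = form_hom u.
  by move=> fu; rewrite vsprojK //; apply/DP; exact: form_hom_hom.
exists L, c; split.
- move=> k u v fu fv; apply: etrans (linearP (vquo W) k _ _); congr (vquo W _).
  apply: val_inj; rewrite /= !vform //; last exact: (@rformL _ _ _ k u v fu fv).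
  apply/lfunP => x; by rewrite add_lfunE scale_lfunE !form_homE ?thetaL //; exact: (@rformL _ _ _ k u v fu fv).
- move=> a u fu; rewrite /c /= laE; congr (vquo W _).
  apply: val_inj; rewrite /= vact !vform //; last exact: (@rform_mul _ _ _ a u fu).
  by apply/lfunP => x; rewrite comp_lfunE lmulrE !form_homE ?thetaK //; exact: (@rform_mul _ _ _ a u fu).
- move=> y; pose w := vlift W y; exists (fun x => eta (vsval w x)); first exact: (hom_form (vh _)).
  rewrite /c -[RHS]vquoK; congr (vquo W _); apply: val_inj.
  rewrite /= vform; last exact: (hom_form (vh _)).
  by apply/lfunP => x; rewrite form_homE ?etaK //; exact: (hom_form (vh _)).
- move=> u fu; split=> [/eqP|[w fw ->]].
    rewrite vquo_eq0 => /WP [g hg]; rewrite vform // => e.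
    exists (fun x => eta (g x)); first exact: (hom_form hg).
    by apply: funext => x; rewrite /= -[LHS]thetaK -form_homE // e comp_lfunE.
  have fwf := rform_comp hf fw.
  apply/eqP; rewrite vquo_eq0; apply/WP; exists (form_hom w); first exact: form_hom_hom.
  by rewrite vform //; apply/lfunP => x; rewrite comp_lfunE !form_homE.
Qed.
End TransposeExists.

(** * Presentations of tau-rigid modules *)

Section Regular.
Variables (K : fieldType) (m : nat).
Local Notation n := m.+1.
Local Notation A := (preproj K n).
Local Notation ee := (@ee K m).
Implicit Types (M N P : rmod A).

(** The algebra as a right module over itself; it is finite-dimensional because
    the monomials span it. *)
Definition regmod : rmod A := fproj K m (@nat_of_ord n.+1).
Definition to_reg (a : A) : regmod := ract regmod a (\sum_i gen K m (@nat_of_ord n.+1) i).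

Let act (a x : A) : A := x * a.
Let actL a : linear (act a).
Proof. by move=> k x y; rewrite /act mulrDl scalerAl. Qed.
Let act_linear k a b x : act (k *: a + b) x = k *: act a x + act b x.
Proof. by rewrite /act mulrDr scalerAr. Qed.
Let actM a b x : act (a * b) x = act b (act a x).
Proof. by rewrite /act mulrA. Qed.
Let act1 x : act 1 x = x.
Proof. by rewrite /act mulr1. Qed.

Section Forms.
Variables (I : finType) (v : I -> nat) (w : I -> A).
Hypothesis w_ee : forall i, w i * ee (v i) = w i.
Definition form_gen : fproj K m v -> A := umap act w.
Lemma form_gen_form : rform form_gen.
Proof.
split; first exact: umap_linear.
move=> a x; exact: (umap_act actL act_linear actM w_ee).
Qed.
Lemma form_genE i : form_gen (gen K m v i) = w i.
Proof. exact: (umap_gen act_linear actM w_ee (act1 _)). Qed.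
End Forms.

Let reg_ee (i : 'I_n.+1) : ee i * ee i = ee i.
Proof. by rewrite ee_mul eqxx. Qed.
Definition of_reg : regmod -> A := form_gen (fun i : 'I_n.+1 => ee i).

Lemma to_regL : linear to_reg.
Proof. by move=> k a b; rewrite /to_reg ractD ractZ. Qed.
Lemma to_reg_act a b : to_reg (a * b) = ract regmod b (to_reg a).
Proof. exact: ractMx. Qed.
Lemma to_regK : cancel to_reg of_reg.
Proof.
have [ul ua] := form_gen_form reg_ee; move=> a; rewrite /of_reg ua.
have -> : form_gen (fun i : 'I_n.+1 => ee i) (\sum_i gen K m (@nat_of_ord n.+1) i) = 1.
  rewrite -ee_sum; elim/big_rec2: _ => [|i y x _ IH].
    by have := ul (-1) 0 0; rewrite scaler0 addr0 scaleN1r addNr.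
  by rewrite -[X in form_gen _ (X + _)]scale1r ul scale1r form_genE ?IH.
by rewrite mul1r.
Qed.
Lemma of_regK : cancel of_reg to_reg.
Proof.
have [ul ua] := form_gen_form reg_ee.
pose F : 'End(regmod) := linfun (to_reg \o of_reg).
have FE z : F z = to_reg (of_reg z).
  by rewrite linfun_linE // => k x y /=; rewrite [of_reg _]ul to_regL.
have hF : rhom F by move=> a z; rewrite !FE [of_reg _]ua to_reg_act.
move=> z; rewrite -FE; have -> : F = \1%VF; last by rewrite id_lfunE.
apply: (@free_hom_eq K m _ (@nat_of_ord n.+1) regmod _ _ hF (@rhom_id _ _ regmod)) => i.
rewrite FE id_lfunE [of_reg _]form_genE // /to_reg linear_sum (bigD1 i) //=.
rewrite [ract _ _ _]gen_ee big1 ?addr0 // => j nji.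
rewrite -[gen K m _ j]gen_ee -ractMx ee_mul ifN ?ract0 //.
Qed.

Lemma fproj_dual_basis (I : finType) (v : I -> nat) :
  exists u, dual_basis_of (gen K m v) u.
Proof.
pose w i j : A := if j == i then ee (v i) else 0.
have w_ee i j : w i j * ee (v j) = w i j.
  by rewrite /w; case: eqP => [->|_]; rewrite ?mul0r // ee_mul eqxx.
pose u i : fproj K m v -> A := form_gen (w i); have fu i : rform (u i) by apply: form_gen_form; exact: w_ee.
exists u; split=> // x.
pose F : 'End(fproj K m v) := \sum_i rank1 (gen K m v i : fproj K m v) (u i).
have hF : rhom F by apply: rhom_sum => i _; exact: rank1_hom.
have -> : \sum_i ract (fproj K m v) (u i x) (gen K m v i) = F x.
  by rewrite sum_lfunE; apply: eq_bigr => i _; rewrite rank1E.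
have -> : F = \1%VF; last by rewrite id_lfunE.
apply: (@free_hom_eq K m _ v (fproj K m v) _ _ hF (@rhom_id _ _ (fproj K m v))) => i.
have uE j k : u j (gen K m v k) = w j k by apply: form_genE; exact: w_ee.
rewrite sum_lfunE id_lfunE (bigD1 i) // big1 => [|j nji]; last first.
  by rewrite (rank1E _ _ (fu j)) uE /w eq_sym (negbTE nji) ract0.
by rewrite (rank1E _ _ (fu i)) uE /w eqxx gen_ee; exact: addr0.
Qed.

(** The label of [(k, c)] is [k] if [c] is less than the multiplicity of the simple at
    [k] in the top of [P], and 0, which is not a vertex, otherwise. *)
Lemma proj_labels P : rproj P -> exists (I : finType) (v : I -> nat), riso (fproj K m v) P.
Proof.
move=> hP; pose N := (\sum_(k < n.+1) topdim P k)%N.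
pose v (p : 'I_n.+1 * 'I_N) : nat := if (p.2 < topdim P p.1)%N then nat_of_ord p.1 else 0%N.
exists ('I_n.+1 * 'I_N)%type, v; apply: proj_of_top => // k hk.
have kn : (k < n.+1)%N by case/andP: hk.
rewrite -(pair_bigA _ (fun i (c : 'I_N) => (v (i, c) == k : nat))) /= (bigD1 (Ordinal kn)) //=.
rewrite [X in (_ + X)%N]big1 ?addn0 => [|i ni].
  under eq_bigr => c _.
    rewrite (_ : (v (Ordinal kn, c) == k) = (c < topdim P k)%N :> nat); last first.
      by rewrite /v /=; case: ifP; rewrite ?eqxx // => _; case: k hk {kn} => [|k].
    over.
  apply: sum_lt_ord; rewrite /N (bigD1 (Ordinal kn)) //=; exact: leq_addr.
rewrite big1 // => c _; rewrite /v /=; case: ifP => _.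
  by apply/eqP; rewrite eqb0; apply: contraNneq ni => e; apply/eqP/val_inj.
by case: k hk {kn ni}.
Qed.

Lemma proj_dual_basis P : rproj P -> exists (I : finType) (p : I -> P) u, dual_basis_of p u.
Proof.
move=> /proj_labels [I [v /riso_inverses [f [g [hf hg gf fg]]]]].
have [u [fu eu]] := fproj_dual_basis v.
exists I, (fun i => f (gen K m v i)), (fun i x => u i (g x)); split=> [i|x].
  exact: rform_comp.
rewrite -[x in LHS]id_lfunE -fg comp_lfunE [in LHS](eu (g x)) linear_sum.
by apply: eq_bigr => i _; rewrite /= hf.
Qed.

(** Both properties concern maps out of [P1], up to those that factor through [f]. A
    map to [P0] is taken to [M] by [g], every map to [M] arises so, and the maps
    to [P0] killed by [g] are those of the form [f v]. *)
Lemma rigid_presentation P1 P0 M (f : 'Hom(P1, P0)) (g : 'Hom(P0, M)) (hf : rhom f) : rhom g ->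
    rproj P1 -> rproj P0 -> limg g = fullv -> limg f = lker g ->
  (forall h : 'Hom(P1, M), rhom h -> exists2 k : 'Hom(P0, M), rhom k & h = (k \o f)%VF)
  <-> trigid (Tcx hf).
Proof.
move=> hg pP1 pP0 sg ex; have gf0 : (g \o f)%VF = 0.
  apply/lfunP => x; rewrite comp_lfunE zero_lfunE; apply/eqP.
  by rewrite -memv_ker -ex memv_img ?memvf.
split=> [fac h hh|rig h hh].
  have [k hk ek] := fac (g \o h)%VF (rhom_comp hg hh).
  have [u hu eu] := pP0 _ _ g k hg hk sg.
  have [|v hv ev] := @proj_lift _ _ _ _ _ f (h - (u \o f))%VF pP1 hf (rhomB hh (rhom_comp hu hf)).
    apply/subvP => _ /memv_imgP [x _ ->]; rewrite ex memv_ker add_lfunE opp_lfunE linearB /=.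
    by rewrite -!comp_lfunE comp_lfunA eu ek subrr.
  by exists v, u; split=> //=; rewrite ev subrK.
have [h' hh' eh] := pP1 _ _ g h hg hh sg.
have [v [u [hv hu e]]] := rig h' hh'.
exists (g \o u)%VF; first exact: rhom_comp.
by rewrite -eh e comp_lfunDr !comp_lfunA gf0 comp_lfun0l add0r.
Qed.

Lemma hom_zero_iso M N N' : riso N N' -> hom_zero M N -> hom_zero M N'.
Proof.
move=> /riso_inverses [f [g [hf hg gf fg]]] hz h hh.
by rewrite -[h]comp_lfun1l -fg -comp_lfunA (hz (g \o h)%VF (rhom_comp hg hh)) comp_lfun0r.
Qed.

Lemma tau_rigid_presentation M : (exists2 N, is_tau M N & hom_zero M N) ->
  exists (P1 P0 : rmod A) (f : 'Hom(P1, P0)) (g : 'Hom(P0, M)) (hf : rhom f),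
    min_proj_presentation f g /\ trigid (Tcx hf).
Proof.
move=> [N [L [P1 [P0 [f [g [c [pres [cL cM cS c0]]]]]]] iN]] hz.
have [[p1 p0 hf hg] [sg ex _ _]] := pres.
have [I1 [q1 [u1 db1]]] := proj_dual_basis p1; have [I0 [q0 [u0 db0]]] := proj_dual_basis p0.
exists P1, P0, f, g, hf; split=> //; apply/(rigid_presentation hf hg p1 p0 sg ex).
exact: (hom_zero_factor cL cM cS c0 db1 (hom_zero_iso iN hz)).
Qed.

Lemma presentation_tau_rigid M P1 P0 (f : 'Hom(P1, P0)) (g : 'Hom(P0, M)) (hf : rhom f) :
    min_proj_presentation f g -> trigid (Tcx hf) ->
  exists2 N, is_tau M N & hom_zero M N.
Proof.
move=> pres rig; have [[p1 p0 _ hg] [sg ex _ _]] := pres.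
have [I1 [q1 [u1 db1]]] := proj_dual_basis p1; have [I0 [q0 [u0 db0]]] := proj_dual_basis p0.
have [L [c [cL cM cS c0]]] := transpose_exists to_regL to_regK of_regK to_reg_act hf.
exists (dualmod L).
  exists L; last exact: riso_refl.
  by exists P1, P0, f, g, c.
apply: (factor_hom_zero hf cL cM cS c0 db1 db0).
exact/(rigid_presentation hf hg p1 p0 sg ex).
Qed.
End Regular.

(** * Classification of the indecomposable tau-rigid pairs *)

Section Retracts.
Variables (K : fieldType) (A : algType K).
Implicit Types (M N : rmod A).

Lemma riso_zero M N : rzero M -> rzero N -> riso M N.
Proof.
move=> zM zN; apply: (@riso_of_inverses _ _ M N 0 0); first exact: rhom0.
  by apply/lfunP => x; rewrite (zM x) !linear0.
by apply/lfunP => x; rewrite (zN x) !linear0.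
Qed.

Lemma rzero_iso M N : riso M N -> rzero M -> rzero N.
Proof. by move=> [f _ [g _ fK]] z y; rewrite -(fK y) (z (g y)) linear0. Qed.

Lemma id_zero M : \1%VF = 0 :> 'End(M) -> rzero M.
Proof. by move=> e x; rewrite -[x]id_lfunE e zero_lfunE. Qed.

Lemma lfun_fullv0 (V W : vectType K) (f : 'Hom(V, W)) : limg f = fullv -> lker f = fullv ->
  forall y : W, y = 0.
Proof.
move=> /surjP sj k y; have [x <-] := sj y; apply/eqP.
by rewrite -memv_ker k memvf.
Qed.

(** For a direct sum decomposition of [M], take [p] to be the projection. *)
Lemma rindec_of_local M : ~ rzero M ->
    (forall p : 'End(M), rhom p -> limg p = fullv \/ limg (\1 - p)%VF = fullv) ->
  rindec M.
Proof.
move=> nz loc; split=> // U V sU sV UV dUV.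
have UVP x : exists2 u, u \in U & exists2 w, w \in V & x = u + w.
  by have := memvf x; rewrite -UV => /memv_addP [u uU [w wV e]]; exists u => //; exists w.
pose p : 'End(M) := daddv_pi U V.
have pE u w : u \in U -> w \in V -> p (u + w) = u.
  move=> uU wV; rewrite linearD /= daddv_pi_id // [daddv_pi _ _ w](_ : _ = 0) ?addr0 //.
  have := daddv_pi_add dUV (_ : w \in (U + V)%VS); rewrite UV memvf => /(_ isT).
  rewrite capvC in dUV; rewrite [daddv_pi V U w]daddv_pi_id // => /eqP.
  by rewrite -subr_eq0 addrK => /eqP.
have hp : rhom p.
  move=> a x; have [u uU [w wV ->]] := UVP x.
  by rewrite pE // linearD pE //; [exact: sU|exact: sV].
have [/surjP sj|/surjP sj] := loc p hp; [right|left]; apply/eqP; rewrite -subv0; apply/subvP => x xV.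
  have xU : x \in U by have [y <-] := sj x; exact: memv_pi.
  by rewrite -dUV memv_cap xU.
have xU : x \in V; last by rewrite -dUV memv_cap xV.
have [y <-] := sj x; have [u uU [w wV ->]] := UVP y.
by rewrite add_lfunE opp_lfunE id_lfunE pE // addrC addKr.
Qed.

(** The image of [i] is a direct summand, with complement the kernel of [p]. *)
Lemma retract_indec M N (i : 'Hom(N, M)) (p : 'Hom(M, N)) : rhom i -> rhom p ->
  (p \o i)%VF = \1%VF -> ~ rzero N -> rindec M -> riso N M.
Proof.
move=> hi hp e nz [_ ind]; have eE y : p (i y) = y by rewrite -comp_lfunE e id_lfunE.
have [||z|z] := ind (limg i) (lker p) (rsubmod_img hi) (rsubmod_ker hp).
- apply/vspaceP => x; rewrite memvf; apply/memv_addP; exists (i (p x)).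
    by apply: memv_img; exact: memvf.
  exists (x - i (p x)); last by rewrite addrC subrK.
  by rewrite memv_ker linearB /= eE subrr.
- apply/eqP; rewrite -subv0; apply/subvP => x; rewrite memv_cap => /andP [/memv_imgP [y _ ->]].
  by rewrite memv_ker eE => /eqP ->; rewrite linear0 mem0v.
- case: nz => y; have : i y \in limg i by apply: memv_img; exact: memvf.
  by rewrite z memv0 -{2}(eE y) => /eqP ->; rewrite linear0.
apply: (@riso_of_inverses _ _ N M i p) => //; apply/lfunP => x; rewrite comp_lfunE id_lfunE.
apply/eqP; rewrite -subr_eq0 -memv0 -z memv_ker linearB /= eE subrr //.
Qed.

Lemma lift_presentation (P1 P0 M Q1 Q0 N : rmod A) (f : 'Hom(P1, P0)) (g : 'Hom(P0, M))
    (f' : 'Hom(Q1, Q0)) (g' : 'Hom(Q0, N)) (phi : 'Hom(M, N)) :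
    rproj P1 -> rproj P0 -> rhom f -> rhom g -> rhom f' -> rhom g' -> rhom phi ->
    limg g' = fullv -> limg f = lker g -> limg f' = lker g' ->
  exists (v : 'Hom(P1, Q1)) (u : 'Hom(P0, Q0)),
  [/\ rhom v, rhom u, (u \o f)%VF = (f' \o v)%VF & (g' \o u)%VF = (phi \o g)%VF].
Proof.
move=> p1 p0 hf hg hf' hg' hphi sg' ex ex'.
have [u hu eu] := p0 _ _ g' (phi \o g)%VF hg' (rhom_comp hphi hg) sg'.
have [|v hv ev] := @proj_lift _ _ _ _ _ f' (u \o f)%VF p1 hf' (rhom_comp hu hf).
  apply/subvP => _ /memv_imgP [x _ ->]; rewrite ex' memv_ker -comp_lfunE comp_lfunA eu.
  have : f x \in lker g by rewrite -ex memv_img ?memvf.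
  by rewrite memv_ker !comp_lfunE => /eqP ->; rewrite linear0.
by exists v, u; split.
Qed.
End Retracts.

Section Pairs.
Variables (K : fieldType) (m : nat).
Local Notation n := m.+1.
Local Notation A := (preproj K n).
Local Notation ee := (@ee K m).
Implicit Types s t : {set 'I_n.+1}.
Local Notation zzs := (zzs K).

Definition has_exit s := [exists p : 'I_n.+2, boundary m (setp s) p && exit (setp s) p].
Local Notation cin s := (fproj K m (@lab_in m (setp s))).
Local Notation cout s := (fproj K m (@lab_out m (setp s))).
Local Notation zd s := (zz_diff K m (setp s)).

Lemma zzs_hom s : rhom (zd s). Proof. exact: zz_diff_hom. Qed.
Arguments zzs_hom : clear implicits.
Definition coker s : rmod A := rquo (rsubmod_img (zzs_hom s)).
Definition coker_proj s : 'Hom(cout s, coker s) := rquo_proj (rsubmod_img (zzs_hom s)).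

(** The pair attached to a two-term presilting complex in general is its cokernel
    with the largest summand of the term in degree -1 that the differential kills; for
    an indecomposable complex one of the two is zero. *)
Definition zzpair s : rmod A * rmod A :=
  if has_exit s then (coker s, zero_mod A) else (zero_mod A, cin s).

Lemma superfluous_rad (M : rmod A) (V : {vspace M}) : (V <= jrad M)%VS -> superfluous V.
Proof.
move=> le U sU e; apply: nakayama => //; apply/eqP; rewrite eqEsubv subvf /= -e.
exact: addvS.
Qed.

Lemma gen_neq0 (I : finType) (v : I -> nat) i : valid m v i 0 0 -> gen K m v i != 0.
Proof.
move=> vi; apply/eqP => /(congr1 (fun z => cf z i 0 0)).
by rewrite cf_gen vi !eqxx cf0 => /eqP; rewrite oner_eq0.
Qed.

Lemma exit_notin (S : pred nat) k : exit S k -> entry S k = false.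
Proof. by rewrite /exit /entry => /andP [/negbTE ->]. Qed.

Lemma no_exit_zero s : ~~ has_exit s -> rzero (cout s).
Proof.
move=> ne; apply: id_zero; apply: fproj_zero => j; apply: contra ne => vj.
apply/existsP; exists j; move: vj; rewrite /valid /boundary /lab_out; case: ifP => //.
by move=> _ /=; rewrite orbT; nlia.
Qed.

Lemma boundary_cases s (p : 'I_n.+2) : boundary m (setp s) p -> ~~ has_exit s -> entry (setp s) p.
Proof.
move=> bp ne; apply: contraNT ne => np; apply/existsP; exists p; rewrite bp /=.
by case/and3P: bp; rewrite (negbTE np).
Qed.

Lemma valid_in (S : pred nat) (p : 'I_n.+2) : boundary m S p -> entry S p -> valid m (lab_in S) p 0 0.
Proof. by move=> /and3P [_ p0 pn] ep; rewrite /valid /lab_in ep addn0 p0. Qed.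
Lemma valid_out (S : pred nat) (p : 'I_n.+2) : boundary m S p -> exit S p -> valid m (lab_out S) p 0 0.
Proof. by move=> /and3P [_ p0 pn] ep; rewrite /valid /lab_out ep addn0 p0. Qed.

(** An element [z] of the kernel with a nonzero coefficient at the generator [i] gives
    a chain endomorphism sending [gen i] to the component of [z] at its vertex, zero in
    degree 0 and on the other generators. Its diagonal coefficient is nonzero at [i] and zero at an exit. *)
Lemma ker_rad s : has_exit s -> (lker (zd s) <= jrad (cin s))%VS.
Proof.
move=> /existsP [p /andP [bp xp]]; apply/subvP => z; rewrite memv_ker => /eqP zz0.
apply: rad_top => i; have [vi|nv] := boolP (valid m (lab_in (setp s)) i 0 0); last exact: cf_out.
have ei : entry (setp s) i by move: vi; rewrite /valid /lab_in; case: ifP.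
have li : lab_in (setp s) i = i by rewrite /lab_in ei.
have bi : boundary m (setp s) i by move: vi; rewrite /valid li addn0 /boundary ei.
have w_ee i' : ract (cin s) (ee (lab_in (setp s) i')) (if i' == i then ract (cin s) (ee i) z else 0)
    = if i' == i then ract (cin s) (ee i) z else 0.
  by case: eqP => [->|_]; rewrite ?linear0 // li ract_ee.
have [v hv ev] := @free_map K m _ (lab_in (setp s)) (cin s)
  (fun i' => if i' == i then ract (cin s) (ee i) z else 0)
  (fun i' => w_ee i').
pose F : tmor (zzs s) (zzs s) := (v, 0).
have cF : tchain F.
  split=> /=; [exact: hv|exact: rhom0|].
  rewrite comp_lfun0l; apply: esym; apply: (free_hom_eq (rhom_comp (zzs_hom s) hv) (@rhom0 _ _ _ _)) => i'.
  rewrite comp_lfunE ev zero_lfunE; case: eqP => _; last by rewrite linear0.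
  by rewrite zzs_hom zz0 linear0.
have := zz_diag_const cF bi bp.
rewrite /zz_diag ei (exit_notin xp) /= zero_lfunE cf0 ev eqxx free_eeE li !addn0 eqxx.
exact.
Qed.

Lemma coker_proj_hom s : rhom (coker_proj s). Proof. exact: rquo_proj_rhom. Qed.
Arguments coker_proj_hom : clear implicits.
Lemma coker_proj_surj s : limg (coker_proj s) = fullv. Proof. exact: rquo_proj_surj. Qed.
Lemma coker_proj_ker s : limg (zd s) = lker (coker_proj s). Proof. by rewrite lker_rquo_proj. Qed.

Lemma img_rad s : (limg (zd s) <= jrad (cout s))%VS.
Proof. by apply/subvP => _ /memv_imgP [z _ ->]; exact: zz_diff_rad. Qed.

Lemma coker_presentation s : has_exit s -> min_proj_presentation (zd s) (coker_proj s).
Proof.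
move=> xs; split; first by split;
  [exact: free_proj|exact: free_proj|exact: zzs_hom|exact: coker_proj_hom].
split; [exact: coker_proj_surj|exact: coker_proj_ker| |].
  by apply: superfluous_rad; exact: ker_rad.
by apply: superfluous_rad; rewrite -coker_proj_ker; exact: img_rad.
Qed.

Lemma coker_nonzero s : has_exit s -> ~ rzero (coker s).
Proof.
move=> /existsP [p /andP [bp xp]] z; have vp := valid_out bp xp.
have : gen K m (lab_out (setp s)) p \in jrad (cout s).
  apply: (subvP (img_rad s)); rewrite coker_proj_ker memv_ker; apply/eqP; exact: z.
move=> /(@top_rad _ _ _ _ _ p); rewrite cf_gen vp !eqxx => /eqP; exact/negP/oner_neq0.
Qed.

Lemma cin_nonzero s : s != set0 -> s != setT -> ~~ has_exit s -> ~ rzero (cin s).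
Proof.
move=> s0 sT ne z; have [p bp] := zzs_boundary s0 sT.
have vp := valid_in bp (boundary_cases bp ne).
by have /eqP := gen_neq0 vp; apply; exact: z.
Qed.

(** The diagonal coefficients of [e] and of [1 - e] add up to 1. *)
Lemma zz_dichotomy s (e : tmor (zzs s) (zzs s)) : s != set0 -> s != setT -> tchain e ->
  exists (b : bool) (e' : tmor (zzs s) (zzs s)), tcomp (if b then e else tid _ - e) e' = tid _.
Proof.
move=> s0 sT ce; have [p bp] := zzs_boundary s0 sT.
have [z|nz] := eqVneq (zz_diag e p) 0; last first.
  by have [e' [_ _ h]] := zz_unit ce bp nz; exists true, e'.
have c1 : tchain (tid (zzs s) - e).
  have [e1 e2 ee'] := ce; split=> /=; try by apply: rhomB => //; exact: rhom_id.
  by rewrite comp_lfunBl comp_lfunBr ee' comp_lfun1l comp_lfun1r.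
have [|e' [_ _ h]] := zz_unit c1 bp; last by exists false, e'.
by rewrite zz_diagB zz_diag_id // z subr0 oner_neq0.
Qed.

(** An endomorphism of the cokernel lifts to the complex, where it or its complement
    to the identity is invertible. *)
Lemma coker_indec s : s != set0 -> s != setT -> has_exit s -> rindec (coker s).
Proof.
move=> s0 sT xs; apply: rindec_of_local; first exact: coker_nonzero.
move=> p hp; have hg := coker_proj_hom s; have sg := coker_proj_surj s.
have ex := coker_proj_ker s.
have [v [u [hv hu e eg]]] := lift_presentation (@free_proj K m _ _) (@free_proj K m _ _)
  (zzs_hom s) hg (zzs_hom s) hg hp sg ex ex.
have [b [e' ee']] := zz_dichotomy s0 sT (And3 hv hu e : tchain ((v, u) : tmor (zzs s) (zzs s))).
have /= e2 := congr1 snd ee'; move/surjP: sg => sg.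
case: b ee' e2 => ee' e2; [left|right]; apply/surjP => y; have [x <-] := sg y.
  exists (coker_proj s (e'.2 x)).
  by rewrite -(comp_lfunE p) -eg comp_lfunE /= -(comp_lfunE u) e2 id_lfunE.
exists (coker_proj s (e'.2 x)).
rewrite add_lfunE opp_lfunE id_lfunE -(comp_lfunE p) -eg comp_lfunE /= -linearB /=.
congr (coker_proj s _); have := congr1 (fun F : 'End(_) => F x) e2.
by rewrite /= !comp_lfunE add_lfunE opp_lfunE !id_lfunE.
Qed.

Lemma cin_indec s : s != set0 -> s != setT -> ~~ has_exit s -> rindec (cin s).
Proof.
move=> s0 sT ne; apply: rindec_of_local; first exact: cin_nonzero.
move=> p hp; have z := no_exit_zero ne.
have ch : tchain ((p, 0) : tmor (zzs s) (zzs s)).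
  split=> /=; [exact: hp|exact: rhom0|].
  by rewrite [LHS](rzero_hom0 _ (or_intror z)) [RHS](rzero_hom0 _ (or_intror z)).
have [b [e' ee']] := zz_dichotomy s0 sT ch.
have /= e1 := congr1 fst ee'.
case: b ee' e1 => ee' e1; [left|right]; apply/surjP => y; exists (e'.1 y).
  by rewrite -(comp_lfunE p) e1 id_lfunE.
have := congr1 (fun F : 'End(_) => F y) e1.
by rewrite /= !comp_lfunE id_lfunE.
Qed.

(** The zero module has the zero presentation. *)
Lemma zero_tau_rigid (P : rmod A) : rproj P -> tau_rigid_pair (zero_mod A, P).
Proof.
move=> hP; have z := @zero_mod_rzero _ A; split=> //=; last first.
  by move=> f _; apply: rzero_hom0; right.
have all0 (V : {vspace zero_mod A}) : V = 0%VS.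
  by apply/eqP; rewrite -subv0; apply/subvP => x _; rewrite (z x) mem0v.
have pz := rproj_zero z.
apply: (@presentation_tau_rigid K m (zero_mod A) (zero_mod A) (zero_mod A) 0 0 (@rhom0 _ _ _ _)).
  split; first by split=> //; exact: rhom0.
  split; try by rewrite [LHS]all0 [RHS]all0.
  - by move=> U _ _; rewrite [LHS]all0 [RHS]all0.
  - by move=> U _ _; rewrite [LHS]all0 [RHS]all0.
move=> h hh; exists 0, 0; split; try exact: rhom0.
by rewrite [LHS](rzero_hom0 _ (or_introl z)) [RHS](rzero_hom0 _ (or_introl z)).
Qed.

Lemma zzpair_tau_rigid s : s != set0 -> s != setT ->
  tau_rigid_pair (zzpair s) /\ indec_pair (zzpair s).
Proof.
move=> s0 sT; rewrite /zzpair; case: ifPn => xs; last first.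
  split; first by apply: zero_tau_rigid; exact: free_proj.
  by right; split; [exact: zero_mod_rzero|exact: cin_indec].
have z := @zero_mod_rzero _ A; split; last by left; split=> //; exact: coker_indec.
split=> /=; first exact: rproj_zero; last by move=> f _; apply: rzero_hom0; left.
exact: (presentation_tau_rigid (coker_presentation xs) (@zzs_rigid K m s)).
Qed.

(** A chain endomorphism that induces the identity on the cokernel differs from the
    identity by a null-homotopic map and a map with values in the kernel of the
    differential; both have values in the radical. *)
Lemma lift_inverse_rad s t (f : tmor (zzs s) (zzs t)) (g : tmor (zzs t) (zzs s)) : has_exit s ->
    tchain f -> tchain g -> (coker_proj s \o (g.2 \o f.2))%VF = coker_proj s ->
  (forall z : cin s, g.1 (f.1 z) - z \in jrad (cin s)) /\
  (forall z : cout s, g.2 (f.2 z) - z \in jrad (cout s)).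
Proof.
move=> xs [f1 f2 ef] [g1 g2 eg] e; pose d := (g.2 \o f.2 - \1)%VF : 'End(cout s).
have hd : rhom d by apply: rhomB; [exact: rhom_comp|exact: rhom_id].
have dE z : g.2 (f.2 z) - z = d z by rewrite add_lfunE opp_lfunE id_lfunE comp_lfunE.
have dker : (limg d <= limg (zd s))%VS.
  apply/subvP => _ /memv_imgP [z _ ->]; rewrite coker_proj_ker memv_ker -dE linearB /=.
  by have /= := congr1 (fun F : 'Hom(_, _) => F z) e; rewrite !comp_lfunE => ->; rewrite subrr.
split=> [z|z]; last first.
  rewrite dE; apply: (subvP (img_rad s)); apply: (subvP dker); exact: memv_img (memvf z).
have [w hw ew] := proj_lift (@free_proj K m _ _) (zzs_hom s) hd dker.
have wf : w (zd s z) \in jrad (cin s) by apply: rad_hom => //; exact: zz_diff_rad.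
rewrite -[X in X \in _](subrK (w (zd s z))); apply: memvD => //.
apply: (subvP (ker_rad xs)); rewrite memv_ker !linearB /= -!(comp_lfunE (zd s)) ew.
rewrite subr_eq0 -dE; apply/eqP; congr (_ - _).
have /= hf_ := congr1 (fun F : 'Hom(_, _) => F z) ef; have /= hg_ := congr1 (fun F : 'Hom(_, _) => F (f.1 z)) eg.
by rewrite !comp_lfunE in hf_ hg_; rewrite hf_ hg_ comp_lfunE.
Qed.

Lemma zzpair_inj s t : s != set0 -> s != setT -> t != set0 -> t != setT ->
  pair_iso (zzpair s) (zzpair t) -> s = t.
Proof.
move=> s0 sT t0 tT []; rewrite /zzpair; have z := @zero_mod_rzero _ A.
case: ifPn => xs; case: ifPn => xt /= i1 i2.
- have [phi [psi [hphi hpsi e1 e2]]] := riso_inverses i1.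
  have [hgs hgt] := (coker_proj_hom s, coker_proj_hom t).
  have [v [u [hv hu e eg]]] := lift_presentation (@free_proj K m _ _) (@free_proj K m _ _)
    (zzs_hom s) hgs (zzs_hom t) hgt hphi (coker_proj_surj t) (coker_proj_ker s) (coker_proj_ker t).
  have [v' [u' [hv' hu' e' eg']]] := lift_presentation (@free_proj K m _ _) (@free_proj K m _ _)
    (zzs_hom t) hgt (zzs_hom s) hgs hpsi (coker_proj_surj s) (coker_proj_ker t) (coker_proj_ker s).
  pose F : tmor (zzs s) (zzs t) := (v, u); pose G : tmor (zzs t) (zzs s) := (v', u').
  have cF : tchain F by []. have cG : tchain G by [].
  have gf : (coker_proj s \o (u' \o u))%VF = coker_proj s.
    by rewrite comp_lfunA eg' -comp_lfunA eg comp_lfunA e1 comp_lfun1l.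
  have fg : (coker_proj t \o (u \o u'))%VF = coker_proj t.
    by rewrite comp_lfunA eg -comp_lfunA eg' comp_lfunA e2 comp_lfun1l.
  have [a1 a2] := @lift_inverse_rad s t F G xs cF cG gf.
  have [b1 b2] := @lift_inverse_rad t s G F xt cG cF fg.
  exact: (zigzag_eq s0 sT cF cG).
- by case: (coker_nonzero xs); apply: rzero_iso (riso_sym i1) z.
- by case: (coker_nonzero xt); apply: rzero_iso i1 z.
have [phi [psi [hphi hpsi e1 e2]]] := riso_inverses i2.
have [zs zt] := (no_exit_zero xs, no_exit_zero xt).
pose F : tmor (zzs s) (zzs t) := (phi, 0); pose G : tmor (zzs t) (zzs s) := (psi, 0).
have cF : tchain F.
  split=> /=; [exact: hphi|exact: rhom0|].
  by rewrite [LHS](rzero_hom0 _ (or_intror zt)) [RHS](rzero_hom0 _ (or_intror zt)).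
have cG : tchain G.
  split=> /=; [exact: hpsi|exact: rhom0|].
  by rewrite [LHS](rzero_hom0 _ (or_intror zs)) [RHS](rzero_hom0 _ (or_intror zs)).
apply: (zigzag_eq s0 sT cF cG) => x /=.
- by rewrite -comp_lfunE e1 id_lfunE subrr mem0v.
- by rewrite [X in X \in _]zs mem0v.
- by rewrite -comp_lfunE e2 id_lfunE subrr mem0v.
- by rewrite [X in X \in _]zt mem0v.
Qed.

(** In either case the pair comes from a rigid complex, a minimal presentation of [M]
    or [Q] alone in degree -1, which contains a zigzag complex; minimality
    excludes the zigzag complexes of the other kind. *)
Lemma zzpair_surj (X : rmod A * rmod A) : tau_rigid_pair X -> indec_pair X ->
  exists2 s, s != set0 /\ s != setT & pair_iso (zzpair s) X.
Proof.
case: X => M Q [/= pQ tM _] [] /= [].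
  move=> iM zQ; have [P1 [P0 [f [g [hf [[[p1 p0 _ hg] [sg ex sf _]] rig]]]]]] := tau_rigid_presentation tM.
  have nT : ~ tnull (tid (Tcx hf)).
    move=> [h hh] /(congr1 snd) /= e; apply: iM.1; apply: (lfun_fullv0 sg).
    apply/vspaceP => x; rewrite memvf -ex -[x]id_lfunE e comp_lfunE memv_img ?memvf //.
  have [s [s0 sT [i [p [[i1 i2 ei] [p1' p2 ep] pi]]]]] := @zigzag_summand K m (Tcx hf) p1 p0 rig nT.
  have /= pi1 := congr1 fst pi; have /= pi2 := congr1 snd pi.
  exists s => //; rewrite /zzpair; case: ifPn => xs; last first.
    have zc := no_exit_zero xs; case: (cin_nonzero s0 sT xs); apply: id_zero.
    (* the summand [cin s] of [P1] would lie in the superfluous kernel of [f] *)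
    rewrite -pi1; have -> : p.1 = 0; last by rewrite comp_lfun0l.
    apply/lfunP => x; rewrite zero_lfunE; apply/eqP; rewrite -memv_ker.
    rewrite (sf (lker p.1) (rsubmod_ker p1')) ?memvf //.
    apply/vspaceP => y; rewrite memvf; apply/memv_addP.
    have pE w : p.1 (i.1 w) = w by rewrite -comp_lfunE pi1 id_lfunE.
    exists (y - i.1 (p.1 y)); first by rewrite memv_ker linearB /= pE subrr.
    exists (i.1 (p.1 y)); last by rewrite subrK.
    have /= ei' := congr1 (fun F : 'Hom(_, _) => F (p.1 y)) ei.
    rewrite memv_ker -comp_lfunE -ei' comp_lfunE.
    by rewrite [zz_diff _ _ _ _]zc linear0.
  split=> /=; last by apply: riso_zero => //; exact: zero_mod_rzero.
  have hq := coker_proj_hom s; have sq := coker_proj_surj s.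
  have la : (lker (coker_proj s) <= lker (g \o i.2)%VF)%VS.
    rewrite -coker_proj_ker; apply/subvP => _ /memv_imgP [x _ ->].
    rewrite memv_ker comp_lfunE -memv_ker -ex.
    have /= h := congr1 (fun F : 'Hom(_, _) => F x) ei; rewrite !comp_lfunE in h.
    rewrite h; exact: memv_img (memvf _).
  have lb : (lker g <= lker (coker_proj s \o p.2)%VF)%VS.
    rewrite -ex; apply/subvP => _ /memv_imgP [x _ ->].
    rewrite memv_ker comp_lfunE -memv_ker -coker_proj_ker.
    have /= h := congr1 (fun F : 'Hom(_, _) => F x) ep; rewrite !comp_lfunE in h.
    rewrite h; exact: memv_img (memvf _).
  have [al hal eal] := surj_factor hq (rhom_comp hg i2) sq la.
  have [be hbe ebe] := surj_factor hg (rhom_comp hq p2) sg lb.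
  apply: (retract_indec hal hbe) => //; last exact: coker_nonzero.
  apply/lfunP => y; move/surjP: sq => /(_ y) [x <-]; rewrite comp_lfunE id_lfunE.
  rewrite -(comp_lfunE al) eal comp_lfunE -(comp_lfunE be) ebe comp_lfunE.
  by rewrite -(comp_lfunE p.2) pi2 id_lfunE.
move=> zM iQ; have z := @zero_mod_rzero _ A.
pose T := Tcx (@rhom0 _ _ Q (zero_mod A)).
have rT : trigid T.
  move=> h hh; exists 0, 0; split; try exact: rhom0.
  by rewrite [LHS](rzero_hom0 _ (or_intror z)) [RHS](rzero_hom0 _ (or_intror z)).
have nT : ~ tnull (tid T).
  by move=> [h hh] /(congr1 fst) /= e; apply: iQ.1; apply: id_zero; rewrite e comp_lfun0r.
have [s [s0 sT [i [p [[i1 i2 ei] [p1 p2 ep] pi]]]]] := @zigzag_summand K m T pQ (rproj_zero z) rT nT.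
have /= pi1 := congr1 fst pi; have /= pi2 := congr1 snd pi.
have ne : ~~ has_exit s.
  apply/negP => /existsP [q /andP [bq xq]]; have /eqP := gen_neq0 (valid_out bq xq); apply.
  rewrite -[LHS]id_lfunE -pi2 (rzero_hom0 i.2) ?comp_lfun0r ?zero_lfunE //; by right.
exists s => //; rewrite /zzpair (negbTE ne); split=> /=; first exact: riso_zero.
apply: (retract_indec i1 p1) => //; exact: cin_nonzero.
Qed.
End Pairs.

(** * Internal simplices of the prism *)

Section PrismSimplices.
Variables (R : realType) (n : nat).
Local Notation point := 'rV[R]_(n.+1 + 2).
Local Notation pa := (@prism_a R n).
Local Notation pb := (@prism_b R n).
Implicit Types (y z : point) (s : {set 'I_n.+1}) (i k : 'I_n.+1).

Definition xc k y : R := y 0 (lshift 2 k).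
Definition ac y : R := y 0 (rshift n.+1 0).
Definition bc y : R := y 0 (rshift n.+1 1).

Lemma xc_a k i : xc k (pa i) = (k == i)%:R.
Proof. by rewrite /xc row_mxEl mxE eqxx. Qed.
Lemma xc_b k i : xc k (pb i) = (k == i)%:R.
Proof. by rewrite /xc row_mxEl mxE eqxx. Qed.
Lemma ac_a i : ac (pa i) = 1. Proof. by rewrite /ac row_mxEr mxE. Qed.
Lemma ac_b i : ac (pb i) = 0. Proof. by rewrite /ac row_mxEr mxE. Qed.
Lemma bc_a i : bc (pa i) = 0. Proof. by rewrite /bc row_mxEr mxE. Qed.
Lemma bc_b i : bc (pb i) = 1. Proof. by rewrite /bc row_mxEr mxE. Qed.

Lemma coord_sum (J : finType) (c : J -> R) (x : J -> point) (k : 'I_(n.+1 + 2)) :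
  (\sum_j c j *: x j) 0 k = \sum_j c j * x j 0 k.
Proof. by rewrite summxE; apply: eq_bigr => j _; rewrite mxE. Qed.
Lemma xc_sum (J : finType) (c : J -> R) (x : J -> point) k :
  xc k (\sum_j c j *: x j) = \sum_j c j * xc k (x j).
Proof. exact: coord_sum. Qed.
Lemma ac_sum (J : finType) (c : J -> R) (x : J -> point) :
  ac (\sum_j c j *: x j) = \sum_j c j * ac (x j).
Proof. exact: coord_sum. Qed.
Lemma bc_sum (J : finType) (c : J -> R) (x : J -> point) :
  bc (\sum_j c j *: x j) = \sum_j c j * bc (x j).
Proof. exact: coord_sum. Qed.

Lemma point_ext y z : (forall k, xc k y = xc k z) -> ac y = ac z -> bc y = bc z -> y = z.
Proof.
move=> ex ea eb; apply/rowP => j; rewrite -[j]splitK; case: (split j) => [k|k] /=; first exact: ex.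
case: k => [[|[|//]] hk].
- by rewrite (_ : Ordinal hk = 0) //; apply: val_inj.
- by rewrite (_ : Ordinal hk = 1) //; apply: val_inj.
Qed.

Lemma vertexP y : prism_vertices y -> exists i, y = pa i \/ y = pb i.
Proof. by case=> -[i _ <-]; exists i; [left|right]. Qed.

Lemma chull_fin (X : set point) (J : finType) (x : J -> point) (c : J -> R) :
  (forall j, X (x j)) -> (forall j, 0 <= c j) -> \sum_j c j = 1 -> chull X (\sum_j c j *: x j).
Proof.
move=> hx hc hs; pose h (j : 'I_#|J|) : J := enum_val j.
have hb : bijective h by exists enum_rank; [exact: enum_valK|exact: enum_rankK].
exists #|J|, (x \o h), (c \o h); split; first by move=> j; exact: hx.
- by move=> j; exact: hc.
- by rewrite -hs [RHS](reindex h) //; exact: onW_bij.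
- by rewrite [LHS](reindex h) //; exact: onW_bij.
Qed.

Lemma sub_chull (X : set point) y : X y -> chull X y.
Proof.
move=> hy; exists 1%N, (fun=> y), (fun=> 1); split.
- by [].
- by move=> _; exact: ler01.
- by rewrite big_ord1.
- by rewrite big_ord1 scale1r.
Qed.

Lemma prism_coords y : prism y ->
  [/\ forall j, 0 <= y 0 j, \sum_k xc k y = 1 & ac y + bc y = 1].
Proof.
move=> [m [x [c [hx hc hs ->]]]]; split=> [j||].
- rewrite coord_sum; apply: sumr_ge0 => i _; apply: mulr_ge0 => //.
  have [k [->|->]] := vertexP (hx i); rewrite mxE; case: split => j'; rewrite mxE ler0n //.
- under eq_bigr do rewrite xc_sum; rewrite exchange_big -[RHS]hs; apply: eq_bigr => i _ /=.
  rewrite -mulr_sumr; have [k [->|->]] := vertexP (hx i).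
    under eq_bigr do rewrite xc_a; rewrite (bigD1 k) //= eqxx big1 ?addr0 ?mulr1 // => j /negbTE ->//.
  under eq_bigr do rewrite xc_b; rewrite (bigD1 k) //= eqxx big1 ?addr0 ?mulr1 // => j /negbTE ->//.
- rewrite ac_sum bc_sum -big_split -[RHS]hs; apply: eq_bigr => i _ /=; rewrite -mulrDr.
  by have [k [->|->]] := vertexP (hx i); rewrite ?ac_a ?bc_a ?ac_b ?bc_b ?addr0 ?add0r mulr1.
Qed.

(** If [x_k], [alpha] and [beta] are the coordinates of [y], the coefficients
    [x_k alpha] of [a_k] and [x_k beta] of [b_k] express it. *)
Lemma coords_prism y :
  (forall j, 0 <= y 0 j) -> \sum_k xc k y = 1 -> ac y + bc y = 1 -> prism y.
Proof.
move=> h0 hx hab.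
pose x (j : 'I_n.+1 * bool) := if j.2 then pa j.1 else pb j.1.
pose c (j : 'I_n.+1 * bool) := xc j.1 y * (if j.2 then ac y else bc y).
have sumP (F : 'I_n.+1 * bool -> R) : \sum_j F j = \sum_k (F (k, true) + F (k, false)).
  transitivity (\sum_j F (j.1, j.2)); first by apply: eq_bigr => -[].
  rewrite -(pair_bigA _ (fun k (b : bool) => F (k, b))); apply: eq_bigr => k _ /=.
  by rewrite big_bool.
have -> : y = \sum_j c j *: x j.
  apply: point_ext => [k||]; rewrite ?xc_sum ?ac_sum ?bc_sum sumP /c /x /=.
  - rewrite (bigD1 k) //= big1 => [|i /negbTE ni]; rewrite xc_a xc_b.
      by rewrite eqxx !mulr1 addr0 -mulrDr hab mulr1.
    by rewrite eq_sym ni !mulr0 addr0.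
  - under eq_bigr do rewrite ac_a ac_b mulr1 mulr0 addr0.
    by rewrite -mulr_suml hx mul1r.
  - under eq_bigr do rewrite bc_a bc_b mulr1 mulr0 add0r.
    by rewrite -mulr_suml hx mul1r.
apply: chull_fin => [[k [|]]|[k b]|]; rewrite /x /c /=.
- by left; exists k.
- by right; exists k.
- by apply: mulr_ge0; [exact: h0|case: b; exact: h0].
- rewrite sumP /=; under eq_bigr do rewrite -mulrDr hab mulr1; exact: hx.
Qed.

Lemma affine_coords y : affine_hull (@prism R n) y -> \sum_k xc k y = 1 /\ ac y + bc y = 1.
Proof.
move=> [m [x [c [hx hs ->]]]]; split.
  under eq_bigr do rewrite xc_sum; rewrite exchange_big -[RHS]hs; apply: eq_bigr => i _ /=.
  by rewrite -mulr_sumr; have [_ -> _] := prism_coords (hx i); rewrite mulr1.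
rewrite ac_sum bc_sum -big_split -[RHS]hs; apply: eq_bigr => i _ /=; rewrite -mulrDr.
by have [_ _ ->] := prism_coords (hx i); rewrite mulr1.
Qed.

(** If a coordinate vanished at [y], moving [y] slightly away from a vertex where that
    coordinate is 1 would make it negative. *)
Lemma interior_pos y : rel_interior (@prism R n) y -> forall j, 0 < y 0 j.
Proof.
move=> [py /nbhs_ballP [e /= e0 ball_prism]] j; have [y0 sx sab] := prism_coords py.
rewrite lt_neqAle y0 andbT; apply/eqP => yj; have {}yj := esym yj.
have [v pv vj] : exists2 v : point, @prism R n v & v 0 j = 1.
  rewrite -[j]splitK; case: (split j) => [k|k] /=.
    by exists (pa k); [apply: sub_chull; left; exists k|rewrite -/(xc k _) xc_a eqxx].
  case: k => [[|[|//]] hk].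
    exists (pa 0); first by apply: sub_chull; left; exists 0.
    by rewrite (_ : Ordinal hk = 0) -/(ac _) ?ac_a //; apply: val_inj.
  exists (pb 0); first by apply: sub_chull; right; exists 0.
  by rewrite (_ : Ordinal hk = 1) -/(bc _) ?bc_b //; apply: val_inj.
pose d := e / 2; have d0 : 0 < d by rewrite divr_gt0.
have de : d < e by rewrite /d; lra.
pose z := (1 + d) *: y + (- d) *: v.
have zE (i : 'I_(n.+1 + 2)) : z 0 i = (1 + d) * y 0 i - d * v 0 i by rewrite !mxE mulNr.
have hz : affine_hull (@prism R n) z.
  exists 2%N, (fun i : 'I_2 => if i == 0 then y else v), (fun i : 'I_2 => if i == 0 then 1 + d else - d).
  split=> [l||]; first by case: ifP.
    by rewrite big_ord_recl big_ord1 /= addrK.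
  by rewrite big_ord_recl big_ord1.
have le1 w (i : 'I_(n.+1 + 2)) : @prism R n w -> w 0 i <= 1.
  move=> pw; have [w0 wx wab] := prism_coords pw; rewrite -[i]splitK; case: (split i) => [k|k] /=.
    rewrite -wx (bigD1 k) //= lerDl; apply: sumr_ge0 => l _; exact: w0.
  have h := w0 (rshift n.+1 0); have h' := w0 (rshift n.+1 1).
  move: wab; rewrite /ac /bc => wab.
  case: k => [[|[|//]] hk].
    by rewrite (_ : Ordinal hk = 0); [lra|apply: val_inj].
  by rewrite (_ : Ordinal hk = 1); [lra|apply: val_inj].
have pz : @prism R n z.
  apply: ball_prism hz; split=> // r l; rewrite ord1 /ball /= zE.
  have h1 := y0 l; have h2 := le1 y l py; have h3 := le1 v l pv.
  have [v0 _ _] := prism_coords pv; have h4 := v0 l.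
  rewrite ltr_norml; apply/andP; split; nra.
have [/(_ j) + _ _] := prism_coords pz; rewrite zE yj vj; lra.
Qed.

Lemma pos_interior (e : R) y : 0 < e -> prism y -> (forall j, e <= y 0 j) ->
  rel_interior (@prism R n) y.
Proof.
move=> e0 py ye; split=> //; apply/nbhs_ballP; exists e => //= z yz /affine_coords [zx zab].
apply: coords_prism => // j; have := yz.2 0 j; rewrite /ball /= ltr_norml => /andP [_ h].
have := ye j; lra.
Qed.

Section Simplex.
Variable s : {set 'I_n.+1}.
Definition svert i := if i \in s then pa i else pb i.
Definition simplex : set point := chull (range svert).

Lemma xc_svert k i : xc k (svert i) = (k == i)%:R.
Proof. by rewrite /svert; case: ifP => _; rewrite ?xc_a ?xc_b. Qed.
Lemma ac_svert i : ac (svert i) = (i \in s)%:R.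
Proof. by rewrite /svert; case: ifP => _; rewrite ?ac_a ?ac_b. Qed.
Lemma bc_svert i : bc (svert i) = (i \notin s)%:R.
Proof. by rewrite /svert; case: ifP => _; rewrite ?bc_a ?bc_b. Qed.

Lemma xc_comb (d : 'I_n.+1 -> R) k : xc k (\sum_i d i *: svert i) = d k.
Proof.
rewrite xc_sum (bigD1 k) //= xc_svert eqxx mulr1 big1 ?addr0 // => i ni.
by rewrite xc_svert eq_sym (negbTE ni) mulr0.
Qed.

Lemma svert_vertex i : prism_vertices (svert i).
Proof. by rewrite /svert; case: ifP => _; [left|right]; exists i. Qed.

Lemma simplexP y : simplex y -> exists d : 'I_n.+1 -> R, y = \sum_i d i *: svert i.
Proof.
move=> [m [x [c [hx _ _ ->]]]].
have /choice [f fP] : forall j, exists i, svert i = x j by move=> j; have [i _ e] := hx j; exists i.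
exists (fun i => \sum_(j | f j == i) c j).
rewrite (partition_big f predT) //=; apply: eq_bigr => i _; rewrite scaler_suml.
by apply: eq_bigr => j /eqP <-; rewrite fP.
Qed.

Lemma simplex_a i : simplex (pa i) <-> i \in s.
Proof.
split=> [/simplexP [d e]|si]; last by apply: sub_chull; exists i => //; rewrite /svert si.
have dE k : d k = (k == i)%:R by rewrite -(xc_comb d) -e xc_a.
have : ac (pa i) = (i \in s)%:R.
  rewrite {1}e ac_sum (bigD1 i) //= dE eqxx mul1r ac_svert big1 ?addr0 // => k /negbTE nk.
  by rewrite dE nk mul0r.
by rewrite ac_a; case: (i \in s) => // /eqP; rewrite oner_eq0.
Qed.

(** The barycentre has positive coordinates. *)
Lemma simplex_internal : s != finset.set0 -> s != [set: 'I_n.+1]%SET -> internal_simplex simplex.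
Proof.
move=> /set0Pn [i0 si0] sT; have [i1 si1] : exists i, i \notin s.
  by apply/existsP; rewrite -negb_forall; apply: contraNN sT => /forallP h;
     apply/eqP/setP => i; rewrite inE h.
split.
  exists svert; split=> //; first exact: svert_vertex.
  by move=> c _ e i; rewrite -(xc_comb c) e /xc mxE.
move=> sub; pose e : R := n.+1%:R^-1; have e0 : 0 < e by rewrite invr_gt0 ltr0n.
pose y := \sum_i e *: svert i.
have se : \sum_(i < n.+1) e = 1.
  by rewrite sumr_const card_ord -[RHS](@mulVf R n.+1%:R) ?pnatr_eq0 // mulr_natr.
have sy : simplex y by apply: chull_fin; [move=> i; exists i|move=> i; exact: ltW|exact: se].
have py : @prism R n y by apply: chull_fin; [move=> i; exact: svert_vertex|move=> i; exact: ltW|exact: se].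
have [_ []] := sub y sy; apply: (pos_interior e0) => // j.
rewrite -[j]splitK; case: (split j) => [k|k] /=; first by rewrite -/(xc k y) xc_comb.
have nn (P : pred 'I_n.+1) : 0 <= \sum_(i | P i) e by apply: sumr_ge0 => i _; exact: ltW.
case: k => [[|[|//]] hk].
  rewrite (_ : Ordinal hk = 0) -/(ac y); last exact: val_inj.
  rewrite ac_sum (bigD1 i0) //= ac_svert si0 mulr1 lerDl; apply: sumr_ge0 => i _.
  by rewrite ac_svert mulr_ge0 // ltW.
rewrite (_ : Ordinal hk = 1) -/(bc y); last exact: val_inj.
rewrite bc_sum (bigD1 i1) //= bc_svert si1 mulr1 lerDl; apply: sumr_ge0 => i _.
by rewrite bc_svert mulr_ge0 // ltW.
Qed.
End Simplex.

(** Every coordinate is positive somewhere on an internal simplex, so each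
    column of the prism and both of its ends meet the vertices; as there are
    [n + 1] vertices, each column contains exactly one of them. *)
Lemma internal_simplexP (S : set point) : internal_simplex S ->
  exists s : {set 'I_n.+1}, [/\ s != finset.set0, s != [set: 'I_n.+1]%SET & S = simplex s].
Proof.
move=> [[t [tv _ ->]] nsub].
have [y [sy yint]] : exists y, chull (range t) y /\ rel_interior (@prism R n) y.
  apply: contrapT => no; apply: nsub => y sy; split; last by move=> yi; apply: no; exists y.
  apply: topology_structure.subset_closure; have [m [x [c [hx hc hs ->]]]] := sy.
  by apply: chull_fin => // i; have [k _ <-] := hx i.
have pos := interior_pos yint.
have [m [x [c [hx hc hs ey]]]] := sy.
have hit j : exists i, t i 0 j != 0.
  apply: contrapT => no; have := pos j; rewrite ey coord_sum big1 ?ltxx // => l _.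
  have [i _ <-] := hx l; have [->|nz] := eqVneq (t i 0 j) 0; first by rewrite mulr0.
  by case: no; exists i.
have /choice [col colP] : forall i, exists k, t i = pa k \/ t i = pb k.
  by move=> i; exact: vertexP (tv i).
have colx k i : xc k (t i) = (k == col i)%:R by case: (colP i) => ->; rewrite ?xc_a ?xc_b.
have /choice [loc locP] : forall k, exists i, col i = k.
  move=> k; have [i] := hit (lshift 2 k); rewrite -/(xc k _) colx.
  by have [->|_] := eqVneq k (col i); [exists i|rewrite eqxx].
have loc_inj : injective loc by exact: can_inj locP.
have locK := bij_can_bij (injF_bij loc_inj) locP.
have colI : injective col by exact: bij_inj.
pose s := [set k | `[< exists i, t i = pa k >] ]%SET.
have tE i : t i = svert s (col i).
  rewrite /svert inE; case: asboolP => [[i' e]|no].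
    have /colI ei : col i' = col i; last by rewrite -ei in e *; rewrite e; congr pa;
      have := colx (col i') i'; rewrite e xc_a eqxx; case: eqP => // _ /eqP; rewrite eq_sym oner_eq0.
    have := colx (col i) i'; rewrite e xc_a eqxx; by case: eqP => // _ /eqP; rewrite oner_eq0.
  by case: (colP i) => // e; case: no; exists i.
have rngE : range t = range (svert s).
  apply/seteqP; split=> z [i _ <-]; first by exists (col i).
  by exists (loc i) => //; rewrite tE locP.
exists s; split; last by rewrite /simplex rngE.
- have [i] := hit (rshift n.+1 0); rewrite -/(ac _) tE ac_svert.
  case: (boolP (col i \in s)) => [h _|_]; last by rewrite eqxx.
  by apply/set0Pn; exists (col i).
- have [i] := hit (rshift n.+1 1); rewrite -/(bc _) tE bc_svert.
  case: (boolP (col i \in s)) => [|h _]; first by rewrite eqxx.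
  by apply: contraNneq h => ->; rewrite inE.
Qed.
End PrismSimplices.

(** * The two bijections *)

(** The set [s] is recovered from its simplex as the set of the [i] for which the
    simplex contains [a_i]. *)
Lemma bij_internal_simplices (R : realType) (n : nat) (U : Type)
    (g : {set 'I_n.+1} -> U) (C : U -> Prop) (iso : U -> U -> Prop) :
    (forall s, s != set0 -> s != setT -> C (g s)) ->
    (forall s t, s != set0 -> s != setT -> t != set0 -> t != setT -> iso (g s) (g t) -> s = t) ->
    (forall x, C x -> exists2 s, s != set0 /\ s != setT & iso (g s) x) ->
  bij_iso_classes (@internal_simplex R n) C iso.
Proof.
move=> gC ginj gsurj.
pose f (S : 'rV[R]_(n.+1 + 2) -> Prop) := g [set i | `[< S (prism_a R i) >] ].
have fE s : f (simplex s) = g s.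
  congr g; apply/setP => i; rewrite inE.
  by apply/asboolP/idP => [/simplex_a|si]; last exact/simplex_a.
exists f; split=> [S|S T|x /gsurj [s [s0 sT] i]].
- by move=> /internal_simplexP [s [s0 sT ->]]; rewrite fE; exact: gC.
- move=> /internal_simplexP [s [s0 sT ->]] /internal_simplexP [t [t0 tT ->]].
  by rewrite !fE => /ginj -> //.
by exists (simplex s); [exact: simplex_internal|rewrite fE].
Qed.

Theorem proposition3p2 (R : realType) (K : fieldType) (n : nat) (hn : (1 <= n)%N) :
  bij_iso_classes (@internal_simplex R n)
    (fun X : rmod (preproj K n) * rmod (preproj K n) =>
       tau_rigid_pair X /\ indec_pair X)
    (@pair_iso K (preproj K n))
  /\
  bij_iso_classes (@internal_simplex R n)
    (fun T : pcomplex (preproj K n) =>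
       [/\ two_term T, presilting T & Kindec T])
    (@Kiso K (preproj K n)).
Proof.
case: n hn => [//|m] _; split.
  apply: (@bij_internal_simplices R m.+1 _ (@zzpair K m)).
  - exact: zzpair_tau_rigid.
  - exact: zzpair_inj.
  - by move=> X [tX iX]; exact: zzpair_surj.
apply: (@bij_internal_simplices R m.+1 _ (@zzcx K m)).
- by move=> s s0 sT; split; [exact: zzcx_two_term|exact: zzcx_presilting|exact: zzcx_Kindec].
- by move=> s t s0 sT _ _; exact: zzcx_inj.
- by move=> T [hT pT iT]; exact: presilting_zigzag.
Qed.
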